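(* The self-adjoint extensions of $\mathcal H_0$ whose domain satisfies $$\phi'(L)=\psi_1'(L)=\cdots=\psi_N'(L)$$ form the four-real-parameter family $\{\mathcal H_{a,c,\beta}\}_{a,c\in\mathbb R,\ \beta\in\mathbb C}$, where $\mathcal H_{a,c,\beta}$ acts as $-\frac{d^2}{dx^2}$ on each edge and $$D(\mathcal H_{a,c,\beta})=\Bigl\{\mathbf U\in H^2(\mathcal G)\ \Big|\ \phi'(L)=\psi_1'(L)=\cdots=\psi_N'(L),\ \ \phi'(-L)=a\,\phi(-L)+\beta\,\sigma,\ \ -\phi'(L)=\bar\beta\,\phi(-L)+c\,\sigma\Bigr\},$$ with $\sigma=\phi(L)-\sum_{j=1}^N\psi_j(L)$.
   Context: Let $L>0$, $N\ge1$. The $\mathcal T$-shaped graph $\mathcal G$ has edges $e_0=[-L,L]$ and $e_j=[L,\infty)$, $j=1,\dots,N$, joined at the vertex $L$, with $-L$ an independent terminal vertex. Functions on $\mathcal G$ are tuples $\mathbf U=(\phi,\psi_1,\dots,\psi_N)$ with $\phi$ on $[-L,L]$, $\psi_j$ on $[L,\infty)$ (complex valued). $L^2(\mathcal G)=L^2(-L,L)\oplus\bigoplus_{j=1}^NL^2(L,\infty)$ and $H^2(\mathcal G)=H^2(-L,L)\oplus\bigoplus_{j=1}^NH^2(L,\infty)$. $\mathcal H_0$ is the symmetric operator in $L^2(\mathcal G)$ acting as $-\frac{d^2}{dx^2}$ on each edge, with domain $C_0^\infty(-L,L)\oplus\bigoplus_{j=1}^NC_0^\infty(L,\infty)$.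
   Formalization: Only self-adjoint extensions on whose domain (φ(-L), σ) takes every value in C² are classified; without this the claim fails, e.g. for φ(-L)=0, φ'(L)=ψ_j'(L)=0, which is self-adjoint and coupled but not of the form H_{a,c,β}. *)

(* Defs.v *)
From HB Require Import structures.
From mathcomp Require Import all_boot all_order all_algebra.
From mathcomp Require Import complex.
From mathcomp Require Import all_classical all_reals all_analysis.
Import Order.TTheory GRing.Theory Num.Theory numFieldNormedType.Exports.

Set Implicit Arguments.
Unset Strict Implicit.
Unset Printing Implicit Defensive.

Local Open Scope classical_set_scope.
Local Open Scope ring_scope.
Local Open Scope complex_scope.

(** * Complex-valued functions on an open interval [I] of the line

    Elements of L^2(I) are represented by functions on the whole line, and
    only their values on [I], up to Lebesgue-null sets, matter. *)

Definition sqnorm (R : realType) (z : R[i]) : R :=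
  (complex.Re z) ^+ 2 + (complex.Im z) ^+ 2.

Definition Cint (R : realType) (I : set R) (f : R -> R[i]) : R[i] :=
  (\int[@lebesgue_measure R]_(x in I) complex.Re (f x))
  +i* (\int[@lebesgue_measure R]_(x in I) complex.Im (f x)).

Definition L2 (R : realType) (I : set R) (u : R -> R[i]) : Prop :=
  [/\ measurable_fun I (fun x => complex.Re (u x)),
      measurable_fun I (fun x => complex.Im (u x)) &
      (\int[@lebesgue_measure R]_(x in I) (sqnorm (u x))%:E < +oo)%E].

Definition Cderive (R : realType) (f : R -> R[i]) : R -> R[i] :=
  fun x => (derive1 (fun y => complex.Re (f y)) x)
           +i* (derive1 (fun y => complex.Im (f y)) x).

Definition smooth (R : realType) (f : R -> R) : Prop :=
  forall (n : nat) (x : R), derivable (derive1n n f) x 1.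

(** The space C_0^oo(I): the support is compact and contained in [I]. *)
Definition test_function (R : realType) (I : set R) (f : R -> R[i]) : Prop :=
  [/\ smooth (fun x => complex.Re (f x)),
      smooth (fun x => complex.Im (f x)) &
      exists K : set R,
        [/\ compact K, K `<=` I & forall x, ~ K x -> f x = 0]].

(** [v] is the distributional derivative of [u] on [I]. *)
Definition weak_derivative (R : realType) (I : set R) (u v : R -> R[i])
    : Prop :=
  forall f : R -> R[i], test_function I f ->
    Cint I (fun x => u x * Cderive f x) = - Cint I (fun x => v x * f x).

Definition H2 (R : realType) (I : set R) (u : R -> R[i]) : Prop :=
  L2 I u /\ exists v w : R -> R[i],
    [/\ L2 I v, L2 I w, weak_derivative I u v & weak_derivative I v w].

(** The weak derivative as a function; it is determined by [u] almost
    everywhere on [I], and is junk (zero) when [u] has none in L^2(I). *)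
Definition wderiv (R : realType) (I : set R) (u : R -> R[i]) : R -> R[i] :=
  xget (fun=> 0) [set v | L2 I v /\ weak_derivative I u v].

(** Pointwise values of a function known only almost everywhere: the value at
    [p] of its representative that is continuous up to the end points of [I].
    Such a representative exists, and is unique on [closure I], for members of
    H^1(I). *)
Definition is_trace (R : realType) (I : set R) (u : R -> R[i]) (p : R)
    (t : R[i]) : Prop :=
  exists g : R -> R[i],
    [/\ {within closure I, continuous (fun x => complex.Re (g x))},
        {within closure I, continuous (fun x => complex.Im (g x))},
        ae_eq (@lebesgue_measure R) I u g &
        g p = t].

Definition trace (R : realType) (I : set R) (u : R -> R[i]) (p : R) : R[i] :=
  xget 0 [set t | is_trace I u p t].

(** * The T-shaped graph

    The edge [None] is e_0 and the edge [Some j] is e_(j+1), for [j < N]. *)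

Definition edge (N : nat) : finType := option 'I_N.

Definition edge_interior (R : realType) (N : nat) (L : R) (e : edge N)
    : set R :=
  if e is Some _ then `]L, +oo[%classic else `]- L, L[%classic.

Definition gfun (R : realType) (N : nat) : Type := edge N -> R -> R[i].

Definition L2G (R : realType) (N : nat) (L : R) (U : gfun R N) : Prop :=
  forall e, L2 (edge_interior L e) (U e).

Definition H2G (R : realType) (N : nat) (L : R) (U : gfun R N) : Prop :=
  forall e, H2 (edge_interior L e) (U e).

Definition ae_eqG (R : realType) (N : nat) (L : R) (U V : gfun R N) : Prop :=
  forall e, ae_eq (@lebesgue_measure R) (edge_interior L e) (U e) (V e).

Definition innerG (R : realType) (N : nat) (L : R) (U V : gfun R N) : R[i] :=
  \sum_(e : edge N) Cint (edge_interior L e) (fun x => U e x * (V e x)^*).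

Definition sqnormG (R : realType) (N : nat) (L : R) (U : gfun R N) : \bar R :=
  (\sum_(e : edge N)
     \int[@lebesgue_measure R]_(x in edge_interior L e) (sqnorm (U e x))%:E)%E.

(** ** Unbounded operators in L^2(G)

    An operator is its graph: [A U F] means that [U] belongs to the domain of
    [A] and [A U = F].  Since elements of L^2(G) are classes of functions, the
    graph is closed under almost everywhere equality. *)

Definition oper (R : realType) (N : nat) : Type := gfun R N -> gfun R N -> Prop.

Definition dom (R : realType) (N : nat) (A : oper R N) (U : gfun R N) : Prop :=
  exists F, A U F.

Definition is_operator (R : realType) (N : nat) (L : R) (A : oper R N) : Prop :=
  [/\ forall U F, A U F -> L2G L U /\ L2G L F,
      forall U F U' F', A U F -> L2G L U' -> L2G L F' ->
        ae_eqG L U U' -> ae_eqG L F F' -> A U' F',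
      A (fun _ _ => 0) (fun _ _ => 0),
      forall (z : R[i]) U F V G, A U F -> A V G ->
        A (fun e x => z * U e x + V e x) (fun e x => z * F e x + G e x) &
      forall U F F', A U F -> A U F' -> ae_eqG L F F'].

Definition densely_defined (R : realType) (N : nat) (L : R)
    (A : oper R N) : Prop :=
  forall U, L2G L U -> forall eps : R, 0 < eps ->
    exists V, dom A V /\ (sqnormG L (fun e x => U e x - V e x)%R < eps%:E)%E.

Definition adjoint (R : realType) (N : nat) (L : R) (A : oper R N)
    : oper R N := fun V G =>
  [/\ L2G L V, L2G L G & forall U F, A U F -> innerG L F V = innerG L U G].

Definition self_adjoint (R : realType) (N : nat) (L : R) (A : oper R N)
    : Prop :=
  [/\ is_operator L A, densely_defined L A &
      forall U F, A U F <-> adjoint L A U F].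

Definition extends (R : realType) (N : nat) (A B : oper R N) : Prop :=
  forall U F, B U F -> A U F.

Definition H0 (R : realType) (N : nat) (L : R) : oper R N := fun U F =>
  [/\ L2G L U, L2G L F &
      exists V : gfun R N,
        [/\ forall e, test_function (edge_interior L e) (V e),
            ae_eqG L U V &
            ae_eqG L F (fun e x => - Cderive (Cderive (V e)) x)]].

Definition bval (R : realType) (N : nat) (L : R) (U : gfun R N)
    (e : edge N) (p : R) : R[i] :=
  trace (edge_interior L e) (U e) p.

Definition bder (R : realType) (N : nat) (L : R) (U : gfun R N)
    (e : edge N) (p : R) : R[i] :=
  trace (edge_interior L e) (wderiv (edge_interior L e) (U e)) p.

Definition sigma (R : realType) (N : nat) (L : R) (U : gfun R N) : R[i] :=
  bval L U None L - \sum_(j < N) bval L U (Some j) L.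

Definition derivative_coupling (R : realType) (N : nat) (L : R)
    (U : gfun R N) : Prop :=
  forall j : 'I_N, bder L U None L = bder L U (Some j) L.

Definition Habc_dom (R : realType) (N : nat) (L : R) (a c : R)
    (beta : R[i]) (U : gfun R N) : Prop :=
  [/\ H2G L U, derivative_coupling L U,
      bder L U None (- L) = a%:C * bval L U None (- L) + beta * sigma L U &
      - bder L U None L = beta^* * bval L U None (- L) + c%:C * sigma L U].

Definition Habc (R : realType) (N : nat) (L : R) (a c : R) (beta : R[i])
    : oper R N := fun U F =>
  [/\ Habc_dom L a c beta U, L2G L F &
      ae_eqG L F (fun e x =>
        - wderiv (edge_interior L e) (wderiv (edge_interior L e) (U e)) x)].

(** The pair (phi(-L), sigma) is unconstrained on the domain of [A].  This
    excludes the limiting self-adjoint conditions ("infinite parameters") that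
    impose a linear relation between phi(-L) and sigma, such as
    phi(-L) = 0 = phi'(L); these are of no form [Habc a c beta]. *)
Definition free_values (R : realType) (N : nat) (L : R) (A : oper R N) : Prop :=
  forall z s : R[i], exists U, [/\ dom A U, bval L U None (- L) = z & sigma L U = s].

(* Main.v *)
(* A self-adjoint extension [A] of H_0 is contained in the adjoint of H_0.
   Testing against C_0^oo functions on one edge shows that a pair (V, G) of that
   adjoint satisfies V'' = -G weakly; by du Bois-Reymond, V and V' then have
   absolutely continuous representatives, and V' is square integrable, so that V
   is in H^2(G) and G = -V''.  When the derivatives at L are coupled, Green's
   formula turns <AU, V> - <U, AV> into the boundary form
     sigma(U) d(V)^* - d(U) sigma(V)^* - z(U) e(V)^* + e(U) z(V)^*,
   where z, e are the values of phi, phi' at -L and d is the common derivative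
   at L.  This form vanishes on the domain of [A]; inserting elements with
   (z, sigma) = (1, 0) and (0, 1) yields the boundary conditions, and maximality
   of [A] gives equality.  Conversely, the domain of H_{a,c,beta} realizes every
   choice of z, sigma and psi_j(L), which is enough to read the coupling and
   the boundary conditions off the adjoint. *)
Require Import Defs.
From mathcomp Require Import all_boot all_order all_algebra.
From mathcomp Require Import complex ring lra.
From mathcomp Require Import all_classical all_reals all_analysis measurable_realfun.
Import Order.TTheory GRing.Theory Num.Theory numFieldNormedType.Exports.
Set Implicit Arguments.
Unset Strict Implicit.
Unset Printing Implicit Defensive.
Local Open Scope classical_set_scope.
Local Open Scope ring_scope.

(** * Smooth cut-off functions *)

Section Smooth.
Context {R : realType}.
Implicit Types f g : R -> R.

(** Absolutely continuous functions are written [c + prim g], with the primitive taken from minus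
    infinity of a function extended by zero outside the edge. Facts about them reduce to integration
    by parts for primitives of integrable functions, where an almost everywhere product rule would
    not suffice. Both kinds of edge are handled as open intervals bounded below. They differ mainly
    in two places. On the bounded edge the first derivative is bounded, whereas on a ray its square
    integrability must be extracted from that of u and u''. On a ray the boundary term at infinity
    must also vanish, which holds because the Wronskian and its derivative are both integrable. The
    parameters form the Hermitian matrix M with rows (a, beta) and (beta^*, c), and the boundary
    conditions say that M sends (z, sigma) to (e, - d). Symmetry of the operator is the Hermitian
    property of M. For the adjoint, Green's formula has to be used before the second element is
    known to be coupled, so it is stated with coupling on one side only. *)

Definition flat (n : nat) (x : R) : R :=
  if 0 < x then x^-1 ^+ n * expR (- x^-1) else 0.

(** The exponential series gives y^(n+2) <= (n+2)! e^y at y = 1/x. The square leaves a factor x to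
    spare, which differentiability at 0 needs. *)
Lemma flat_bound n (x : R) : `|flat n x| <= (n.+2)`!%:R * x ^+ 2.
Proof.
rewrite /flat; case: ifPn => x0; last by rewrite normr0 mulr_ge0 ?sqr_ge0.
have y0 : 0 < x^-1 by rewrite invr_gt0.
rewrite ger0_norm; last by rewrite mulr_ge0 ?expR_ge0 ?exprn_ge0 ?ltW.
have := expR_ge1Dxn n.+1 (ltW y0).
set F := (_`!)%:R => h.
have F0 : 0 < F by rewrite ltr0n fact_gt0.
have h' : x^-1 ^+ n.+2 <= F * expR x^-1.
  rewrite -ler_pdivrMl // mulrC; apply: le_trans h; lra.
rewrite expRN ler_pdivrMr ?expR_gt0 //.
have -> : F * x ^+ 2 * expR x^-1 = (F * expR x^-1) * x ^+ 2 by ring.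
have -> : x^-1 ^+ n = x^-1 ^+ n.+2 * x ^+ 2.
  rewrite -addn2 exprD -mulrA -exprMn mulVf ?gt_eqF // expr1n mulr1 //.
by rewrite ler_pM2r // exprn_gt0.
Qed.

(** The functions x^(-n) e^(-1/x), continued by 0, are closed under differentiation up to linear
    combinations; hence all higher derivatives at 0 are covered at once. *)
Lemma is_derive_flat n (x : R) :
  is_derive x 1 (flat n) (flat n.+2 x - n%:R * flat n.+1 x).
Proof.
case: (ltgtP x 0) => [x0|x0|->]; last first.
- rewrite {2 3}/flat ltxx mulr0 subr0.
  (* This slope is at most (n+2)! |z| in absolute value, hence continuous at 0, where division by
     zero gives it the right value 0. *)
  apply/is_derive1_caratheodory; exists (fun z => flat n z / z); split.
  + move=> z; have [->|z0] := eqVneq z 0; first by rewrite !subrr mulr0.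
    by rewrite subr0 {2}/flat ltxx subr0 divfK.
  + rewrite /prop_for /continuous_at invr0 mulr0.
    apply/cvgrPdist_le => e e0 /=.
    pose C : R := (n.+2)`!%:R.
    have C0 : 0 < C by rewrite ltr0n fact_gt0.
    near=> z.
    rewrite sub0r normrN normrM.
    have [->|z0] := eqVneq z 0; first by rewrite invr0 normr0 mulr0 ltW.
    rewrite normfV ler_pdivrMr ?normr_gt0 //.
    apply: (le_trans (flat_bound n z)); rewrite -/C -[z ^+ 2]real_normK ?num_real // expr2 mulrA.
    rewrite ler_pM2r ?normr_gt0 // -ler_pdivlMl //.
    near: z; apply/nbhs_ballP; exists (C^-1 * e) => /=; first by rewrite mulr_gt0 ?invr_gt0.
    by move=> y; rewrite /ball /= sub0r normrN => /ltW.
  + by rewrite invr0 mulr0.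
- have E : \forall y \near x, (fun y => y^-1 ^+ n * expR (- y^-1)) y = flat n y.
    near=> y; rewrite /flat ifT //; near: y; exact: lt_nbhsr.
  apply: (near_eq_is_derive E).
  have x00 : x != 0 by rewrite gt_eqF.
  have H1 : is_derive x 1 (fun y : R => y^-1) (- x ^- 2).
    have := @is_deriveV R id x 1 1 x00 (is_derive_id x 1).
    by move=> h; apply: is_derive_eq h _; rewrite /GRing.scale /= mulr1.
  have H2 : is_derive x 1 (fun y : R => y^-1 ^+ n) (n%:R * x^-1 ^+ n.-1 * - x ^- 2).
    rewrite -[X in is_derive _ _ X _]exprfctE; exact: (is_deriveX n H1).
  have H3 : is_derive x 1 (fun y : R => - y^-1) (- - x ^- 2).
    exact: is_deriveN.
  have H4 : is_derive x 1 (fun y : R => expR (- y^-1)) (expR (- x^-1) * - - x ^- 2).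
    exact: (@is_derive1_comp _ expR (fun y => - y^-1)).
  have H5 := is_deriveM H2 H4.
  apply: is_derive_eq H5 _; rewrite /GRing.scale /= /flat x0.
  case: n {H2 E} => [|n] /=; first by rewrite !expr0 !expr2; field.
  rewrite -!exprVn !exprS; ring.
- have E : \forall y \near x, (cst (0:R)) y = flat n y.
    near=> y; rewrite /flat ifF //; apply/negbTE; rewrite -leNgt; apply: ltW; near: y; exact: lt_nbhsl.
  apply: (near_eq_is_derive E).
  by rewrite /flat ltNge (ltW x0) /= mulr0 subr0; exact: is_derive_cst.
Unshelve. all: by end_near.
Qed.

(** A syntactic class stable under differentiation: derivatives of all orders exist by induction,
    without a formula for the n-th derivative of a product or a composite. *)
Inductive elem_smooth : (R -> R) -> Prop :=
| elem_cst c : elem_smooth (fun=> c)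
| elem_id : elem_smooth (fun x => x)
| elem_flat n : elem_smooth (flat n)
| elem_add f g : elem_smooth f -> elem_smooth g -> elem_smooth (fun x => f x + g x)
| elem_mul f g : elem_smooth f -> elem_smooth g -> elem_smooth (fun x => f x * g x)
| elem_aff f a b : elem_smooth f -> elem_smooth (fun x => f (a * x + b)).

Lemma elem_smooth_derive f : elem_smooth f ->
  exists2 g, elem_smooth g & forall x, is_derive x (1:R) f (g x).
Proof.
elim=> [c||n|{}f g _ [f' ef df] _ [g' eg dg]|{}f g ef0 [f' ef df] eg0 [g' eg dg]|{}f a b ef0 [f' ef df]].
- by exists (fun=> 0); [exact: elem_cst|move=> x; exact: is_derive_cst].
- by exists (fun=> 1); [exact: elem_cst|move=> x; exact: is_derive_id].
- exists (fun x => flat n.+2 x + (- n%:R) * flat n.+1 x).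
    by apply: elem_add; [exact: elem_flat|apply: elem_mul; [exact: elem_cst|exact: elem_flat]].
  by move=> x; rewrite mulNr; exact: is_derive_flat.
- by exists (fun x => f' x + g' x); [exact: elem_add|move=> x; exact: is_deriveD].
- exists (fun x => f x * g' x + g x * f' x).
    by apply: elem_add; apply: elem_mul.
  by move=> x; exact: is_deriveM.
- exists (fun x => f' (a * x + b) * a).
    by apply: elem_mul; [exact: elem_aff|exact: elem_cst].
  move=> x; apply: (@is_derive1_comp _ f (fun x => a * x + b)).
  have := is_deriveD (is_deriveZ a (is_derive_id x (1:R))) (is_derive_cst b x (1:R)).
  by move=> h; apply: is_derive_eq h _; rewrite /GRing.scale /= mulr1 addr0.
Qed.

Lemma elem_smooth_smooth f : elem_smooth f -> smooth f.
Proof.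
move=> ef n x; have : elem_smooth (derive1n n f).
  elim: n => [//|n IH]; rewrite derive1nS.
  have [g eg dg] := elem_smooth_derive IH.
  suff -> : derive1 (derive1n n f) = g by [].
  by apply/funext => y; rewrite derive1E; exact: (derive_val (is_derive := dg y)).
by move=> /elem_smooth_derive[g _ /(_ x) []].
Qed.

(** For c > 0, [flat 0 (n.+1%:R * c)] is e^(-1/((n+1) c)), so these bumps have values in [0, 1] and
    converge pointwise to the indicator of ]a, b[. *)
Definition hat (n : nat) (a b t : R) : R :=
  flat 0 (n.+1%:R * (t - a)) * flat 0 (n.+1%:R * (b - t)).

Lemma smooth_hat n a b : smooth (hat n a b).
Proof.
apply: elem_smooth_smooth.
have := elem_mul (elem_aff n.+1%:R (- (n.+1%:R * a)) (elem_flat 0))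
                 (elem_aff (- n.+1%:R) (n.+1%:R * b) (elem_flat 0)).
congr elem_smooth; apply/funext => t; rewrite /hat; congr (flat _ _ * flat _ _); ring.
Qed.

Lemma flat0_ge0 x : 0 <= flat 0 x.
Proof. by rewrite /flat; case: ifP => // _; rewrite expr0 mul1r expR_ge0. Qed.

Lemma flat0_le1 x : flat 0 x <= 1.
Proof.
rewrite /flat; case: ifP => // x0; rewrite expr0 mul1r expR_le1.
by rewrite oppr_le0 invr_ge0 ltW.
Qed.

Lemma hat_ge0 n a b t : 0 <= hat n a b t.
Proof. by rewrite mulr_ge0 ?flat0_ge0. Qed.

Lemma hat_le1 n a b t : hat n a b t <= 1.
Proof. by rewrite mulr_ile1 ?flat0_ge0 ?flat0_le1. Qed.

Lemma hat_eq0 n a b t : ~~ (a < t < b) -> hat n a b t = 0.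
Proof.
rewrite negb_and -!leNgt /hat /flat => /orP[h|h].
- by rewrite ifF ?mul0r //; apply/negbTE; rewrite -leNgt pmulr_rle0 // subr_le0.
- by rewrite [in X in _ * X]ifF ?mulr0 //; apply/negbTE; rewrite -leNgt pmulr_rle0 // subr_le0.
Qed.

Lemma hat_gt0 n a b t : a < t < b -> 0 < hat n a b t.
Proof.
move=> /andP[h1 h2]; rewrite /hat /flat !ifT ?pmulr_rgt0 ?subr_gt0 //.
by rewrite ?expr0 ?mul1r expR_gt0.
by rewrite ?expr0 ?mul1r expR_gt0.
Qed.

Lemma cvg_hat a b t : a < t < b -> hat n a b t @[n --> \oo] --> (1 : R).
Proof.
move=> /andP[at_ tb].
have H c : 0 < c -> flat 0 (n.+1%:R * c) @[n --> \oo] --> (1:R).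
  move=> c0.
  have -> : (fun n => flat 0 (n.+1%:R * c)) = expR \o (fun n => - (c^-1 * n.+1%:R^-1)).
    apply/funext => n /=; rewrite /flat pmulr_rgt0 // c0 expr0 mul1r invfM mulrC //.
  rewrite -[X in _ --> X](@expR0 R); apply: continuous_cvg; first exact: continuous_expR.
  suff : - (c^-1 * (n.+1%:R : R)^-1) @[n --> \oo] --> - (c^-1 * 0) by rewrite mulr0 oppr0.
  by apply: cvgN; apply: cvgMr; exact: cvg_harmonic.
rewrite -[X in _ --> X](mulr1 1); apply: cvgM; apply: H; by rewrite subr_gt0.
Qed.
End Smooth.

(** * Primitives of integrable functions *)

Section Prim.
Context {R : realType}.
Notation mu := (@lebesgue_measure R).
Implicit Types f g : R -> R.

Lemma ae_imply (P Q : R -> Prop) : (forall x, P x -> Q x) ->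
  {ae mu, forall x, P x} -> {ae mu, forall x, Q x}.
Proof. by move=> PQ; apply: filterS => //; exact: (ae_filter_ringOfSetsType mu). Qed.

Lemma ae_imply2 (P Q S : R -> Prop) : (forall x, P x -> Q x -> S x) ->
  {ae mu, forall x, P x} -> {ae mu, forall x, Q x} -> {ae mu, forall x, S x}.
Proof. by move=> PQ; apply: filterS2 => //; exact: (ae_filter_ringOfSetsType mu). Qed.

(** Integrability on every left ray instead of the line: an L^2 function on an unbounded edge,
    extended by zero, need not be integrable, yet it has a primitive based at minus infinity. *)
Definition lint g := forall x, mu.-integrable `]-oo, x] (EFin \o g).
Definition prim g x : R := \int[mu]_(t in `]-oo, x]) g t.

Lemma lint_subset g x (A : set R) : lint g -> measurable A -> A `<=` `]-oo, x] ->
  mu.-integrable A (EFin \o g).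
Proof. by move=> lg mA Ax; apply: integrableS (lg x). Qed.

Lemma lint_itv g x y : lint g -> mu.-integrable `]x, y] (EFin \o g).
Proof.
move=> lg; apply: (lint_subset (x := y)) => // t /=.
by rewrite !in_itv /= => /andP[].
Qed.

Lemma lint_measurable g : lint g -> measurable_fun [set: R] g.
Proof.
move=> lg; have -> : [set: R] = \bigcup_n `]-oo, (n%:R : R)]%classic.
  apply/esym/seteqP; split=> // x _; exists (`|Num.ceil x|)%N => //=; rewrite in_itv /=.
  apply: (le_trans (ceil_ge x)).
  by rewrite natr_absz ler_int ler_norm.
apply/measurable_fun_bigcup => // n.
by apply/measurable_EFinP; exact: (measurable_int mu).
Qed.

Lemma lintD f g : lint f -> lint g -> lint (fun t => f t + g t).
Proof. by move=> lf lg x; exact: (integrableD _ (lf x) (lg x)). Qed.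

Lemma lintN f : lint f -> lint (fun t => - f t).
Proof. by move=> lf x; exact: (integrableN (lf x)). Qed.

Lemma lintB f g : lint f -> lint g -> lint (fun t => f t - g t).
Proof. by move=> lf lg; apply: lintD => //; exact: lintN. Qed.

Lemma lintZ k f : lint f -> lint (fun t => k * f t).
Proof. by move=> lf x; exact: (integrableZl _ k (lf x)). Qed.

Lemma lint_norm f : lint f -> lint (fun t => `|f t|).
Proof. by move=> lf x; exact: (integrable_norm (lf x)). Qed.

Lemma lintM f g : lint f -> measurable_fun [set: R] g ->
  (forall x, exists M, forall t, t <= x -> `|g t| <= M) -> lint (fun t => f t * g t).
Proof.
move=> lf mg bg x; have [M hM] := bg x.
apply: (@le_integrable _ _ _ mu _ _ _ (EFin \o (fun t => M * f t))).
- by [].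
- apply/measurable_EFinP; apply: measurable_funM; last exact: measurable_funTS.
  by apply: measurable_funTS; exact: lint_measurable.
- move=> t /=; rewrite in_itv /= => tx; rewrite lee_fin !normrM mulrC.
  by rewrite ler_wpM2r // (le_trans (hM t tx)) // ler_norm.
- exact: lintZ.
Qed.

Lemma primB g x y : lint g -> x <= y -> prim g y - prim g x = \int[mu]_(t in `]x, y]) g t.
Proof. by move=> lg xy; rewrite Rintegral_itvB // lg. Qed.

Lemma primD f g x : lint f -> lint g -> prim (fun t => f t + g t) x = prim f x + prim g x.
Proof. by move=> lf lg; rewrite /prim RintegralD. Qed.

Lemma primZ k f x : lint f -> prim (fun t => k * f t) x = k * prim f x.
Proof. by move=> lf; rewrite /prim RintegralZl. Qed.

Lemma primBf f g x : lint f -> lint g -> prim (fun t => f t - g t) x = prim f x - prim g x.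
Proof. by move=> lf lg; rewrite /prim RintegralB. Qed.

Lemma prim_ge0 g x y : lint g -> (forall t, 0 <= g t) -> x <= y -> prim g x <= prim g y.
Proof. by move=> lg g0 xy; rewrite -subr_ge0 primB //; exact: Rintegral_ge0. Qed.

Lemma le_prim f g x y : lint f -> lint g -> x <= y ->
  (forall t, x < t <= y -> f t <= g t) -> prim f y - prim f x <= prim g y - prim g x.
Proof.
move=> lf lg xy fg; rewrite !primB //; apply: le_Rintegral => //; exact: lint_itv.
Qed.

Lemma prim_norm g x y : lint g -> x <= y ->
  `|prim g y - prim g x| <= prim (fun t => `|g t|) y - prim (fun t => `|g t|) x.
Proof.
move=> lg xy; rewrite !primB //; last exact: lint_norm.
by apply: le_normr_Rintegral => //; exact: lint_itv.
Qed.

Lemma continuous_prim g : lint g -> continuous (prim g).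
Proof.
move=> lg x; apply/cvgrPdist_le => e e0.
(* The cut beyond x + 1 makes the function integrable on the line, so that absolute continuity of
   the integral applies near x. *)
pose h := g \_ (`]-oo, x + 1]%classic : set R).
have ih : mu.-integrable setT (EFin \o h).
  by rewrite -restrict_EFin; apply/integrable_restrict => //=; rewrite setTI.
have [d [d0 H]] := integral_normr_continuous ih e0.
have K y z : y <= z -> z <= x + 1 -> z - y < d -> `|prim g z - prim g y| <= e.
  move=> yz zx zyd; apply: (le_trans (prim_norm lg yz)); rewrite primB //; last exact: lint_norm.
  have myz : (mu `]y, z]%classic < d%:E)%E.
    rewrite lebesgue_measure_itv /= lte_fin; case: ifPn => _; last by rewrite lte_fin.
    by rewrite -EFinD lte_fin.
  have := ltW (H `]y, z]%classic (measurable_itv _) myz); congr (_ <= _); apply: eq_Rintegral => t.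
  rewrite inE /= in_itv /= => /andP[_ tz]; rewrite /h patchE ifT // inE /= in_itv /=.
  exact: le_trans zx.
near=> y; have [xy|yx] := leP x y.
- rewrite distrC; apply: K => //.
    by apply: ltW; near: y; apply: lt_nbhsl; rewrite ltrDl.
  rewrite ltrBlDr; near: y; apply: lt_nbhsl; rewrite ltrDr //.
- apply: K; [exact: ltW|by rewrite lerDl|].
  rewrite ltrBlDl -ltrBlDr; near: y; apply: lt_nbhsr; rewrite ltrBlDr ltrDl //.
Unshelve. all: by end_near.
Qed.

Lemma measurable_prim g : lint g -> measurable_fun [set: R] (prim g).
Proof. by move=> lg; exact: continuous_measurable_fun (continuous_prim lg). Qed.

Lemma prim_bounded c g x : lint g -> exists M, forall t, t <= x -> `|c + prim g t| <= M.
Proof.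
move=> lg; exists (`|c| + prim (fun t => `|g t|) x) => t tx.
apply: (le_trans (ler_normD _ _)); rewrite lerD2l.
apply: (le_trans _ (prim_ge0 (lint_norm lg) _ tx)) => //.
by apply: le_normr_Rintegral.
Qed.

Lemma ae_derive_prim g : lint g ->
  {ae mu, forall x, derivable (prim g) x 1 /\ derive1 (prim g) x = g x}.
Proof.
move=> lg; apply: FTC1Ny => //; split.
- exact: lint_measurable.
- exact: openT.
- move=> K _ cK; have [M [Mr KM]] := compact_bounded cK.
  have sK : K `<=` `]-oo, M + 1].
    move=> x Kx /=; rewrite in_itv /=; apply: (le_trans (ler_norm x)).
    by apply: (KM (M + 1)) => //; rewrite ltrDl.
  have /integrableP[_] := lint_subset lg (compact_measurable cK) sK.
  by apply: le_lt_trans; rewrite le_eqVlt; apply/orP; left; apply/eqP/eq_integral.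
Qed.

Lemma is_derive_prim g : lint g -> continuous g -> forall x, is_derive x (1:R) (prim g) (g x).
Proof.
move=> lg cg x; have x1 : x < x + 1 by rewrite ltrDl.
case: (@continuous_FTC1 R g -oo%O x (x + 1) x1 (lg _) _ (cg x)) => [|h1 h2].
  by rewrite ltNyr.
by apply: DeriveDef => //; rewrite -derive1E.
Qed.

(** * Integration by parts for primitives of integrable functions *)

Section by_parts.
Variables (c d : R) (f g : R -> R).
Hypotheses (lf : lint f) (lg : lint g).
Let F t := c + prim f t.
Let G t := d + prim g t.
Let h t := f t * G t + F t * g t.
Let m t := `|f t| + `|g t|.
Let M := prim m.
Let D t := F t * G t - prim h t.

Let lm : lint m. Proof. by apply: lintD; exact: lint_norm. Qed.

Let mF : measurable_fun [set: R] F.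
Proof. by apply: measurable_funD => //; exact: measurable_prim. Qed.

Let mG : measurable_fun [set: R] G.
Proof. by apply: measurable_funD => //; exact: measurable_prim. Qed.

Lemma lint_by_parts : lint h.
Proof.
apply: lintD; first by apply: lintM => // x; apply: prim_bounded.
have -> : (fun t => F t * g t) = (fun t => g t * F t) by apply/funext => t; rewrite mulrC.
by apply: lintM => // x; apply: prim_bounded.
Qed.

Let dF s t : s <= t -> `|F t - F s| <= M t - M s.
Proof.
move=> st; have -> : F t - F s = prim f t - prim f s by rewrite /F; ring.
apply: (le_trans (prim_norm lf st)); apply: le_prim => //; first exact: lint_norm.
by move=> x _; rewrite lerDl.
Qed.

Let dG s t : s <= t -> `|G t - G s| <= M t - M s.
Proof.
move=> st; have -> : G t - G s = prim g t - prim g s by rewrite /G; ring.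
apply: (le_trans (prim_norm lg st)); apply: le_prim => //; first exact: lint_norm.
by move=> x _; rewrite lerDr.
Qed.

Let M_mono s t : s <= t -> M s <= M t.
Proof. by move=> st; apply: prim_ge0 => // x; rewrite addr_ge0. Qed.

(** The increment of the defect is the integral over ]s, t] of (F t - F x) g x - (G x - G s) f x.
    Both brackets are at most M t - M s, and integrating |f| + |g| gives the second factor. *)
Let D_sqr s t : s <= t -> `|D t - D s| <= (M t - M s) ^+ 2.
Proof.
move=> st.
have lfG : lint (fun x => G s * f x) by exact: lintZ.
have lgF : lint (fun x => F t * g x) by exact: lintZ.
have lh := lint_by_parts.
have ls : lint (fun x => G s * f x + F t * g x) by exact: lintD.
have lk : lint (fun x => (G s * f x + F t * g x) - h x) by exact: lintB.
have -> : D t - D s = prim (fun x => (G s * f x + F t * g x) - h x) t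
                    - prim (fun x => (G s * f x + F t * g x) - h x) s.
  have E u : prim (fun x => (G s * f x + F t * g x) - h x) u =
      G s * prim f u + F t * prim g u - prim h u by rewrite primBf // primD // !primZ.
  by rewrite !E /D /F /G; ring.
apply: (le_trans (prim_norm lk st)); rewrite expr2.
have lMm : lint (fun x => (M t - M s) * m x) by exact: lintZ.
have -> : (M t - M s) * (M t - M s) = prim (fun x => (M t - M s) * m x) t
    - prim (fun x => (M t - M s) * m x) s by rewrite !primZ // -mulrBr.
apply: le_prim => //; first exact: lint_norm.
move=> x /andP[/ltW sx xt].
have -> : G s * f x + F t * g x - h x = (F t - F x) * g x - (G x - G s) * f x.
  by rewrite /h; ring.
apply: (le_trans (ler_normB _ _)); rewrite !normrM /m mulrDr addrC lerD // ler_wpM2r //.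
- by apply: (le_trans (dG sx)); rewrite lerD2r M_mono.
- by apply: (le_trans (dF xt)); rewrite lerD2l lerN2 M_mono.
Qed.

Let D_pow n s t : s <= t -> `|D t - D s| <= (M t - M s) ^+ 2 / 2 ^+ n.
Proof.
elim: n s t => [|n IH] s t st; first by rewrite expr0 divr1 D_sqr.
have [] := @IVT R M s t ((M s + M t) / 2) st.
- exact/continuous_subspaceT/continuous_prim.
- by have := M_mono st; move=> h1; rewrite min_l // max_r //; apply/andP; split; lra.
move=> r; rewrite in_itv /= => /andP[sr rt] Mr.
have -> : D t - D s = (D t - D r) + (D r - D s) by ring.
apply: (le_trans (ler_normD _ _)).
apply: (le_trans (lerD (IH _ _ rt) (IH _ _ sr))); rewrite Mr [2 ^+ n.+1]exprS !expr2.
have n0 : (2 ^+ n : R) != 0 by rewrite expf_neq0.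
by rewrite le_eqVlt; apply/orP; left; apply/eqP; field.
Qed.

(* Every dyadic subdivision into pieces of equal [M]-mass halves the quadratic
   error bound, so the defect [D] is constant. *)
Lemma by_parts s t : s <= t -> F t * G t - F s * G s = prim h t - prim h s.
Proof.
move=> st; suff : D t - D s = 0 by rewrite /D => /eqP; rewrite subr_eq0 => /eqP; lra.
apply/eqP; rewrite -normr_le0; apply/ler_addgt0Pl => e e0; rewrite addr0.
have : (M t - M s) ^+ 2 * (2^-1) ^+ n @[n --> \oo] --> (M t - M s) ^+ 2 * 0.
  by apply: cvgMr; apply: cvg_expr; rewrite ger0_norm //; lra.
rewrite mulr0 => /cvgrPdist_le /(_ _ e0) [n _ /(_ n (leqnn n))] /=.
rewrite sub0r normrN ger0_norm; last by rewrite mulr_ge0 ?sqr_ge0 // exprn_ge0 // invr_ge0.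
by apply: le_trans; rewrite exprVn; exact: D_pow.
Qed.
End by_parts.
End Prim.

(** * Weak derivatives of real functions *)

Section TestFunctions.
Context {R : realType}.
Notation mu := (@lebesgue_measure R).
Implicit Types f g h : R -> R.

Definition pair g f : R := \int[mu]_t (g t * f t).

Lemma Rintegral_support h (A : set R) : (forall t, ~ A t -> h t = 0) ->
  \int[mu]_t h t = \int[mu]_(t in A) h t.
Proof.
move=> hA; rewrite [RHS]Rintegral_mkcond; congr Rintegral; apply/funext => t.
by rewrite patchE; case: ifPn => // /negP tA; apply: hA => At; apply: tA; rewrite inE.
Qed.

Lemma Rintegral_supp_prim h y : (forall t, y < t -> h t = 0) -> \int[mu]_t h t = prim h y.
Proof.
move=> h0; apply: Rintegral_support => t /= ty; apply: h0.
by rewrite ltNge; apply/negP => H; apply: ty; rewrite in_itv.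
Qed.

Lemma prim_eq0 h x : (forall t, t <= x -> h t = 0) -> prim h x = 0.
Proof.
move=> h0; rewrite /prim (@eq_Rintegral _ _ _ _ _ (cst 0)) ?Rintegral_cst ?mul0r //.
by move=> t; rewrite inE /= in_itv /= => tx; exact: h0.
Qed.

Lemma is_derive_continuous f g : (forall x, is_derive x (1:R) f (g x)) -> continuous f.
Proof.
move=> df x; have [/derivable1_diffP h _] := df x.
exact: differentiable_continuous.
Qed.

Lemma is_derive1_val f x (d : R) : is_derive x (1:R) f d -> derive1 f x = d.
Proof. by move=> df; rewrite derive1E; exact: (derive_val (is_derive := df)). Qed.

Lemma smooth_is_derive f : smooth f -> forall x, is_derive x (1:R) f (derive1 f x).
Proof. by move=> sf x; rewrite derive1E; exact: (derivableP (sf 0%N x)). Qed.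

Lemma smooth_continuous f : smooth f -> continuous f.
Proof. by move=> /smooth_is_derive; exact: is_derive_continuous. Qed.

Lemma smooth_derive1 f : smooth f -> smooth (derive1 f).
Proof.
move=> sf n x; suff -> : derive1n n (derive1 f) = derive1n n.+1 f by exact: sf.
by rewrite /derive1n -iterSr.
Qed.

Lemma is_derive_smooth f g : (forall x, is_derive x (1:R) f (g x)) -> smooth g -> smooth f.
Proof.
move=> df sg [|n] x; first by have [] := df x.
have -> : derive1n n.+1 f = derive1n n g; last exact: sg.
rewrite /derive1n iterSr; congr iter; apply/funext => y.
by rewrite derive1E; exact: (derive_val (is_derive := df y)).
Qed.

Lemma smoothD f g : smooth f -> smooth g -> smooth (fun x => f x + g x).
Proof.
move=> sf sg; have E n : derive1n n (fun x => f x + g x) = fun x => derive1n n f x + derive1n n g x.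
  elim: n => [//|n IH]; rewrite !derive1nS IH; apply/funext => x.
  by rewrite !derive1E deriveD.
by move=> n x; rewrite E; exact: derivableD.
Qed.

Lemma smoothZ k f : smooth f -> smooth (fun x => k * f x).
Proof.
move=> sf; have E n : derive1n n (fun x => k * f x) = fun x => k * derive1n n f x.
  elim: n => [//|n IH]; rewrite !derive1nS IH; apply/funext => x.
  by rewrite !derive1E (deriveZ k (sf n x)).
by move=> n x; rewrite E; exact: derivableZ.
Qed.

(** Common frame for both kinds of edge. The lower bound [a] makes every left ray meet [I] in a set
    of finite measure. *)
Record open_ray_part (I : set R) (a : R) : Prop := OpenRayPart {
  orp_open : open I;
  orp_convex : forall x y z, I x -> I y -> x <= z <= y -> I z;
  orp_lb : forall x, I x -> a < x;
  orp_ex : exists x, I x }.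

Section interval.
Variables (I : set R) (a : R).
Hypothesis HI : open_ray_part I a.
Let oI := orp_open HI.
Let cI := orp_convex HI.
Let aI := orp_lb HI.
Let I0 := orp_ex HI.

Let mI : measurable I. Proof. exact: open_measurable. Qed.

Lemma lint_restrict h : (forall x, mu.-integrable (`]-oo, x] `&` I) (EFin \o h)) -> lint (h \_ I).
Proof. by move=> ih x; rewrite -restrict_EFin; apply/integrable_restrict. Qed.

Lemma lint_patch h : measurable_fun [set: R] h ->
  (forall x, exists M, forall t, t <= x -> `|h t| <= M) -> lint (h \_ I).
Proof.
move=> mh bh; apply: lint_restrict => x; have [M hM] := bh x.
have mD : measurable (`]-oo, x] `&` I) by exact: measurableI.
apply: measurable_bounded_integrable => //.
- apply: (@le_lt_trans _ _ (mu `]a, x])).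
    apply: le_measure; rewrite ?inE //.
    by move=> t [/=]; rewrite !in_itv /= => tx /aI ->.
  rewrite lebesgue_measure_itv /=; case: ifP => _; last by rewrite ltry.
  by rewrite -EFinD ltry.
- exact: measurable_funTS.
- exists M; split; first exact: num_real.
  move=> z Mz t [/=]; rewrite in_itv /= => tx _.
  exact: (le_trans (hM _ tx) (ltW Mz)).
Qed.

(** Recording a segment around the support makes all supports comparable by their ends, which lie in
    [I]; for y < x the condition forces f = 0. *)
Definition supported f := exists x y, [/\ I x, I y & forall t, ~~ (x <= t <= y) -> f t = 0].

Lemma supported_patch f : supported f -> f \_ I = f.
Proof.
move=> [x [y [Ix Iy f0]]]; apply/funext => t; rewrite patchE; case: ifPn => //.
by rewrite notin_setE => nI; rewrite f0 //; apply/negP => h; apply: nI; exact: cI Ix Iy h.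
Qed.

Lemma supported2 f g : supported f -> supported g -> exists x y,
  [/\ I x, I y, forall t, ~~ (x <= t <= y) -> f t = 0 & forall t, ~~ (x <= t <= y) -> g t = 0].
Proof.
move=> [x [y [Ix Iy f0]]] [x' [y' [Ix' Iy' g0]]].
exists (Num.min x x'), (Num.max y y'); split.
- by rewrite minEle; case: ifP.
- by rewrite maxEle; case: ifP.
- by move=> t; rewrite ge_min le_max => /negP h; apply: f0; apply/negP => /andP[h1 h2]; apply: h; rewrite h1 h2.
- move=> t; rewrite ge_min le_max => /negP h; apply: g0; apply/negP => /andP[h1 h2]; apply: h.
  by rewrite h1 h2 !orbT.
Qed.

Lemma supported_lin k f g : supported f -> supported g -> supported (fun t => f t + k * g t).
Proof.
move=> sf sg; have [x [y [Ix Iy f0 g0]]] := supported2 sf sg.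
by exists x, y; split=> // t h; rewrite f0 // g0 // mulr0 addr0.
Qed.

Definition rtest f := smooth f /\ supported f.

Lemma rtest_lin k f g : rtest f -> rtest g -> rtest (fun t => f t + k * g t).
Proof.
move=> [sf uf] [sg ug]; split; last exact: supported_lin.
exact: (smoothD sf (@smoothZ k g sg)).
Qed.

Lemma supported_derive1 f : supported f -> supported (derive1 f).
Proof.
move=> [x [y [Ix Iy f0]]]; exists x, y; split=> // t ht.
rewrite derive1E (@near_eq_derive _ _ _ f (cst 0)) ?derive_cst //.
move: ht; rewrite negb_and -!ltNge => /orP[h|h]; near=> s; apply: f0;
  rewrite negb_and -!ltNge; apply/orP; [left|right]; near: s.
- exact: lt_nbhsl.
- exact: lt_nbhsr.
Unshelve. all: by end_near.
Qed.

Lemma rtest_derive1 f : rtest f -> rtest (derive1 f).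
Proof. by move=> [sf uf]; split; [exact: smooth_derive1|exact: supported_derive1]. Qed.

Lemma supported_bounded f : continuous f -> supported f -> exists M, forall t, `|f t| <= M.
Proof.
move=> cf [x [y [Ix Iy f0]]].
have : compact (f @` `[x, y]).
  by apply: continuous_compact; [exact: continuous_subspaceT|exact: segment_compact].
move=> /compact_bounded [M [_ hM]]; exists (Num.max (M + 1) 0) => t.
have [h|/f0->] := boolP (x <= t <= y); last by rewrite normr0 le_max lexx orbT.
by rewrite le_max (hM (M + 1)) ?ltrDl //; exists t => //=; rewrite in_itv.
Qed.

Lemma lint_supported f : continuous f -> supported f -> lint f.
Proof.
move=> cf sf; rewrite -(supported_patch sf); apply: lint_patch.
  exact: continuous_measurable_fun.
by have [M hM] := supported_bounded cf sf; move=> x; exists M => t _.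
Qed.

Lemma lint_pair g f : lint g -> continuous f -> supported f -> lint (fun t => g t * f t).
Proof.
move=> lg cf sf; apply: lintM => //; first exact: continuous_measurable_fun.
by have [M hM] := supported_bounded cf sf; move=> x; exists M => t _.
Qed.

Lemma pair_prim g f y : (forall t, y < t -> f t = 0) -> pair g f = prim (fun t => g t * f t) y.
Proof. by move=> f0; apply: Rintegral_supp_prim => t /f0 ->; rewrite mulr0. Qed.

Lemma pair_linr k g f h : lint g -> continuous f -> supported f -> continuous h -> supported h ->
  pair g (fun t => f t + k * h t) = pair g f + k * pair g h.
Proof.
move=> lg cf sf ch sh; have [x [y [Ix Iy f0 h0]]] := supported2 sf sh.
have Y t : y < t -> ~~ (x <= t <= y) by move=> yt; rewrite negb_and -!ltNge yt orbT.
rewrite !(@pair_prim _ _ y); do ?[by move=> t /Y => yt; rewrite ?f0 ?h0 // mulr0 addr0].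
rewrite -primZ; last exact: lint_pair.
rewrite -primD; [|exact: lint_pair|by apply: lintZ; exact: lint_pair].
by congr prim; apply/funext => t; ring.
Qed.

Lemma pair_linl k g f h : lint g -> lint h -> continuous f -> supported f ->
  pair (fun t => g t + k * h t) f = pair g f + k * pair h f.
Proof.
move=> lg lh cf sf; have [x [y [Ix Iy f0]]] := sf.
have Y t : y < t -> f t = 0 by move=> yt; rewrite f0 // negb_and -!ltNge yt orbT.
rewrite !(@pair_prim _ _ y) // -primZ; last exact: lint_pair.
rewrite -primD; [|exact: lint_pair|by apply: lintZ; exact: lint_pair].
by congr prim; apply/funext => t; ring.
Qed.

Lemma rtestP f : rtest f -> [/\ continuous f, supported f, continuous (derive1 f) & supported (derive1 f)].
Proof.
move=> [sf uf]; split => //; first exact: smooth_continuous.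
- by apply: smooth_continuous; exact: smooth_derive1.
- exact: supported_derive1.
Qed.

Lemma rtest_prim f : rtest f -> f = prim (derive1 f).
Proof.
move=> rf; have [cf uf cf' uf'] := rtestP rf.
have lf' := lint_supported cf' uf'.
have [x [y [Ix Iy f0]]] := uf; have [x' [y' [Ix' Iy' f'0]]] := uf'.
apply/funext => t.
have D0 s : is_derive s (1:R) (f - prim (derive1 f)) 0.
  have := is_deriveB (smooth_is_derive (proj1 rf) s) (is_derive_prim lf' cf' s).
  by rewrite subrr.
pose s := Num.min x x' - 1.
have sx : s < x by rewrite /s; have := ge_min x x x'; rewrite lexx /=; lra.
have sx' : s < x' by rewrite /s; have := ge_min x' x x'; rewrite lexx orbT /=; lra.
have fs : f s = 0 by apply: f0; rewrite negb_and -ltNge sx.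
have ps : prim (derive1 f) s = 0.
  by apply: prim_eq0 => r rs; apply: f'0; rewrite negb_and -ltNge (le_lt_trans rs sx').
by have := is_derive_0_is_cst t s D0; rewrite !fctE fs ps subr0 => /eqP; rewrite subr_eq0 => /eqP.
Qed.

Lemma rtest_hat n x y : I x -> I y -> rtest (hat n x y).
Proof.
move=> Ix Iy; split; first exact: smooth_hat.
exists x, y; split=> // t; move=> h; apply: hat_eq0; apply: contra h.
by move=> /andP[h1 h2]; rewrite !ltW.
Qed.

Lemma exists_rtest1 : exists2 f, rtest f & \int[mu]_t f t = 1.
Proof.
have [x Ix] := I0; have [y xy Iy] : exists2 y, x < y & I y.
  have /nbhs_ballP[e /= e0 he] : nbhs x I by exact: open_nbhs_nbhs.
  exists (x + e / 2); first by rewrite ltrDl divr_gt0.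
  apply: he; rewrite /ball /= opprD addNKr normrN gtr0_norm ?divr_gt0 //; lra.
have rb := rtest_hat 0 Ix Iy; have [cb ub _ _] := rtestP rb.
have lb := lint_supported cb ub.
set m := \int[mu]_t hat 0 x y t.
have mE z : y <= z -> m = prim (hat 0 x y) z.
  move=> yz; apply: Rintegral_supp_prim => t zt; apply: hat_eq0.
  by rewrite negb_and -!leNgt (ltW (le_lt_trans yz zt)) orbT.
suff m0 : m != 0.
  exists (fun t => 0 + m^-1 * hat 0 x y t).
    apply: rtest_lin => //; split; last by exists x, x.
    by apply: elem_smooth_smooth; exact: elem_cst.
  under eq_Rintegral do rewrite add0r.
  rewrite (@Rintegral_supp_prim _ y) ?primZ -?mE ?mulVf //.
  by move=> t yt; rewrite hat_eq0 ?mulr0 // negb_and -!leNgt (ltW yt) orbT.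
(* If the integral were zero, the primitive of the nonnegative bump would vanish identically,
   against its positive derivative at the midpoint. *)
apply/negP => /eqP m0.
have P0 z : prim (hat 0 x y) z = 0.
  apply/eqP; rewrite eq_le; apply/andP; split.
    have [zy|yz] := leP z y; last by rewrite -mE ?m0 // ltW.
    by rewrite -[leRHS]m0 (mE _ (lexx y)); apply: prim_ge0 => // t; exact: hat_ge0.
  by apply: Rintegral_ge0 => t _; exact: hat_ge0.
have d := is_derive_prim lb cb ((x + y) / 2).
have : 0 < hat 0 x y ((x + y) / 2) by apply: hat_gt0; apply/andP; split; lra.
rewrite -(derive_val (is_derive := d)).
have -> : prim (hat 0 x y) = cst 0 by apply/funext.
by rewrite derive_cst ltxx.
Qed.

(** The vanishing mean brings the primitive back to 0 to the right of the support. *)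
Lemma rtest_prim0 h : rtest h -> \int[mu]_t h t = 0 -> rtest (prim h) /\ derive1 (prim h) = h.
Proof.
move=> rh h0; have [ch uh _ _] := rtestP rh; have lh := lint_supported ch uh.
have d := is_derive_prim lh ch.
split; last by apply/funext => x; rewrite derive1E; exact: (derive_val (is_derive := d x)).
split; first by apply: is_derive_smooth d (proj1 rh).
have [x [y [Ix Iy z]]] := uh; exists x, y; split=> // t; rewrite negb_and -!ltNge => /orP[tx|yt].
  by apply: prim_eq0 => s st; apply: z; rewrite negb_and -!ltNge (le_lt_trans st tx).
rewrite -(@Rintegral_supp_prim h t) // => s ts; apply: z.
by rewrite negb_and -!ltNge (lt_trans yt ts) orbT.
Qed.

Lemma prim_cst_ae0 g : lint g -> (forall x y, I x -> I y -> x < y -> prim g x = prim g y) ->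
  {ae mu, forall x, I x -> g x = 0}.
Proof.
move=> lg gc; apply: ae_imply (ae_derive_prim lg) => x [dx <-] Ix.
rewrite derive1E (@near_eq_derive _ _ _ (prim g) (cst (prim g x))) ?derive_cst //.
have : nbhs x I by exact: open_nbhs_nbhs.
apply: filterS => y Iy; have [xy|yx|->//] := ltgtP x y.
  by rewrite -(gc _ _ Ix Iy).
by rewrite (gc _ _ Iy Ix).
Qed.

(** The bumps [hat n x y] converge boundedly to the indicator of ]x, y[, so the integrals of [g]
    between points of [I] vanish. The primitive is then constant on [I], and Lebesgue
    differentiation concludes. *)
Lemma fundamental_lemma g : lint g -> (forall f, rtest f -> pair g f = 0) ->
  {ae mu, forall x, I x -> g x = 0}.
Proof.
move=> lg g0; apply: prim_cst_ae0 => // x y Ix Iy xy.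
suff : \int[mu]_(t in `]x, y[) g t = 0.
  rewrite Rintegral_itv_bndo_bndc; last first.
    by apply: (lint_subset (x := y)) => // t /=; rewrite !in_itv /= => /andP[_ /ltW].
  by rewrite -primB ?ltW // => /eqP; rewrite subr_eq0 => /eqP.
have ig : mu.-integrable `]x, y[ (EFin \o g).
  by apply: (lint_subset (x := y)) => // t /=; rewrite !in_itv /= => /andP[_ /ltW].
have mg : measurable_fun `]x, y[ (EFin \o g) by exact: (measurable_int mu).
have mb n : measurable_fun [set: R] (hat n x y).
  by apply: continuous_measurable_fun; apply: smooth_continuous; exact: smooth_hat.
have [] := @dominated_convergence _ _ _ mu `]x, y[%classic (measurable_itv _)
  (fun n => EFin \o (fun t => g t * hat n x y t)) (EFin \o g) (EFin \o (fun t => `|g t|)).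
- move=> n; apply/measurable_EFinP; apply: measurable_funM; last exact: (measurable_funTS (mb n)).
  exact/measurable_EFinP.
- exact: mg.
- apply: aeW => t /=; rewrite in_itv /= => xty.
  apply: cvg_EFin; first by near=> n.
  rewrite -[X in _ --> X]mulr1; apply: cvgMr; exact: cvg_hat.
- exact: integrable_norm.
- apply: aeW => t n _ /=; rewrite lee_fin normrM ler_piMr // ger0_norm ?hat_ge0 //.
  exact: hat_le1.
move=> _ _ /= h.
have {}h : (0 : \bar R)%E @[n --> \oo] --> (\int[mu]_(t in `]x, y[) (g t)%:E)%E.
  apply: cvg_trans h; apply: near_eq_cvg; near=> n => /=.
  have := g0 _ (rtest_hat n Ix Iy); rewrite /pair.
  rewrite (@Rintegral_support _ `]x, y[%classic); last first.
    by move=> t /= /negP; rewrite in_itv /= => nt; rewrite hat_eq0 ?mulr0.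
  have ign : mu.-integrable `]x, y[ (EFin \o (fun t => g t * hat n x y t)).
    apply: (le_integrable _ _ _ (integrable_norm ig)) => //.
      apply/measurable_EFinP; apply: measurable_funM; last exact: (measurable_funTS (mb n)).
      exact/measurable_EFinP.
    move=> t _ /=; rewrite lee_fin normr_id normrM ler_piMr // ger0_norm ?hat_ge0 //.
    exact: hat_le1.
  by rewrite /Rintegral => h; rewrite -[LHS]fineK ?h //; exact: (integrable_fin_num _ ign).
rewrite /Rintegral; suff -> : (\int[mu]_(t in `]x, y[) (g t)%:E = 0)%E by [].
by apply: (cvg_unique _ h); [exact: ereal_hausdorff|exact: cvg_cst].
Unshelve. all: by end_near.
Qed.
End interval.
End TestFunctions.

(** * The du Bois-Reymond lemma and weak second derivatives *)

Section Weak.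
Context {R : realType}.
Notation mu := (@lebesgue_measure R).
Implicit Types f g h : R -> R.
Variables (I : set R) (a : R).
Hypothesis HI : open_ray_part I a.
Let oI := orp_open HI.
Let mI : measurable I. Proof. exact: open_measurable. Qed.

Lemma restrict0E (A : set R) h x : (h \_ A) x = if x \in A then h x else 0.
Proof. by []. Qed.

Lemma lint_patch_prim c g : lint g -> lint ((fun t => c + prim g t) \_ I).
Proof.
move=> lg; apply: (lint_patch HI).
  by apply: measurable_funD => //; exact: measurable_prim.
by move=> x; exact: prim_bounded.
Qed.

Lemma lint_patch_cst (c : R) : lint ((fun=> c) \_ I).
Proof. by apply: (lint_patch HI) => // x; exists `|c|. Qed.

Lemma pair_patch u f : supported I f -> pair (u \_ I) f = pair u f.
Proof.
move=> sf; apply: eq_Rintegral => t _; rewrite restrict0E; case: ifPn => // nI.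
by rewrite -[f](supported_patch HI sf) restrict0E (negbTE nI) !mulr0.
Qed.

Lemma pair_cst (c : R) f : rtest I f -> pair ((fun=> c) \_ I) f = c * \int[mu]_t f t.
Proof.
move=> rf; have [cf sf _ _] := rtestP rf; rewrite pair_patch //.
have [x [y [Ix Iy f0]]] := sf.
have Y t : y < t -> f t = 0 by move=> yt; rewrite f0 // negb_and -!ltNge yt orbT.
rewrite (pair_prim _ (y := y)) // (Rintegral_supp_prim (y := y)) // primZ //.
exact: (lint_supported HI).
Qed.

(** Removing the mean along a fixed [r] of integral 1 turns any test function into the derivative of
    one. *)
Lemma zero_mean_part f r : rtest I f -> rtest I r -> \int[mu]_t r t = 1 ->
  let h := fun t => f t + (- \int[mu]_s f s) * r t in
  rtest I (prim h) /\ derive1 (prim h) = h.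
Proof.
move=> rf rr r1 h; apply: (rtest_prim0 HI); first exact: rtest_lin.
have [cf sf _ _] := rtestP rf; have [cr sr _ _] := rtestP rr.
have [x [y [Ix Iy f0 r0]]] := supported2 sf sr.
have Y t : y < t -> ~~ (x <= t <= y) by move=> yt; rewrite negb_and -!ltNge yt orbT.
have lf := lint_supported HI cf sf; have lr := lint_supported HI cr sr.
rewrite (Rintegral_supp_prim (y := y)); last by move=> t /Y yt; rewrite /h f0 // r0 // mulr0 addr0.
rewrite primD //; last exact: lintZ.
rewrite primZ //.
rewrite -(Rintegral_supp_prim (y := y) (h := f)); last by move=> t /Y yt; rewrite f0.
rewrite -(Rintegral_supp_prim (y := y) (h := r)); last by move=> t /Y yt; rewrite r0.
by rewrite r1 mulr1 subrr.
Qed.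

Lemma du_bois_reymond g : lint g -> (forall f, rtest I f -> pair g (derive1 f) = 0) ->
  exists K, {ae mu, forall x, I x -> g x = K}.
Proof.
move=> lg g0; have [r rr r1] := exists_rtest1 HI; have [cr sr _ _] := rtestP rr.
(* Pairing the conclusion with [r], of integral 1, forces this constant. *)
exists (pair g r).
have lK := lint_patch_cst (pair g r).
suff : {ae mu, forall x, I x -> g x + (-1) * ((fun=> pair g r) \_ I) x = 0}.
  apply: ae_imply => x h Ix; have := h Ix.
  by rewrite restrict0E mem_set // mulN1r => /eqP; rewrite subr_eq0 => /eqP.
apply: (fundamental_lemma HI); first by apply: lintD => //; exact: lintZ.
move=> f rf; have [cf sf _ _] := rtestP rf.
rewrite (pair_linl (I := I)) // pair_cst //.
have [rh dh] := zero_mean_part rf rr r1.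
have := g0 _ rh; rewrite dh (pair_linr (I := I)) //; lra.
Qed.

Lemma pair_by_parts c v f : lint v -> rtest I f ->
  pair ((fun t => c + prim v t) \_ I) (derive1 f) = - pair v f.
Proof.
move=> lv rf; have [cf sf cf' sf'] := rtestP rf.
rewrite pair_patch //; have [x [y [Ix Iy f0 f'0]]] := supported2 sf sf'.
have lf' := lint_supported HI cf' sf'.
have fE t : f t = 0 + prim (derive1 f) t by rewrite add0r -(rtest_prim HI rf).
have Y t : y < t -> ~~ (x <= t <= y) by move=> yt; rewrite negb_and -!ltNge yt orbT.
have X t : t < x -> ~~ (x <= t <= y) by move=> yt; rewrite negb_and -!ltNge yt.
(* Ends outside the support, where the boundary terms vanish. *)
pose s := x - 1; pose z := Num.max x y + 1.
have sx : s < x by rewrite /s; lra.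
have xz : x < z by rewrite /z; have := le_max x x y; rewrite lexx /=; lra.
have yz : y < z by rewrite /z; have := le_max y x y; rewrite lexx orbT /=; lra.
have sz : s <= z by lra.
have E := by_parts c 0 lv lf' sz.
rewrite -!fE (f0 _ (Y _ yz)) (f0 _ (X _ sx)) !mulr0 subrr in E.
have Eh : (fun t => v t * (0 + prim (derive1 f) t) + (c + prim v t) * derive1 f t) =
          (fun t => v t * f t + (c + prim v t) * derive1 f t).
  by apply/funext => t; rewrite -fE.
rewrite Eh in E.
have ps : prim (fun t => v t * f t + (c + prim v t) * derive1 f t) s = 0.
  apply: prim_eq0 => t ts; have tx := le_lt_trans ts sx.
  by rewrite f0 ?X // f'0 ?X // !mulr0 addr0.
rewrite ps subr0 primD in E; last first.
- have -> : (fun t => (c + prim v t) * derive1 f t) = (fun t => derive1 f t * (c + prim v t)).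
    by apply/funext => t; rewrite mulrC.
  apply: lintM => //; last by move=> t; exact: prim_bounded.
  by apply: measurable_funD => //; exact: measurable_prim.
- exact: (lint_pair (I := I)).
have Z t : z < t -> ~~ (x <= t <= y) by move=> zt; apply: Y; exact: lt_trans zt.
rewrite (pair_prim _ (y := z)); last by move=> t /Z/f'0.
rewrite (pair_prim _ (y := z)); last by move=> t /Z/f0.
lra.
Qed.

(* [u] and [v] are already extended by zero outside [I]. *)
Lemma weak_derivative_prim u v : lint u -> lint v ->
  (forall f, rtest I f -> pair u (derive1 f) = - pair v f) ->
  exists c, {ae mu, forall x, I x -> u x = c + prim v x}.
Proof.
move=> lu lv uv.
have lp := lint_patch_prim 0 lv.
have [|f rf|K hK] := @du_bois_reymond (fun x => u x + (-1) * ((fun t => 0 + prim v t) \_ I) x).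
- by apply: lintD => //; exact: lintZ.
- have [cf sf cf' sf'] := rtestP rf.
  by rewrite (pair_linl (I := I)) // uv // pair_by_parts //; ring.
exists K; apply: ae_imply hK => x h Ix; have := h Ix.
by rewrite restrict0E mem_set //; lra.
Qed.

(** Here u' is only a distribution, so [du_bois_reymond] does not apply to u' - [prim w]. Its
    argument is repeated for the functional f -> - [pair u] f', and evaluation at the normalised [r]
    determines [d]. *)
Lemma weak_second_derivative u w : lint u -> lint w ->
  (forall f, rtest I f -> pair u (derive1 (derive1 f)) = pair w f) ->
  exists d, forall f, rtest I f ->
    pair u (derive1 f) = - pair ((fun t => d + prim w t) \_ I) f.
Proof.
move=> lu lw uw; have [r rr r1] := exists_rtest1 HI; have [cr sr cr' sr'] := rtestP rr.
pose q := (fun t => 0 + prim w t) \_ I.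
have lq : lint q by exact: lint_patch_prim.
exists (- (pair u (derive1 r) + pair q r)) => f rf.
have [cf sf cf' sf'] := rtestP rf.
set K := pair u _ + _.
have -> : ((fun t => - K + prim w t) \_ I) = (fun t => q t + (-1) * ((fun=> K) \_ I) t).
  by apply/funext => t; rewrite /q !restrict0E; case: ifP => _; ring.
rewrite (pair_linl (I := I)) //; last exact: lint_patch_cst.
rewrite pair_cst //.
have [rh dh] := zero_mean_part rf rr r1.
move: rh dh; set h := (fun t => f t + _) => rh dh.
have := uw _ rh.
have := pair_by_parts 0 lw rh; rewrite -/q dh.
have -> : derive1 h = fun t => derive1 f t + (- \int[mu]_s f s) * derive1 r t.
  apply/funext => t; apply: is_derive1_val.
  apply: is_deriveD; [exact: smooth_is_derive (proj1 rf) t|].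
  exact: is_deriveZ (smooth_is_derive (proj1 rr) t).
set m := \int[mu]_s f s.
have -> : pair q h = pair q f + - m * pair q r by exact: (pair_linr (I := I)).
have -> : pair u (fun t => derive1 f t + - m * derive1 r t) =
          pair u (derive1 f) + - m * pair u (derive1 r) by exact: (pair_linr (I := I)).
rewrite /K; move: (pair q f) (pair q r) (pair u _) (pair u _) (pair w _) m => A B C D E m.
by move=> h1 h2; rewrite -h2 in h1; lra.
Qed.
End Weak.

(** * Real functions in H^2 of an interval *)

Section Tail.
Context {R : realType}.
Notation mu := (@lebesgue_measure R).
Implicit Types f g h : R -> R.

Lemma integrable_lint g : mu.-integrable setT (EFin \o g) -> lint g.
Proof. by move=> ig x; apply: integrableS ig. Qed.

Lemma itv_finite_measure (x y : R) : (mu `]x, y]%classic < +oo)%E.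
Proof. by rewrite lebesgue_measure_itv /=; case: ifP => _; rewrite ?ltry // -EFinD ltry. Qed.

Lemma Rintegral_cst_itv (m x y : R) : x <= y -> \int[mu]_(t in `]x, y]) m = m * (y - x).
Proof.
move=> xy; rewrite Rintegral_cst //; congr (_ * _).
have E : mu `]x, y]%classic = (y - x)%:E.
  rewrite lebesgue_measure_itv /= lte_fin; case: ltgtP xy => // -> _.
  by rewrite subrr.
exact: (congr1 fine E).
Qed.

Lemma bigcup_rays : \bigcup_n `]-oo, (n%:R : R)]%classic = [set: R].
Proof.
apply/seteqP; split=> // x _; exists (`|Num.ceil x|)%N => //=; rewrite in_itv /=.
apply: (le_trans (ceil_ge x)); by rewrite natr_absz ler_int ler_norm.
Qed.

Lemma cvg_prim_ge0 g : lint g -> (forall t, 0 <= g t) ->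
  ((prim g n%:R)%:E @[n --> \oo] --> \int[mu]_t (g t)%:E)%E.
Proof.
move=> lg g0.
have -> : (fun n : nat => (prim g n%:R)%:E) = (fun n : nat => \int[mu]_(t in `]-oo, n%:R]) (g t)%:E)%E.
  apply/funext => n; rewrite /prim /Rintegral fineK //.
  exact: (integrable_fin_num _ (lg _)).
rewrite -bigcup_rays; apply: ge0_nondecreasing_set_cvg_integral => //.
- move=> m n mn; rewrite subsetEset => t /=; rewrite !in_itv /= => tm.
  by apply: (le_trans tm); rewrite ler_nat.
- by move=> n; exact: (measurable_int mu).
- by move=> n t _; rewrite lee_fin.
Qed.

Lemma prim_bounded_integrable g M : lint g -> (forall t, 0 <= g t) ->
  (forall x, prim g x <= M) -> mu.-integrable setT (EFin \o g).
Proof.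
move=> lg g0 gM; apply/integrableP; split; first by apply/measurable_EFinP; exact: lint_measurable.
under eq_integral do rewrite /= ger0_norm //.
apply: (@le_lt_trans _ _ M%:E); last by rewrite ltry.
apply: (closed_cvg (fun y => y <= M%:E)%E _ _ _ (cvg_prim_ge0 lg g0)) => //.
  exact: closed_ereal_ge_ereal.
by apply: nearW => n; rewrite lee_fin.
Qed.

Lemma integral_prim_tail g x : mu.-integrable setT (EFin \o g) ->
  \int[mu]_t g t - prim g x = \int[mu]_(t in `]x, +oo[) g t.
Proof.
move=> ig; have ig' : mu.-integrable `]-oo, +oo[ (EFin \o g) by apply: integrableS ig.
by rewrite -(Rintegral_itvB ig') // set_itvE.
Qed.

Lemma prim_le_integral g x : mu.-integrable setT (EFin \o g) -> (forall t, 0 <= g t) ->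
  prim g x <= \int[mu]_t g t.
Proof.
by move=> ig g0; rewrite -subr_ge0 integral_prim_tail //; exact: Rintegral_ge0.
Qed.

Lemma prim_tail g e : mu.-integrable setT (EFin \o g) -> 0 < e ->
  exists X, forall x, X <= x -> `|\int[mu]_t g t - prim g x| <= e.
Proof.
move=> ig e0; have lg := integrable_lint ig.
have ing : mu.-integrable setT (EFin \o (fun t => `|g t|)) by exact: integrable_norm.
have lng := lint_norm lg.
have h := cvg_prim_ge0 lng (fun t => normr_ge0 (g t)).
have {}h : prim (fun t => `|g t|) n%:R @[n --> \oo] --> \int[mu]_t `|g t|.
  have eN : (\int[mu]_t `|g t|%:E = (\int[mu]_t `|g t|)%:E)%E.
    by rewrite /Rintegral fineK //; exact: (integrable_fin_num _ ing).
  by rewrite eN in h; exact: (fine_cvg h).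
move/cvgrPdist_le : h => /(_ _ e0)[n _ /(_ n (leqnn n)) /= hn].
exists n%:R => x nx; rewrite integral_prim_tail //.
have itail : mu.-integrable `]x, +oo[ (EFin \o g) by apply: integrableS ig.
apply: (le_trans (le_normr_Rintegral _ itail)) => //.
rewrite -integral_prim_tail //; apply: le_trans hn; apply: le_trans (ler_norm _).
by rewrite lerD2l lerN2; apply: prim_ge0.
Qed.

Lemma integrable_not_bounded_away g X m : mu.-integrable setT (EFin \o g) -> 0 < m ->
  ~ (forall x, X <= x -> m <= `|g x|).
Proof.
move=> ig m0 gm; have lng := lint_norm (integrable_lint ig).
have ing : mu.-integrable setT (EFin \o (fun t => `|g t|)) by exact: integrable_norm.
set N := \int[mu]_t `|g t|.
have N0 : 0 <= N by exact: Rintegral_ge0.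
(* Over a length N / m + 1 the lower bound m already contributes N + m, more than the total mass
   N. *)
have N1 : 0 < N / m + 1 by rewrite ltr_wpDl // divr_ge0 // ltW.
have XX : X <= X + (N / m + 1) by rewrite lerDl ltW.
have : prim (fun t => `|g t|) (X + (N / m + 1)) - prim (fun t => `|g t|) X <= N.
  rewrite lerBlDr; apply: (le_trans (prim_le_integral _ ing _)) => //.
  by rewrite lerDl; exact: Rintegral_ge0.
rewrite primB // => h.
have : \int[mu]_(t in `]X, X + (N / m + 1)]) m <= N.
  apply: le_trans h; apply: le_Rintegral => //.
  - apply: measurable_bounded_integrable => //.
      exact: itv_finite_measure.
    by exists m; split; [exact: num_real|move=> y my t _; rewrite ger0_norm ltW].
  - by apply: lint_itv.
  - by move=> t /=; rewrite in_itv /= => /andP[/ltW /gm].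
rewrite Rintegral_cst_itv // addrC addKr.
rewrite mulrDr mulr1 mulrCA divff ?gt_eqF // mulr1; lra.
Qed.

(* An integrable function cannot have a nonzero limit at infinity. *)
Lemma prim_cvg_integrable0 k g c : mu.-integrable setT (EFin \o k) ->
  mu.-integrable setT (EFin \o g) -> (exists X, forall x, X <= x -> g x = c + prim k x) ->
  c + \int[mu]_t k t = 0.
Proof.
move=> ik ig [X gE]; apply/eqP; apply/negPn/negP => l0.
set l := c + _ in l0.
have l2 : 0 < `|l| / 2 by rewrite divr_gt0 // normr_gt0.
have [Y hY] := prim_tail ik l2.
apply: (@integrable_not_bounded_away _ (Num.max X Y) _ ig l2) => x.
rewrite ge_max => /andP[Xx Yx]; rewrite gE //.
have -> : c + prim k x = l - (\int[mu]_t k t - prim k x) by rewrite /l; ring.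
have := hY x Yx; have := lerB_dist l (\int[mu]_t k t - prim k x); lra.
Qed.
End Tail.

(** * Square-integrable real functions *)

Section L2r.
Context {R : realType}.
Notation mu := (@lebesgue_measure R).
Implicit Types f g h u v w : R -> R.

Definition L2r (I : set R) u :=
  measurable_fun I u /\ mu.-integrable I (EFin \o (fun x => u x ^+ 2)).

Lemma L2r_mul I u v : measurable (I : set (measurableTypeR R)) -> L2r I u -> L2r I v ->
  mu.-integrable I (EFin \o (fun x => u x * v x)).
Proof.
move=> mI [mu_ iu] [mv iv].
apply: (@le_integrable _ _ _ mu I mI _ (EFin \o (fun x => u x ^+ 2 + v x ^+ 2))).
- by apply/measurable_EFinP; exact: measurable_funM.
- move=> x _ /=; rewrite lee_fin normrM [leRHS]ger0_norm ?addr_ge0 ?sqr_ge0 //.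
  rewrite -(real_normK (num_real (u x))) -(real_normK (num_real (v x))).
  have := sqr_ge0 (`|u x| - `|v x|); have := normr_ge0 (u x); have := normr_ge0 (v x).
  move: `|u x| `|v x| => p q; nra.
- exact: (integrableD mI iu iv).
Qed.

Lemma L2r_lin I k u v : measurable (I : set (measurableTypeR R)) -> L2r I u -> L2r I v ->
  L2r I (fun x => u x + k * v x).
Proof.
move=> mI uu vv; have [mu_ iu] := uu; have [mv iv] := vv; split.
  by apply: measurable_funD => //; apply: measurable_funM.
have := integrableD mI iu (integrableD mI (integrableZl mI (2 * k) (L2r_mul mI uu vv))
  (integrableZl mI (k ^+ 2) iv)).
by apply: eq_integrable => // x _ /=; congr EFin; ring.
Qed.

Lemma eq_L2r I u v : measurable (I : set (measurableTypeR R)) ->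
  (forall x, I x -> u x = v x) -> L2r I u -> L2r I v.
Proof.
move=> mI uv [mu_ iu]; split.
  by apply: eq_measurable_fun mu_ => x; rewrite inE => /uv ->.
by apply: eq_integrable iu => // x; rewrite inE /= => /uv ->.
Qed.

Lemma L2r_bounded I u M : measurable (I : set (measurableTypeR R)) ->
  (mu (I : set (measurableTypeR R)) < +oo)%E -> measurable_fun I u ->
  (forall x, I x -> `|u x| <= M) -> L2r I u.
Proof.
move=> mI fI mf uM; split => //; apply: measurable_bounded_integrable => //.
  exact: measurable_funX.
exists (M ^+ 2); split; first exact: num_real.
move=> z Mz x Ix /=; rewrite normrX; apply: ltW; apply: le_lt_trans Mz.
by rewrite lerXn2r ?nnegrE // ?uM // (le_trans _ (uM x Ix)).
Qed.

Variables (I : set R) (a : R).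
Hypothesis HI : open_ray_part I a.
Let oI := orp_open HI.
Let aI := orp_lb HI.
Let mI : measurable I. Proof. exact: open_measurable. Qed.

Lemma finite_ray_part x : (mu (`]-oo, x] `&` I) < +oo)%E.
Proof.
apply: (@le_lt_trans _ _ (mu `]a, x])).
  apply: le_measure; rewrite ?inE //; first exact: measurableI.
  by move=> t [/=]; rewrite !in_itv /= => tx /aI ->.
exact: itv_finite_measure.
Qed.

(** The part of [I] on a left ray has finite measure, and |u| <= 1 + u^2 there. *)
Lemma L2r_lint u : L2r I u -> lint (u \_ I).
Proof.
move=> uu; apply: (lint_restrict HI) => x.
have mD : measurable ((`]-oo, x]%classic : set (measurableTypeR R)) `&` I) by exact: measurableI.
have [mu_ iu] := uu.
have iu' : mu.-integrable (`]-oo, x] `&` I) (EFin \o (fun x => u x ^+ 2)).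
  by apply: integrableS iu.
have i1 : mu.-integrable (`]-oo, x] `&` I) (EFin \o (fun=> 1)).
  apply: measurable_bounded_integrable => //; first exact: finite_ray_part.
  by exists 1; split; [exact: num_real|move=> y y1 t _; rewrite normr1 ltW].
apply: (@le_integrable _ _ _ mu _ mD _ (EFin \o (fun x => 1 + u x ^+ 2))).
- by apply/measurable_EFinP; apply: measurable_funS mu_.
- move=> t _ /=; rewrite lee_fin [leRHS]ger0_norm ?addr_ge0 ?sqr_ge0 //.
  rewrite -(real_normK (num_real (u t))).
  have := sqr_ge0 (`|u t| - 1); have := normr_ge0 (u t); move: `|u t| => p; nra.
- exact: (integrableD mD i1 iu').
Qed.

Lemma integrable_restrictT h : mu.-integrable I (EFin \o h) -> mu.-integrable setT (EFin \o (h \_ I)).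
Proof. by move=> ih; rewrite -restrict_EFin; apply/integrable_restrict => //; rewrite setTI. Qed.

Lemma prim_restrict_le g x : x <= a -> prim (g \_ I) x = 0.
Proof.
move=> xa; apply: prim_eq0 => t tx; rewrite restrict0E; case: ifPn => //.
by rewrite inE => /aI; rewrite ltNge (le_trans tx xa).
Qed.
End L2r.

(** * Absolutely continuous representatives and the Wronskian *)

Section Triples.
Context {R : realType}.
Notation mu := (@lebesgue_measure R).
Implicit Types f g h u v w : R -> R.

Lemma integrable_ae (D : set (measurableTypeR R)) f g : measurable D ->
  mu.-integrable D (EFin \o f) -> measurable_fun D g ->
  {ae mu, forall x, D x -> f x = g x} -> mu.-integrable D (EFin \o g).
Proof.
move=> mD /integrableP[mf fi] mg fg; apply/integrableP; split; first exact/measurable_EFinP.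
apply: le_lt_trans fi; rewrite le_eqVlt; apply/orP; left; apply/eqP.
apply: ae_eq_integral => //.
- by apply: measurableT_comp => //; exact/measurable_EFinP.
- exact: measurableT_comp.
- by apply: ae_imply fg => x fg Dx; rewrite /= fg.
Qed.

Lemma L2r_ae (D : set (measurableTypeR R)) u v : measurable D -> L2r D u -> measurable_fun D v ->
  {ae mu, forall x, D x -> u x = v x} -> L2r D v.
Proof.
move=> mD [mu_ iu] mv uv; split => //; apply: (integrable_ae mD iu).
  exact: measurable_funX.
by apply: ae_imply uv => x uv Dx; rewrite uv.
Qed.

Lemma Rintegral_ae (D : set (measurableTypeR R)) f g : measurable D -> measurable_fun D f -> measurable_fun D g ->
  {ae mu, forall x, D x -> f x = g x} -> \int[mu]_(x in D) f x = \int[mu]_(x in D) g x.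
Proof.
move=> mD mf mg fg; congr fine; apply: ae_eq_integral => //; try exact/measurable_EFinP.
by apply: ae_imply fg => x fg Dx; rewrite /= fg.
Qed.

Section interval.
Variables (I : set R) (a : R).
Hypothesis HI : open_ray_part I a.
Let oI := orp_open HI.
Let aI := orp_lb HI.
Let mI : measurable (I : set (measurableTypeR R)). Proof. exact: open_measurable. Qed.

(* [u] and [v] are the absolutely continuous representatives of a member of
   H^2(I) and of its derivative, extended to the whole line by continuity. *)
Record rep2 u v w : Prop := Rep2 {
  rep_u : L2r I u; rep_v : L2r I v; rep_w : L2r I w;
  rep_uE : forall x, u x = u a + prim (v \_ I) x;
  rep_vE : forall x, v x = v a + prim (w \_ I) x }.

Lemma prim_patch_ae g h x : lint (g \_ I) -> lint (h \_ I) ->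
  {ae mu, forall x, I x -> g x = h x} -> prim (g \_ I) x = prim (h \_ I) x.
Proof.
move=> lg lh gh; apply: Rintegral_ae => //.
- by apply: measurable_funTS; exact: lint_measurable.
- by apply: measurable_funTS; exact: lint_measurable.
- apply: ae_imply gh => y gh _; rewrite !restrict0E; case: ifPn => //; rewrite inE; exact: gh.
Qed.

Lemma measurable_prim_cst c g : lint g -> measurable_fun I (fun x => c + prim g x).
Proof.
by move=> lg; apply: measurable_funTS; apply: measurable_funD => //; exact: measurable_prim.
Qed.

Lemma prim_restrict_cst c g : (fun x => c + prim (g \_ I) x) a = c.
Proof. by rewrite /= (prim_restrict_le HI) // addr0. Qed.

Lemma rep2_weak u v w f : rep2 u v w -> rtest I f ->
  pair (u \_ I) (derive1 f) = - pair (v \_ I) f /\ pair (v \_ I) (derive1 f) = - pair (w \_ I) f.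
Proof.
move=> [uu vv ww uE vE] rf.
have -> : u = (fun x => u a + prim (v \_ I) x) by apply/funext.
split; first by rewrite (pair_by_parts HI) //; exact: (L2r_lint HI).
rewrite {1}(_ : v = (fun x => v a + prim (w \_ I) x)); last by apply/funext.
by rewrite (pair_by_parts HI) //; exact: (L2r_lint HI).
Qed.

Lemma weak_rep1 u v : L2r I u -> lint (v \_ I) ->
  (forall f, rtest I f -> pair (u \_ I) (derive1 f) = - pair (v \_ I) f) ->
  exists c, {ae mu, forall x, I x -> u x = c + prim (v \_ I) x}.
Proof.
move=> uu lv uv; have [c hc] := weak_derivative_prim HI (L2r_lint HI uu) lv uv.
by exists c; apply: ae_imply hc => x h Ix; rewrite -h // restrict0E mem_set.
Qed.

Lemma rep2_of_weak u v w : L2r I u -> L2r I v -> L2r I w ->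
  (forall f, rtest I f -> pair (u \_ I) (derive1 f) = - pair (v \_ I) f) ->
  (forall f, rtest I f -> pair (v \_ I) (derive1 f) = - pair (w \_ I) f) ->
  exists u' v', [/\ rep2 u' v' w, {ae mu, forall x, I x -> u x = u' x} &
    {ae mu, forall x, I x -> v x = v' x}].
Proof.
move=> uu vv ww uv vw.
have lu := L2r_lint HI uu; have lv := L2r_lint HI vv; have lw := L2r_lint HI ww.
have [c hc] := weak_rep1 uu lv uv; have [d hd] := weak_rep1 vv lw vw.
(* [w] is kept as given, while [u'] will be the primitive of the corrected [v'], so that both
   identities hold at every point. *)
pose v' x := d + prim (w \_ I) x.
have vv' : L2r I v' by apply: (L2r_ae mI vv) => //; exact: measurable_prim_cst.
have lv' := L2r_lint HI vv'.
pose u' x := c + prim (v' \_ I) x.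
have uu' : {ae mu, forall x, I x -> u x = u' x}.
  by apply: ae_imply hc => x h Ix; rewrite h // /u' (prim_patch_ae x lv lv').
exists u', v'; split => //; split => //.
- by apply: (L2r_ae mI uu) => //; exact: measurable_prim_cst.
- by move=> x; rewrite /u' prim_restrict_cst.
- by move=> x; rewrite /v' prim_restrict_cst.
Qed.

(** The form met in the adjoint, where only the second weak derivative is known. Square
    integrability of the first one is a premise because its proof depends on the type of
    interval. *)
Lemma rep2_of_weak2 u w : L2r I u -> L2r I w ->
  (forall u v, (forall x, u x = u a + prim (v \_ I) x) -> (forall x, v x = v a + prim (w \_ I) x) ->
     L2r I u -> L2r I v) ->
  (forall f, rtest I f -> pair (u \_ I) (derive1 (derive1 f)) = pair (w \_ I) f) ->
  exists u' v', rep2 u' v' w /\ {ae mu, forall x, I x -> u x = u' x}.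
Proof.
move=> uu ww L uw.
have lu := L2r_lint HI uu; have lw := L2r_lint HI ww.
have [d hd] := weak_second_derivative HI lu lw uw.
pose v' x := d + prim (w \_ I) x.
have lv' : lint (v' \_ I) by exact: (lint_patch_prim HI).
have [c hc] := weak_rep1 uu lv' hd.
pose u' x := c + prim (v' \_ I) x.
have uL : L2r I u' by apply: (L2r_ae mI uu) => //; exact: measurable_prim_cst.
have uE x : u' x = u' a + prim (v' \_ I) x by rewrite /u' prim_restrict_cst.
have vE x : v' x = v' a + prim (w \_ I) x by rewrite /v' prim_restrict_cst.
by exists u', v'; split => //; split => //; exact: (L u').
Qed.

Lemma rep_continuous u v : lint (v \_ I) -> (forall x, u x = u a + prim (v \_ I) x) -> continuous u.
Proof.
move=> lv uE; rewrite (_ : u = (fun x => u a + prim (v \_ I) x)); last by apply/funext.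
by move=> x; apply: cvgD; [exact: cvg_cst|exact: continuous_prim].
Qed.

(** Two integrations by parts, in which the products v1 v2 cancel. *)
Lemma wronskian u1 v1 w1 u2 v2 w2 x : rep2 u1 v1 w1 -> rep2 u2 v2 w2 -> a <= x ->
  (u1 x * v2 x - v1 x * u2 x) - (u1 a * v2 a - v1 a * u2 a) =
  prim ((fun t => u1 t * w2 t - w1 t * u2 t) \_ I) x.
Proof.
move=> [uu1 vv1 ww1 uE1 vE1] [uu2 vv2 ww2 uE2 vE2] ax.
have lv1 := L2r_lint HI vv1; have lw1 := L2r_lint HI ww1.
have lv2 := L2r_lint HI vv2; have lw2 := L2r_lint HI ww2.
have E1 := by_parts (u1 a) (v2 a) lv1 lw2 ax.
have E2 := by_parts (v1 a) (u2 a) lw1 lv2 ax.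
have L1 := lint_by_parts (u1 a) (v2 a) lv1 lw2.
have L2 := lint_by_parts (v1 a) (u2 a) lw1 lv2.
rewrite -!uE1 -!vE2 in E1; rewrite -!uE2 -!vE1 in E2.
have -> : (fun t => u1 t * w2 t - w1 t * u2 t) \_ I =
  fun t => ((v1 \_ I) t * (v2 a + prim (w2 \_ I) t) + (u1 a + prim (v1 \_ I) t) * (w2 \_ I) t) -
    ((w1 \_ I) t * (u2 a + prim (v2 \_ I) t) + (v1 a + prim (w1 \_ I) t) * (v2 \_ I) t).
  by apply/funext => t; rewrite -uE1 -vE2 -vE1 -uE2 !restrict0E; case: ifP => _; ring.
rewrite primBf // -[LHS]addr0.
(* The primitives start at minus infinity and the formula at [a]; the integrands vanish to the left
   of [a]. *)
have Z : forall g, (forall t, ~ I t -> g t = 0) -> prim g a = 0.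
  by move=> g g0; apply: prim_eq0 => t ta; apply: g0 => /aI; rewrite ltNge ta.
have p1 := Z (fun t => (v1 \_ I) t * (v2 a + prim (w2 \_ I) t) + (u1 a + prim (v1 \_ I) t) * (w2 \_ I) t).
have p2 := Z (fun t => (w1 \_ I) t * (u2 a + prim (v2 \_ I) t) + (v1 a + prim (w1 \_ I) t) * (v2 \_ I) t).
rewrite p1 in E1; last first.
  by move=> t nI; rewrite !restrict0E memNset // !mul0r mulr0 addr0.
rewrite p2 in E2; last first.
  by move=> t nI; rewrite !restrict0E memNset // !mul0r mulr0 addr0.
rewrite subr0 in E1; rewrite subr0 in E2; rewrite -E1 -E2; ring.
Qed.

(** On [I] the first function is the derivative of the second; integrability of both removes the
    boundary term at infinity of a ray. *)
Lemma wronskian_integrable u1 v1 w1 u2 v2 w2 : rep2 u1 v1 w1 -> rep2 u2 v2 w2 ->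
  mu.-integrable setT (EFin \o ((fun t => u1 t * w2 t - w1 t * u2 t) \_ I)) /\
  mu.-integrable setT (EFin \o ((fun t => u1 t * v2 t - v1 t * u2 t) \_ I)).
Proof.
move=> [uu1 vv1 ww1 _ _] [uu2 vv2 ww2 _ _].
split; apply: (integrable_restrictT HI).
- exact: (integrableB mI (L2r_mul mI uu1 ww2) (L2r_mul mI ww1 uu2)).
- exact: (integrableB mI (L2r_mul mI uu1 vv2) (L2r_mul mI vv1 uu2)).
Qed.
End interval.
End Triples.

(** * Green's formula on bounded intervals and on rays *)

Section Edges.
Context {R : realType}.
Notation mu := (@lebesgue_measure R).
Implicit Types f g h u v w : R -> R.

Lemma open_ray_part_itv (a b : R) : a < b -> open_ray_part `]a, b[%classic a.
Proof.
move=> ab; split.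
- exact: interval_open.
- move=> x y z /=; rewrite !in_itv /= => /andP[ax xb] /andP[ay yb] /andP[xz zy].
  by rewrite (lt_le_trans ax xz) (le_lt_trans zy yb).
- by move=> x /=; rewrite in_itv /= => /andP[].
- by exists ((a + b) / 2) => /=; rewrite in_itv /=; apply/andP; split; lra.
Qed.

Lemma open_ray_part_ray (a : R) : open_ray_part `]a, +oo[%classic a.
Proof.
split.
- exact: interval_open.
- move=> x y z /=; rewrite !in_itv /= !andbT => ax ay /andP[xz zy].
  exact: lt_le_trans ax xz.
- by move=> x /=; rewrite in_itv /= andbT.
- by exists (a + 1) => /=; rewrite in_itv /= andbT ltrDl.
Qed.

Section bounded.
Variables (a b : R).
Hypothesis ab : a < b.
Let I := `]a, b[%classic : set R.
Let HI : open_ray_part I a := open_ray_part_itv ab.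

Lemma itv_finite_measure_oo : (mu (I : set (measurableTypeR R)) < +oo)%E.
Proof. by rewrite lebesgue_measure_itv /=; case: ifP => _; rewrite ?ltry // -EFinD ltry. Qed.

Lemma L2r_prim_bounded c g : lint g -> L2r I (fun x => c + prim g x).
Proof.
move=> lg; have [M hM] := prim_bounded c b lg.
apply: (L2r_bounded (M := M)).
- exact: measurable_itv.
- exact: itv_finite_measure_oo.
- exact: measurable_prim_cst.
- by move=> x; rewrite /I /= in_itv /= => /andP[_ /ltW /hM].
Qed.

Lemma green_bounded u1 v1 w1 u2 v2 w2 : rep2 I a u1 v1 w1 -> rep2 I a u2 v2 w2 ->
  \int[mu]_(t in I) (u1 t * w2 t - w1 t * u2 t) =
  (u1 b * v2 b - v1 b * u2 b) - (u1 a * v2 a - v1 a * u2 a).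
Proof.
move=> r1 r2; rewrite (wronskian HI r1 r2 (ltW ab)) Rintegral_mkcond.
apply: Rintegral_supp_prim => t bt; rewrite restrict0E memNset // /I /= in_itv /=.
by move=> /andP[_]; rewrite ltNge (ltW bt).
Qed.
End bounded.

Section ray.
Variable (a : R).
Let I := `]a, +oo[%classic : set R.
Let HI : open_ray_part I a := open_ray_part_ray a.
Let mI : measurable (I : set (measurableTypeR R)). Proof. exact: measurable_itv. Qed.

(** The Wronskian is a constant plus the primitive of an integrable function, so it has a limit at
    infinity; being integrable itself, it tends to 0. *)
Lemma green_ray u1 v1 w1 u2 v2 w2 : rep2 I a u1 v1 w1 -> rep2 I a u2 v2 w2 ->
  \int[mu]_(t in I) (u1 t * w2 t - w1 t * u2 t) = - (u1 a * v2 a - v1 a * u2 a).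
Proof.
move=> r1 r2; have [iK iW] := wronskian_integrable HI r1 r2.
rewrite Rintegral_mkcond.
have := @prim_cvg_integrable0 R _ _ (u1 a * v2 a - v1 a * u2 a) iK iW.
move=> h; apply/eqP; rewrite -addr_eq0 addrC; apply/eqP; apply: h.
exists (a + 1) => x ax; have ax' : a < x by lra.
rewrite -(wronskian HI r1 r2 (ltW ax')) restrict0E mem_set; first by ring.
by rewrite /I /= in_itv /= andbT.
Qed.

(* If [v] were not square integrable, integration by parts would make [u v],
   and then the derivative of [u ^ 2], bounded below by a positive constant. *)
Lemma L2r_middle_derivative u v w : (forall x, u x = u a + prim (v \_ I) x) ->
  (forall x, v x = v a + prim (w \_ I) x) -> L2r I u -> L2r I w -> L2r I v.
Proof.
move=> uE vE uu ww.
have lw := L2r_lint HI ww.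
have lv : lint (v \_ I).
  by rewrite (_ : v = (fun x => v a + prim (w \_ I) x)); [exact: (lint_patch_prim HI)|apply/funext].
have mv : measurable_fun [set: R] v.
  exact: continuous_measurable_fun (rep_continuous lw vE).
have mu_ : measurable_fun [set: R] u.
  exact: continuous_measurable_fun (rep_continuous lv uE).
pose k := (fun t => u t * w t) \_ I.
have ik : mu.-integrable setT (EFin \o k) by apply: (integrable_restrictT HI); exact: L2r_mul.
have ink : mu.-integrable setT (EFin \o (fun t => `|k t|)) by exact: integrable_norm.
pose q := (fun t => v t ^+ 2) \_ I.
have L1 := lint_by_parts (u a) (v a) lv lw.
have hE : (fun t => (v \_ I) t * (v a + prim (w \_ I) t) + (u a + prim (v \_ I) t) * (w \_ I) t)
   = (fun t => q t + k t).
  by apply/funext => t; rewrite -uE -vE /q /k !restrict0E; case: ifP => _; ring.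
have lk := integrable_lint ik.
have lq : lint q.
  have -> : q = fun t => (q t + k t) - k t by apply/funext => t; ring.
  by apply: lintB => //; rewrite -hE.
have q0 t : 0 <= q t by rewrite /q restrict0E; case: ifP => _; rewrite ?sqr_ge0.
have E x : a <= x -> u x * v x - u a * v a = prim q x + prim k x.
  move=> ax; have := by_parts (u a) (v a) lv lw ax.
  rewrite -!uE -!vE hE !primD //.
  have -> : prim q a = 0 by exact: (prim_restrict_le HI).
  have -> : prim k a = 0 by exact: (prim_restrict_le HI).
  by rewrite addr0 subr0.
pose B := \int[mu]_t `|k t|.
have kB x : - B <= prim k x.
  rewrite lerNl; apply: (le_trans (ler_norm _)); rewrite normrN.
  apply: (le_trans (le_normr_Rintegral _ (lk x))) => //.
  exact: (prim_le_integral x ink).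
split; first exact: measurable_funTS.
suff : mu.-integrable setT (EFin \o q).
  by rewrite -restrict_EFin => /integrable_restrict; rewrite setTI; apply.
have [[M hM]|nM] := pselect (exists M, forall x, prim q x <= M).
  exact: (prim_bounded_integrable lq q0 hM).
(* Since u v = u(a) v(a) + [prim q] + [prim k] and [prim k] >= - B, this threshold yields u v >= 1
   beyond X. *)
exfalso; have [X qX] : exists X, B + u a * v a * (-1) + 1 < prim q X.
  apply: contrapT => nX; apply: nM; exists (B + u a * v a * (-1) + 1) => x.
  by rewrite leNgt; apply/negP => h; apply: nX; exists x.
pose Y := Num.max X (a + 1).
have uv x : Y <= x -> 1 <= u x * v x.
  rewrite ge_max => /andP[Xx ax].
  have := E x; have := kB x; have := prim_ge0 lq q0 Xx; lra.
have iu2 : mu.-integrable setT (EFin \o ((fun t => u t ^+ 2) \_ I)).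
  by apply: (integrable_restrictT HI); exact: (proj2 uu).
(* From Y on, u^2 grows at rate 2 u v >= 2, so u^2 >= 2 one unit further right. *)
apply: (@integrable_not_bounded_away _ _ (Y + 1) 2 iu2) => // x Yx.
have aY : a + 1 <= Y by rewrite le_max lexx orbT.
have Yx' : Y <= x by lra.
rewrite restrict0E mem_set; last by rewrite /I /= in_itv /= andbT; lra.
rewrite ger0_norm ?sqr_ge0 //.
have L2 := lint_by_parts (u a) (u a) lv lv.
have := by_parts (u a) (u a) lv lv Yx'; rewrite -!uE primB // => uuE.
have : \int[mu]_(t in `]Y, x]) 2 <= u x * u x - u Y * u Y.
  rewrite uuE; apply: le_Rintegral => //.
  - apply: measurable_bounded_integrable => //; first exact: itv_finite_measure.
    by exists 2; split; [exact: num_real|move=> z z2 t _; rewrite ger0_norm // ltW].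
  - exact: lint_itv.
  - move=> t /=; rewrite in_itv /= => /andP[Yt tx].
    have := uv t (ltW Yt); rewrite -!uE !restrict0E mem_set; first by lra.
    by rewrite /I /= in_itv /= andbT; lra.
rewrite Rintegral_cst_itv // expr2; have := sqr_ge0 (u Y); rewrite expr2; lra.
Qed.
End ray.
End Edges.

(** * Density of smooth functions *)

Section Density.
Context {R : realType}.
Notation mu := (@lebesgue_measure R).
Implicit Types f g h u v w : R -> R.

(** The Steklov average over [t, t + k], in place of convolution with a mollifier. For k > 0 it
    keeps sup bounds, enlarges the support only to the left, by k, and gains one derivative. *)
Definition avg (k : R) g t := (prim g (t + k) - prim g t) / k.

Lemma avg_le k M g t : 0 < k -> lint g -> (forall s, `|g s| <= M) -> `|avg k g t| <= M.
Proof.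
move=> k0 lg gM; rewrite /avg normrM normfV (gtr0_norm k0) ler_pdivrMr //.
have tk : t <= t + k by rewrite lerDl ltW.
apply: (le_trans (prim_norm lg tk)); rewrite primB //; last exact: lint_norm.
have -> : M * k = \int[mu]_(s in `]t, t + k]) M by rewrite Rintegral_cst_itv // addrC addKr.
apply: le_Rintegral => //.
- by apply: lint_itv; exact: lint_norm.
- apply: measurable_bounded_integrable => //; first exact: itv_finite_measure.
  by exists `|M|; split; [exact: num_real|move=> z Mz s _; rewrite ltW].
Qed.

Lemma avg_eq0 k g x y t : 0 < k -> lint g -> (forall s, ~~ (x <= s <= y) -> g s = 0) ->
  ~~ (x - k <= t <= y) -> avg k g t = 0.
Proof.
move=> k0 lg g0 ht; have tk : t <= t + k by rewrite lerDl ltW.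
rewrite /avg primB // (@eq_Rintegral _ _ _ _ _ (cst 0)) ?Rintegral_cst ?mul0r //.
move=> s; rewrite inE /= in_itv /= => /andP[ts stk]; apply: g0.
move: ht; rewrite !negb_and -!ltNge => /orP[h|h]; apply/orP; [left|right]; lra.
Qed.

Lemma continuous_shift g k : continuous g -> continuous (fun t => g (t + k)).
Proof.
by move=> cg t; apply: (@continuous_comp _ _ _ (fun t => t + k) g);
  [apply: cvgD; [exact: cvg_id|exact: cvg_cst]|exact: cg].
Qed.

Lemma continuous_avg k g : lint g -> continuous (avg k g).
Proof.
move=> lg t; apply: cvgM; last exact: cvg_cst.
apply: cvgB; last exact: continuous_prim.
exact: (continuous_shift (continuous_prim lg)).
Qed.

Lemma is_derive_shift_quot k f g : (forall t, is_derive t (1:R) f (g t)) ->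
  forall t, is_derive t (1:R) (fun t => (f (t + k) - f t) / k) ((g (t + k) - g t) / k).
Proof.
move=> df t.
have h : is_derive t (1:R) (fun t => f (t + k)) (g (t + k)).
  have d1 : is_derive t (1:R) (fun t => t + k) 1.
    by apply: is_derive_eq (is_deriveD (is_derive_id t (1:R)) (is_derive_cst k t (1:R))) _; rewrite addr0.
  have := @is_derive1_comp _ f (fun t => t + k) t _ _ (df (t + k)) d1.
  by rewrite mulr1.
have := is_deriveZ k^-1 (is_deriveB h (df t)).
rewrite /GRing.scale /= mulrC.
congr (is_derive _ _ _ _); apply/funext => s /=; rewrite /GRing.scale /= mulrC //.
Qed.

Lemma is_derive_avg k g : lint g -> continuous g ->
  forall t, is_derive t (1:R) (avg k g) ((g (t + k) - g t) / k).
Proof. by move=> lg cg; apply: is_derive_shift_quot; exact: is_derive_prim. Qed.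

(** Where the primitive has derivative [g t], the averages are values at t + 1/(n+1) of its
    Caratheodory slope, which is continuous at t. *)
Lemma cvg_avg g : lint g -> {ae mu, forall t, avg n.+1%:R^-1 g t @[n --> \oo] --> g t}.
Proof.
move=> lg; apply: ae_imply (ae_derive_prim lg) => t [dt gt].
have d : is_derive t (1:R) (prim g) (g t) by apply: DeriveDef; [exact: dt|rewrite -derive1E].
have [q [qE qc <-]] := (is_derive1_caratheodory (prim g) t (g t)).1 d.
have -> : (fun n => avg n.+1%:R^-1 g t) = (fun n => q (t + n.+1%:R^-1)).
  apply/funext => n; rewrite /avg qE [t + _ - t]addrAC subrr add0r mulfK // invr_eq0 pnatr_eq0 //.
apply: (@cvg_comp _ _ _ (fun n : nat => t + n.+1%:R^-1) q _ _ _ _ qc).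
have : t + n.+1%:R^-1 @[n --> \oo] --> t + 0 by apply: cvgD; [exact: cvg_cst|exact: cvg_harmonic].
by rewrite addr0.
Qed.

Section interval.
Variables (I : set R) (a : R).
Hypothesis HI : open_ray_part I a.
Let oI := orp_open HI.
Let aI := orp_lb HI.
Let mI : measurable (I : set (measurableTypeR R)). Proof. exact: open_measurable. Qed.

Definition dist2 f g := \int[mu]_(t in I) (f t - g t) ^+ 2.

Lemma L2rB f g : L2r I f -> L2r I g -> L2r I (fun t => f t - g t).
Proof.
move=> ff gg; have := L2r_lin (-1) mI ff gg; apply: eq_L2r => // t _; ring.
Qed.

Lemma dist2_triangle f g h : L2r I f -> L2r I g -> L2r I h ->
  dist2 f h <= 2 * dist2 f g + 2 * dist2 g h.
Proof.
move=> ff gg hh.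
have [_ i1] := L2rB ff gg; have [_ i2] := L2rB gg hh; have [_ i3] := L2rB ff hh.
rewrite /dist2 -!RintegralZl // -RintegralD //.
- apply: le_Rintegral => //.
    exact: (integrableD mI (integrableZl mI 2 i1) (integrableZl mI 2 i2)).
  move=> t _; have := sqr_ge0 ((f t - g t) - (g t - h t)); rewrite !expr2; lra.
- exact: (integrableZl mI 2 i1).
- exact: (integrableZl mI 2 i2).
Qed.

Lemma dominated_small (D : set (measurableTypeR R)) (p : nat -> R -> R) (q : R -> R) e : measurable D ->
  (forall n, measurable_fun D (p n)) -> mu.-integrable D (EFin \o q) ->
  {ae mu, forall t, D t -> p n t @[n --> \oo] --> (0 : R)} ->
  (forall n t, D t -> 0 <= p n t <= q t) -> 0 < e ->
  \forall n \near \oo, \int[mu]_(t in D) p n t < e.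
Proof.
move=> mD mp iq p0 pq e0.
have [] := @dominated_convergence _ _ _ mu D mD (fun n => EFin \o p n) (EFin \o cst 0) (EFin \o q).
- by move=> n; exact/measurable_EFinP.
- by apply/measurable_EFinP; exact: measurable_cst.
- apply: ae_imply p0 => t p0 Dt; apply: cvg_EFin; first by near=> n.
  exact: p0.
- exact: iq.
- by apply: aeW => t n Dt /=; have /andP[h1 h2] := pq n t Dt; rewrite ger0_norm // lee_fin.
move=> _ _ /= h.
have ip n : mu.-integrable D (EFin \o p n).
  apply: (le_integrable mD _ _ iq); first exact/measurable_EFinP.
  move=> t Dt /=; have /andP[h1 h2] := pq n t Dt; rewrite lee_fin !ger0_norm //.
  exact: le_trans h2.
have {}h : (\int[mu]_(t in D) p n t)%:E @[n --> \oo] --> (0 : R)%:E.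
  have E n : ((\int[mu]_(t in D) p n t)%:E = \int[mu]_(t in D) (p n t)%:E)%E.
    by rewrite /Rintegral fineK //; exact: (integrable_fin_num _ (ip n)).
  under eq_fun do rewrite E.
  by rewrite integral0 in h.
have {}h : \int[mu]_(t in D) p n t @[n --> \oo] --> (0 : R) by exact: (fine_cvg h).
move/cvgrPdist_lt : h => /(_ _ e0); apply: filterS => n /=.
rewrite sub0r normrN; apply: le_lt_trans; exact: ler_norm.
Unshelve. all: by end_near.
Qed.

Lemma supported_L2r f M : measurable_fun [set: R] f -> (forall t, `|f t| <= M) ->
  supported I f -> L2r I f.
Proof.
move=> mf fM [x [y [Ix Iy f0]]]; split; first exact: measurable_funTS.
have mD : measurable ((`]-oo, y]%classic : set (measurableTypeR R)) `&` I) by exact: measurableI.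
have : mu.-integrable (`]-oo, y] `&` I) (EFin \o (fun t => f t ^+ 2)).
  apply: measurable_bounded_integrable => //.
  - exact: (finite_ray_part HI).
  - by apply: measurable_funX; exact: measurable_funTS.
  - exists (M ^+ 2); split; first exact: num_real.
    move=> z Mz t _ /=; rewrite normrX; apply: ltW; apply: le_lt_trans Mz.
    by rewrite lerXn2r ?nnegrE // (le_trans _ (fM t)).
move=> /integrable_mkcond - /(_ mD) h; apply/integrable_mkcond => //.
apply: eq_integrable h => // t _; rewrite !patchE in_setI.
case: (boolP (t \in I)) => It; rewrite ?andbT ?andbF //; case: ifPn => //.
rewrite notin_setE /= in_itv /= => /negP; rewrite -ltNge => yt.
by rewrite /= f0 ?expr0n // negb_and -!ltNge yt orbT.
Qed.

(** A class preserved by averaging, with the same bound [M], when k is small enough for the support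
    to stay inside [I]. *)
Record nice f (M : R) : Prop := Nice {
  nice_meas : measurable_fun [set: R] f;
  nice_bd : forall t, `|f t| <= M;
  nice_supp : supported I f }.

Lemma nice_lint f M : nice f M -> lint f.
Proof.
by move=> [mf fM sf]; rewrite -(supported_patch HI sf); apply: (lint_patch HI) => // x; exists M.
Qed.

Lemma nice_L2r f M : nice f M -> L2r I f.
Proof. by move=> [mf fM sf]; exact: supported_L2r fM sf. Qed.

Lemma avg_approx f M e : nice f M -> 0 < e ->
  exists k, [/\ 0 < k, nice (avg k f) M & dist2 f (avg k f) < e].
Proof.
move=> nf e0; have lf := nice_lint nf; have [mf fM [x [y [Ix Iy f0]]]] := nf.
have /nbhs_ballP[d /= d0 hd] : nbhs x I by exact: open_nbhs_nbhs.
have M0 : 0 <= M by exact: le_trans (fM x).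
have ma k : measurable_fun [set: R] (avg k f).
  by apply: continuous_measurable_fun; exact: continuous_avg.
(* Room to the left of the support: averages over lengths below d / 2 stay supported in [x', y],
   whose part in [I] has finite measure, so that the constant (2 M)^2 dominates. *)
pose x' := x - d / 2.
have Ix' : I x'.
  apply: hd; rewrite /ball /= /x' opprB addrC subrK gtr0_norm ?divr_gt0 //; lra.
have n0 (n : nat) : 0 < (n.+1%:R : R)^-1 by rewrite invr_gt0.
have := @dominated_small (`[x', y]%classic `&` I) (fun n t => (f t - avg n.+1%:R^-1 f t) ^+ 2)
    (fun=> (2 * M) ^+ 2) e _ _ _ _ _ e0.
have mD : measurable ((`[x', y]%classic : set (measurableTypeR R)) `&` I) by exact: measurableI.
move=> H; have {}H : \forall n \near \oo, \int[mu]_(t in `[x', y] `&` I) (f t - avg n.+1%:R^-1 f t) ^+ 2 < e.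
  apply: H => //.
  - move=> n; apply: measurable_funX; apply: measurable_funB;
      [exact: (measurable_funTS mf)|exact: (measurable_funTS (ma _))].
  - apply: measurable_bounded_integrable => //.
      apply: le_lt_trans (finite_ray_part HI y); apply: le_measure; rewrite ?inE //; first exact: measurableI.
      by move=> t [/= + It]; rewrite !in_itv /= => /andP[_ ->].
    by exists ((2 * M) ^+ 2); split; [exact: num_real|move=> z Mz t _ /=; rewrite ger0_norm ?sqr_ge0 ?ltW].
  - apply: ae_imply (cvg_avg lf) => t ct _.
    have : (f t - avg n.+1%:R^-1 f t) ^+ 2 @[n --> \oo] --> (f t - f t) ^+ 2.
      rewrite expr2; under eq_fun do rewrite expr2.
      by apply: cvgM; (apply: cvgB; [exact: cvg_cst|exact: ct]).
    by rewrite subrr expr0n.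
  - move=> n t _; rewrite sqr_ge0 /= -real_normK ?num_real // lerXn2r ?nnegrE ?mulr_ge0 //.
    apply: (le_trans (ler_normB _ _)); have := fM t; have := avg_le t (n0 n) lf fM; lra.
have : \forall n \near \oo, (n.+1%:R : R)^-1 < d / 2.
  have := @cvg_harmonic R; move/cvgrPdist_lt => /(_ (d / 2)).
  rewrite divr_gt0 // => /(_ isT); apply: filterS => n /=.
  by rewrite sub0r normrN gtr0_norm.
move=> hn; have [n [h1 h2]] : exists n : nat, (n.+1%:R : R)^-1 < d / 2 /\
    \int[mu]_(t in `[x', y] `&` I) (f t - avg n.+1%:R^-1 f t) ^+ 2 < e.
  by have [n] := filter_ex (filterI hn H); exists n.
have z t : ~~ (x' <= t <= y) -> avg n.+1%:R^-1 f t = 0.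
  move=> ht; apply: (avg_eq0 (n0 n) lf f0); apply: contra ht => /andP[h3 h4].
  rewrite h4 andbT; apply: le_trans h3; by rewrite lerD2l lerN2 ltW.
exists n.+1%:R^-1; split=> //.
- split; [exact: ma|by move=> t; exact: avg_le|by exists x', y].
- apply: le_lt_trans h2; rewrite le_eqVlt; apply/orP; left; apply/eqP.
  rewrite /dist2 Rintegral_mkcondl; apply: eq_Rintegral => t _; rewrite restrict0E.
  case: ifPn => //; rewrite notin_setE /= in_itv /= => /negP ht.
  rewrite z // f0 ?subr0 ?expr0n //; apply: contra ht => /andP[h3 h4].
  by rewrite h4 andbT /x'; lra.
Qed.

Lemma rep2_C2 f f1 f2 : supported I f ->
  (forall t, is_derive t (1:R) f (f1 t)) -> (forall t, is_derive t (1:R) f1 (f2 t)) ->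
  continuous f2 -> rep2 I a f f1 f2.
Proof.
move=> sf d1 d2 c2.
have E1 : derive1 f = f1 by apply/funext => t; exact: is_derive1_val.
have E2 : derive1 f1 = f2 by apply/funext => t; exact: is_derive1_val.
have sf1 : supported I f1 by rewrite -E1; exact: supported_derive1.
have sf2 : supported I f2 by rewrite -E2; exact: supported_derive1.
have c1 := is_derive_continuous d2; have c0 := is_derive_continuous d1.
have N h : continuous h -> supported I h -> L2r I h.
  move=> ch sh; have [M hM] := supported_bounded ch sh.
  by apply: supported_L2r hM sh; exact: continuous_measurable_fun.
have E h h1 : supported I h1 -> (forall t, is_derive t (1:R) h (h1 t)) ->
    continuous h1 -> forall t, h t = h a + prim (h1 \_ I) t.
  move=> sh1 dh ch1 t; rewrite (supported_patch HI sh1).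
  have l1 := lint_supported HI ch1 sh1.
  have D0 s : is_derive s (1:R) (h - prim h1) 0.
    by have := is_deriveB (dh s) (is_derive_prim l1 ch1 s); rewrite subrr.
  have := is_derive_0_is_cst t a D0; rewrite !fctE.
  rewrite [prim h1 a]prim_eq0; first by move=> H; rewrite -[LHS](subrK (prim h1 t)) H subr0.
  move=> s sa; have [x [y [Ix _ z]]] := sh1; apply: z.
  by rewrite negb_and -!ltNge (le_lt_trans sa (aI Ix)).
split; [exact: N|exact: N|exact: N|exact: E|exact: E].
Qed.

(** Three averages are taken: the first makes [f] continuous, the second C^1, the third C^2, as
    [rep2_C2] requires. *)
Lemma nice_dense f M e : nice f M -> 0 < e ->
  exists u v w, [/\ rep2 I a u v w, supported I u, supported I v & dist2 f u < e].
Proof.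
(* The triangle inequality for squared distances, used twice, bounds the total by 10 e / 16. *)
move=> nf e0; have e8 : 0 < e / 16 by rewrite divr_gt0.
have [k1 [k10 n1 h1]] := avg_approx nf e8; set g1 := avg k1 f in n1 h1.
have [k2 [k20 n2 h2]] := avg_approx n1 e8; set g2 := avg k2 g1 in n2 h2.
have [k3 [k30 n3 h3]] := avg_approx n2 e8; set g3 := avg k3 g2 in n3 h3.
have c1 : continuous g1 by apply: continuous_avg; exact: nice_lint nf.
have c2 : continuous g2 by apply: continuous_avg; exact: nice_lint n1.
have d2 := is_derive_avg k2 (nice_lint n1) c1.
have d3 := is_derive_avg k3 (nice_lint n2) c2.
have d3' := is_derive_shift_quot k3 d2.
have cq k h : continuous h -> continuous (fun t => (h (t + k) - h t) / k).
  move=> ch t; apply: cvgM; last exact: cvg_cst.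
  by apply: cvgB; [exact: (continuous_shift ch)|exact: ch].
exists g3, (fun t => (g2 (t + k3) - g2 t) / k3),
  (fun t => ((fun t => (g1 (t + k2) - g1 t) / k2) (t + k3) - (fun t => (g1 (t + k2) - g1 t) / k2) t) / k3).
split.
- by apply: rep2_C2 d3 d3' _; [exact: nice_supp n3|apply: (cq); exact: cq].
- exact: nice_supp n3.
- have := supported_derive1 (nice_supp n3); congr supported; apply/funext => t; exact: is_derive1_val.
- have := dist2_triangle (nice_L2r nf) (nice_L2r n1) (nice_L2r n3).
  have := dist2_triangle (nice_L2r n1) (nice_L2r n2) (nice_L2r n3); lra.
Qed.

(** Cutting off along segments with ends in [I] that eventually contain each point gives supports
    inside [I]. *)
Definition exhausted := exists x_ y_ : nat -> R,
  (forall n, I (x_ n) /\ I (y_ n)) /\ forall t, I t -> \forall n \near \oo, x_ n <= t <= y_ n.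

Definition clamp (n s : R) : R := Num.max (- n) (Num.min n s).

Lemma clamp_le n s : 0 <= n -> `|clamp n s| <= n.
Proof.
move=> n0; rewrite /clamp ler_norml le_max lexx /= ge_max ge_min lexx orTb andbT.
lra.
Qed.

Lemma clamp_dist n s : 0 <= n -> (s - clamp n s) ^+ 2 <= s ^+ 2.
Proof.
move=> n0; rewrite /clamp maxEle minEle; case: (leP n s) => h1; case: ifPn => h2; rewrite ?expr2; nra.
Qed.

Lemma clamp_id n s : `|s| <= n -> clamp n s = s.
Proof.
by rewrite ler_norml => /andP[h1 h2]; rewrite /clamp min_r // max_r.
Qed.

(** Truncating both values and domain leads to [nice] functions; clamping moves a value by at most
    its modulus, so u^2 dominates the squared error. The support of [v] is tracked because boundary
    derivatives have to vanish too. *)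
Lemma L2r_dense u e : exhausted -> L2r I u -> 0 < e ->
  exists f v w, [/\ rep2 I a f v w, supported I f, supported I v & dist2 u f < e].
Proof.
move=> [x_ [y_ [Ixy ex]]] uu e0.
pose f n t := clamp n%:R ((u \_ I) t) * \1_(`[x_ n, y_ n]%classic : set (measurableTypeR R)) t.
have lu := L2r_lint HI uu.
have f0 n t : ~~ (x_ n <= t <= y_ n) -> f n t = 0.
  by move=> h; rewrite /f indicE memNset ?mulr0 //= in_itv /=; exact/negP.
have f1 n t : x_ n <= t <= y_ n -> f n t = clamp n%:R ((u \_ I) t).
  by move=> h; rewrite /f indicE mem_set ?mulr1 //= in_itv /=.
have nf n : nice (f n) n%:R.
  split.
  - apply: measurable_funM; last exact: measurable_indic.
    apply: measurable_maxr => //; apply: measurable_minr => //; exact: lint_measurable.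
  - move=> t; have [h|h] := boolP (x_ n <= t <= y_ n); last by rewrite f0 // normr0.
    by rewrite f1 // clamp_le.
  - by have [? ?] := Ixy n; exists (x_ n), (y_ n); split=> // t; exact: f0.
have e4 : 0 < e / 4 by rewrite divr_gt0.
have : \forall n \near \oo, \int[mu]_(t in I) (u t - f n t) ^+ 2 < e / 4.
  apply: (@dominated_small I _ (fun t => u t ^+ 2)) => //.
  - move=> n; apply: measurable_funX; apply: measurable_funB; first exact: (proj1 uu).
    exact: (measurable_funTS (nice_meas (nf n))).
  - exact: (proj2 uu).
  - apply: aeW => t It; have := ex t It => exn.
    apply: cvg_near_cst; near=> n.
    rewrite f1 ?clamp_id; last first.
    + by near: n.
    + rewrite restrict0E mem_set //; near: n; exact: nbhs_infty_ger.
    by rewrite restrict0E mem_set // subrr expr0n.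
  - move=> n t It; rewrite sqr_ge0 /=; have [h|h] := boolP (x_ n <= t <= y_ n); last by rewrite f0 // subr0.
    by rewrite f1 // restrict0E mem_set // clamp_dist.
move=> /filter_ex[n hn].
have [g [v [w [rg sg sv dg]]]] := nice_dense (nf n) e4.
exists g, v, w; split => //.
have := dist2_triangle uu (nice_L2r (nf n)) (rep_u rg); rewrite /dist2 in dg *; lra.
Unshelve. all: by end_near.
Qed.
End interval.
End Density.

(** * Complex-valued functions and traces *)

Section ComplexParts.
Context {R : realType}.
Implicit Types x y : R[i].
Notation Re := (@complex.Re R).
Notation Im := (@complex.Im R).

Lemma ReM x y : Re (x * y) = Re x * Re y - Im x * Im y.
Proof. by case: x => a b; case: y. Qed.
Lemma ImM x y : Im (x * y) = Re x * Im y + Im x * Re y.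
Proof. by case: x => a b; case: y => c d /=. Qed.
Lemma ReD x y : Re (x + y) = Re x + Re y.
Proof. by case: x => a b; case: y. Qed.
Lemma ImD x y : Im (x + y) = Im x + Im y.
Proof. by case: x => a b; case: y. Qed.
Lemma ReN x : Re (- x) = - Re x.
Proof. by case: x. Qed.
Lemma ImN x : Im (- x) = - Im x.
Proof. by case: x. Qed.
Lemma ReJ x : Re (conjc x) = Re x.
Proof. by case: x. Qed.
Lemma ImJ x : Im (conjc x) = - Im x.
Proof. by case: x. Qed.
Lemma complex_ext x y : Re x = Re y -> Im x = Im y -> x = y.
Proof. by case: x => a b; case: y => c d /= -> ->. Qed.
Definition ReImE := (ReM, ImM, ReD, ImD, ReN, ImN, ReJ, ImJ).
End ComplexParts.

(** * Complex-valued L^2 functions and their weak derivatives *)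

Section ComplexSobolev.
Context {R : realType}.
Notation mu := (@lebesgue_measure R).
Notation Re := (@complex.Re R).
Notation Im := (@complex.Im R).
Implicit Types (u v w f : R -> R[i]) (p q : R -> R).
Local Open Scope complex_scope.

Section interval.
Variables (I : set R) (a : R).
Hypothesis HI : open_ray_part I a.
Let oI := orp_open HI.
Let cI := orp_convex HI.
Let I0 := orp_ex HI.
Let mI : measurable (I : set (measurableTypeR R)). Proof. exact: open_measurable. Qed.

Lemma L2P u : L2 I u <-> L2r I (fun x => Re (u x)) /\ L2r I (fun x => Im (u x)).
Proof.
split=> [[mr mi h]|[[mr ir] [mi ii]]].
  have K p : measurable_fun I p -> (forall x, p x ^+ 2 <= sqnorm (u x)) -> L2r I p.
    move=> mp pu; split => //; apply/integrableP; split.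
      by apply/measurable_EFinP; exact: measurable_funX.
    apply: le_lt_trans h; apply: ge0_le_integral => //.
    - by apply: measurableT_comp => //; apply/measurable_EFinP; exact: measurable_funX.
    - by apply/measurable_EFinP; apply: measurable_funD; exact: measurable_funX.
    - by move=> x _ /=; rewrite ger0_norm ?sqr_ge0 // lee_fin.
  by split; apply: K => // x; rewrite /sqnorm ?lerDl ?lerDr sqr_ge0.
split => //; exact: (integrable_lty mI (integrableD mI ir ii)).
Qed.

Lemma rtest_test p : rtest I p -> test_function I (fun x => (p x)%:C).
Proof.
move=> [sp [x [y [Ix Iy p0]]]]; split; first exact: sp.
  by apply: (@elem_smooth_smooth _ (fun=> 0)); exact: elem_cst.
exists `[x, y]%classic; split; first exact: segment_compact.
- by move=> t /=; rewrite in_itv /= => h; exact: cI h.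
- by move=> t /= /negP; rewrite in_itv /= => h; rewrite p0.
Qed.

Lemma test_rtest f : test_function I f -> rtest I (fun x => Re (f x)) /\ rtest I (fun x => Im (f x)).
Proof.
move=> [sr si [K [cK KI f0]]].
have [x [y [Ix Iy fxy]]] : exists x y, [/\ I x, I y & forall t, ~~ (x <= t <= y) -> f t = 0].
  (* The segment is spanned by the least and greatest points of [K]; for empty [K] any point of [I]
     serves. *)
  have [K0|nK] := pselect (K !=set0); last first.
    have [x Ix] := I0; exists x, x; split=> // t _; apply: f0 => Kt; apply: nK; by exists t.
  have cid : {within K, continuous (fun x : R => x)} by apply: continuous_subspaceT => ?; exact: cvg_id.
  have [x Kx hx] := compact_EVT_min K0 cK cid.
  have [y Ky hy] := compact_EVT_max K0 cK cid.
  rewrite inE in Kx; rewrite inE in Ky.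
  exists x, y; split; [exact: KI|exact: KI|].
  move=> t h; apply: f0 => Kt; move/negP: h; apply.
  by rewrite hx ?hy // inE.
by split; split => //; exists x, y; split => // t /fxy ->.
Qed.

Lemma Rintegral_pair p q : supported I q -> \int[mu]_(x in I) (p x * q x) = pair (p \_ I) q.
Proof.
move=> sq; rewrite (pair_patch HI) // /pair -[in RHS](supported_patch HI sq) Rintegral_mkcond.
by apply: eq_Rintegral => t _; rewrite !restrict0E; case: ifP; rewrite ?mulr0.
Qed.

Lemma integrable_pair p q : lint (p \_ I) -> continuous q -> supported I q ->
  mu.-integrable I (EFin \o (fun x => p x * q x)).
Proof.
move=> lp cq sq; have [x [y [Ix Iy q0]]] := sq.
have l := lint_pair lp cq sq.
have : mu.-integrable (`]-oo, y]%classic `&` I) (EFin \o (fun t => (p \_ I) t * q t)).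
  by apply: (lint_subset l (x := y)) => [|t []]; first exact: measurableI.
have mD : measurable ((`]-oo, y]%classic : set (measurableTypeR R)) `&` I) by exact: measurableI.
move=> /integrable_mkcond - /(_ mD) h; apply/integrable_mkcond => //.
apply: eq_integrable h => // t _; rewrite !patchE in_setI.
case: (boolP (t \in I)) => It; rewrite ?andbT ?andbF //=; case: ifPn; rewrite ?restrict0E ?It //.
rewrite notin_setE /= in_itv /= => /negP; rewrite -ltNge => yt.
by rewrite q0 ?mulr0 // negb_and -!ltNge yt orbT.
Qed.

Lemma Cint_pair u f : lint ((fun x => Re (u x)) \_ I) -> lint ((fun x => Im (u x)) \_ I) ->
  continuous (fun x => Re (f x)) -> continuous (fun x => Im (f x)) ->
  supported I (fun x => Re (f x)) -> supported I (fun x => Im (f x)) ->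
  Cint I (fun x => u x * f x) =
   (pair ((fun x => Re (u x)) \_ I) (fun x => Re (f x)) - pair ((fun x => Im (u x)) \_ I) (fun x => Im (f x)))
   +i* (pair ((fun x => Re (u x)) \_ I) (fun x => Im (f x)) + pair ((fun x => Im (u x)) \_ I) (fun x => Re (f x))).
Proof.
move=> lr li cr ci sr si; rewrite /Cint; congr (_ +i* _).
  under eq_Rintegral do rewrite ReM.
  by rewrite RintegralB // ?Rintegral_pair //; exact: integrable_pair.
under eq_Rintegral do rewrite ImM.
by rewrite RintegralD // ?Rintegral_pair //; exact: integrable_pair.
Qed.

Definition rweak p q := forall h, rtest I h -> pair (p \_ I) (derive1 h) = - pair (q \_ I) h.

Lemma derive1_cst0 : derive1 (fun=> (0 : R)) = fun=> 0.
Proof. by apply/funext => x; apply: is_derive1_val; exact: is_derive_cst. Qed.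

Lemma pair0r p : pair p (fun=> 0) = 0.
Proof. by rewrite /pair; under eq_Rintegral do rewrite mulr0; rewrite Rintegral_cst // mul0r. Qed.

(** Real test functions already separate real and imaginary parts; conversely a complex test
    function splits into two real ones. *)
Lemma weakP u v : L2 I u -> L2 I v -> weak_derivative I u v <->
  rweak (fun x => Re (u x)) (fun x => Re (v x)) /\ rweak (fun x => Im (u x)) (fun x => Im (v x)).
Proof.
move=> /L2P[ur ui] /L2P[vr vi].
have lur := L2r_lint HI ur; have lui := L2r_lint HI ui.
have lvr := L2r_lint HI vr; have lvi := L2r_lint HI vi.
have s0 : supported I (fun=> (0 : R)) by have [x Ix] := I0; exists x, x.
have c0 : continuous (fun _ : R => (0 : R)) by exact: cst_continuous.
split=> [uv|[uvr uvi] f tf].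
  have E h : rtest I h ->
      pair ((fun x => Re (u x)) \_ I) (derive1 h) = - pair ((fun x => Re (v x)) \_ I) h /\
      pair ((fun x => Im (u x)) \_ I) (derive1 h) = - pair ((fun x => Im (v x)) \_ I) h.
    move=> rh; have [ch sh ch' sh'] := rtestP rh.
    have := uv _ (rtest_test rh).
    rewrite !Cint_pair //=; try by rewrite derive1_cst0.
    by rewrite derive1_cst0 !pair0r !subr0 !add0r => -[].
  by split=> h /E[].
have [rp rq] := test_rtest tf.
have [cp sp cp' sp'] := rtestP rp; have [cq sq cq' sq'] := rtestP rq.
rewrite !Cint_pair //= uvr // uvr // uvi // uvi //.
apply: complex_ext; rewrite !ReImE /=; ring.
Qed.

Lemma ae_eq_sym_trans (T : Type) (f g h : R -> T) : ae_eq mu I f g -> ae_eq mu I f h -> ae_eq mu I g h.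
Proof. by apply: ae_imply2 => x fg fh Ix; rewrite -fg // fh. Qed.

Lemma complex_ae_eqP u v : ae_eq mu I u v <-> {ae mu, forall x, I x -> Re (u x) = Re (v x)} /\
  {ae mu, forall x, I x -> Im (u x) = Im (v x)}.
Proof.
split=> [uv|[]]; first by split; apply: ae_imply uv => x uv Ix; rewrite uv.
by apply: ae_imply2 => x er ei Ix; apply: complex_ext; [exact: er|exact: ei].
Qed.

Lemma Rintegral_ae_mul p q h : L2r I p -> L2r I q -> {ae mu, forall x, I x -> p x = q x} ->
  continuous h -> pair (p \_ I) h = pair (q \_ I) h.
Proof.
move=> pp qq pq ch.
have m z : L2r I z -> measurable_fun [set: measurableTypeR R] (fun t => (z \_ I) t * h t).
  move=> zz; apply: measurable_funM; last exact: continuous_measurable_fun.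
  exact: lint_measurable (L2r_lint HI zz).
apply: Rintegral_ae => //; [exact: m|exact: m|].
by apply: ae_imply pq => x e _; rewrite !restrict0E; case: ifPn => //; rewrite inE => /e ->.
Qed.

Lemma rweak_uniq p p' q q' : L2r I p -> L2r I p' -> L2r I q -> L2r I q' ->
  {ae mu, forall x, I x -> p x = p' x} -> rweak p q -> rweak p' q' ->
  {ae mu, forall x, I x -> q x = q' x}.
Proof.
move=> pp pp' qq qq' epp' w w'.
have lq := L2r_lint HI qq; have lq' := L2r_lint HI qq'.
have lb : lint (fun x => (q \_ I) x + (-1) * (q' \_ I) x) by apply: lintD => //; exact: lintZ.
have H : {ae mu, forall x, I x -> (q \_ I) x + (-1) * (q' \_ I) x = 0}.
  apply: (fundamental_lemma HI lb) => f rf; have [cf sf cf' sf'] := rtestP rf.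
  rewrite (pair_linl (I := I)) //.
  have := w _ rf; have := w' _ rf; rewrite (Rintegral_ae_mul pp pp' epp' cf').
  by move=> -> /eqP; rewrite eqr_opp => /eqP ->; rewrite mulN1r subrr.
apply: ae_imply H => x h Ix; have := h Ix; rewrite !restrict0E !mem_set //; lra.
Qed.

Lemma weak_uniq u u' v v' : L2 I u -> L2 I u' -> L2 I v -> L2 I v' -> ae_eq mu I u u' ->
  weak_derivative I u v -> weak_derivative I u' v' -> ae_eq mu I v v'.
Proof.
move=> Lu Lu' Lv Lv' uu'; rewrite !weakP // => -[wr wi] [wr' wi'].
have /L2P[ur ui] := Lu; have /L2P[ur' ui'] := Lu'.
have /L2P[vr vi] := Lv; have /L2P[vr' vi'] := Lv'.
have [er ei] := (complex_ae_eqP u u').1 uu'.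
by apply/complex_ae_eqP; split; [exact: rweak_uniq er wr wr'|exact: rweak_uniq ei wi wi'].
Qed.

Lemma weak_ae u u' v v' : L2 I u -> L2 I u' -> L2 I v -> L2 I v' -> ae_eq mu I u u' ->
  ae_eq mu I v v' -> weak_derivative I u v -> weak_derivative I u' v'.
Proof.
move=> Lu Lu' Lv Lv' uu' vv'; rewrite !weakP // => -[wr wi].
have /L2P[ur ui] := Lu; have /L2P[ur' ui'] := Lu'.
have /L2P[vr vi] := Lv; have /L2P[vr' vi'] := Lv'.
have [er ei] := (complex_ae_eqP u u').1 uu'; have [fr fi] := (complex_ae_eqP v v').1 vv'.
split=> h rh; have [ch sh ch' sh'] := rtestP rh.
  by rewrite -(Rintegral_ae_mul ur ur' er ch') wr // (Rintegral_ae_mul vr vr' fr ch).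
by rewrite -(Rintegral_ae_mul ui ui' ei ch') wi // (Rintegral_ae_mul vi vi' fi ch).
Qed.

(** The given [v] rules out the default value of [xget], and uniqueness of weak derivatives makes
    the choice immaterial up to null sets. *)
Lemma wderivP u v : L2 I u -> L2 I v -> weak_derivative I u v ->
  [/\ L2 I (wderiv I u), weak_derivative I u (wderiv I u) & ae_eq mu I (wderiv I u) v].
Proof.
move=> Lu Lv uv; have [L W] : L2 I (wderiv I u) /\ weak_derivative I u (wderiv I u).
  by rewrite /wderiv; case: xgetP => [w _ //|/(_ v)]; case.
split => //; apply: (weak_uniq Lu Lu L Lv) => //; exact: ae_eq_refl.
Qed.
End interval.
End ComplexSobolev.

(** * Traces and Green's formula for complex-valued functions *)

Section ComplexRep.
Context {R : realType}.
Notation mu := (@lebesgue_measure R).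
Notation Re := (@complex.Re R).
Notation Im := (@complex.Im R).
Implicit Types (u v w f : R -> R[i]) (p q : R -> R).
Local Open Scope complex_scope.

Lemma ae_exists (P : R -> Prop) (x e : R) : 0 < e -> {ae mu, forall y, P y} ->
  exists2 y, ball x e y & P y.
Proof.
move=> e0 [N [mN N0 PN]]; apply: contrapT => nP.
have sub : ball x e `<=` N.
  by move=> y xy; apply: PN => Py; apply: nP; exists y.
have H : (mu (ball x e) <= mu N)%E.
  by apply: le_measure; rewrite ?inE //; exact: measurable_ball.
have E : mu (ball x e) = (e *+ 2)%:E by apply: lebesgue_measure_ball; exact: ltW.
have : ((e *+ 2)%:E <= 0%:E)%E by rewrite -E; apply: (le_trans H); rewrite le_eqVlt N0 eqxx.
by rewrite lee_fin leNgt pmulrn_lgt0 // e0.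
Qed.

(** Uniqueness of traces. Near a point of the closure lies a ball contained in the open set [I];
    such a ball has positive measure and so contains a point where p = q. Continuity up to the
    closure does the rest. *)
Lemma closure_ae_eq (I : set R) (p q : R -> R) x : open I -> closure I x ->
  {within closure I, continuous p} -> {within closure I, continuous q} ->
  {ae mu, forall y, I y -> p y = q y} -> p x = q x.
Proof.
move=> oI cx /subspace_continuousP/(_ _ cx) cp /subspace_continuousP/(_ _ cx) cq pq.
apply/eqP/negPn/negP => npq.
have e0 : 0 < `|p x - q x| / 2 by rewrite divr_gt0 // normr_gt0 subr_eq0.
move/cvgrPdist_lt : cp => /(_ _ e0); rewrite near_withinE => np.
move/cvgrPdist_lt : cq => /(_ _ e0); rewrite near_withinE => nq.
have [y [Iy [py qy]]] := cx _ (filterI np nq).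
have : nbhs y (I `&` setT) by rewrite setIT; exact: open_nbhs_nbhs.
have [z [Iz pz qz ez]] : exists z, [/\ I z, `|p x - p z| < `|p x - q x| / 2,
    `|q x - q z| < `|p x - q x| / 2 & p z = q z].
  have : nbhs x ((fun t => closure I t -> `|p x - p t| < `|p x - q x| / 2) `&`
    (fun t => closure I t -> `|q x - q t| < `|p x - q x| / 2)) by exact: filterI.
  move=> /nbhs_interior nx.
  have [t [It tint]] := cx _ nx.
  have : nbhs t I by exact: open_nbhs_nbhs.
  move=> /(filterI tint) /nbhs_ballP[d /= d0 hd].
  have [z tz ez] := ae_exists t d0 pq.
  have [[h1 h2] Iz] := hd _ tz; exists z; split => //; last exact: ez.
  - by apply: h1; exact: subset_closure.
  - by apply: h2; exact: subset_closure.
have : `|p x - q x| <= `|p x - p z| + `|q x - q z|.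
  have -> : p x - q x = (p x - p z) - (q x - q z) by rewrite ez; ring.
  exact: ler_normB.
lra.
Qed.

Section interval.
Variables (I : set R) (a : R).
Hypothesis HI : open_ray_part I a.
Let oI := orp_open HI.
Let mI : measurable (I : set (measurableTypeR R)). Proof. exact: open_measurable. Qed.

Record crep u v w : Prop := CRep {
  crep_re : rep2 I a (fun x => Re (u x)) (fun x => Re (v x)) (fun x => Re (w x));
  crep_im : rep2 I a (fun x => Im (u x)) (fun x => Im (v x)) (fun x => Im (w x)) }.

Lemma crep_L2 u v w : crep u v w -> [/\ L2 I u, L2 I v & L2 I w].
Proof. by move=> [[? ? ? _ _] [? ? ? _ _]]; split; apply/(L2P HI). Qed.

Lemma crep_weak u v w : crep u v w -> weak_derivative I u v /\ weak_derivative I v w.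
Proof.
move=> c; have [Lu Lv Lw] := crep_L2 c; have [r i] := c.
split; apply/(weakP HI) => //; split=> h rh;
  by [have [] := rep2_weak HI r rh|have [] := rep2_weak HI i rh].
Qed.

Lemma trace_continuous u v (p : R) : closure I p -> continuous (fun x => Re (v x)) ->
  continuous (fun x => Im (v x)) -> ae_eq mu I u v -> trace I u p = v p.
Proof.
move=> cp cr ci uv; rewrite /trace.
have T : is_trace I u p (v p).
  by exists v; split => //; exact: continuous_subspaceT.
case: xgetP => [_ _ [g [gr gi ug <-]]|/(_ (v p))]; last by [].
have vg : ae_eq mu I g v by apply: ae_eq_sym_trans ug uv.
have [er ei] := (complex_ae_eqP I g v).1 vg.
apply: complex_ext.
- by apply: (closure_ae_eq oI cp gr _ er); exact: continuous_subspaceT.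
- by apply: (closure_ae_eq oI cp gi _ ei); exact: continuous_subspaceT.
Qed.

Lemma crep_H2 u0 u v w : crep u v w -> L2 I u0 -> ae_eq mu I u0 u ->
  [/\ H2 I u0, ae_eq mu I (wderiv I (wderiv I u0)) w,
      forall p : R, closure I p -> trace I u0 p = u p &
      forall p : R, closure I p -> trace I (wderiv I u0) p = v p].
Proof.
move=> c L0 e0; have [Lu Lv Lw] := crep_L2 c; have [uv vw] := crep_weak c.
have u0v : weak_derivative I u0 v.
  apply: (weak_ae HI Lu L0 Lv Lv _ _ uv); [exact: ae_eq_sym|exact: ae_eq_refl].
have [L1 W1 e1] := wderivP HI L0 Lv u0v.
have W2 : weak_derivative I (wderiv I u0) w.
  apply: (weak_ae HI Lv L1 Lw Lw _ _ vw); [exact: ae_eq_sym|exact: ae_eq_refl].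
have [L2' _ e2] := wderivP HI L1 Lw W2.
have [[ur vr wr uEr vEr] [ui vi wi uEi vEi]] := c.
split.
- by split => //; exists v, w.
- exact: e2.
- move=> p cp; apply: trace_continuous => //.
    exact: (rep_continuous (L2r_lint HI vr) uEr).
  exact: (rep_continuous (L2r_lint HI vi) uEi).
- move=> p cp; apply: trace_continuous => //.
    exact: (rep_continuous (L2r_lint HI wr) vEr).
  exact: (rep_continuous (L2r_lint HI wi) vEi).
Qed.

Lemma H2_crep u0 : H2 I u0 -> exists u v w, crep u v w /\ ae_eq mu I u0 u.
Proof.
move=> [L0 [v0 [w0 [Lv Lw uv vw]]]].
have [u0r u0i] := (L2P HI u0).1 L0; have [v0r v0i] := (L2P HI v0).1 Lv.
have [w0r w0i] := (L2P HI w0).1 Lw.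
have [uvr uvi] := (weakP HI L0 Lv).1 uv; have [vwr vwi] := (weakP HI Lv Lw).1 vw.
have [ur [vr [rr er _]]] := rep2_of_weak HI u0r v0r w0r uvr vwr.
have [ui [vi [ri ei _]]] := rep2_of_weak HI u0i v0i w0i uvi vwi.
exists (fun x => ur x +i* ui x), (fun x => vr x +i* vi x), w0.
by split => //; apply/complex_ae_eqP.
Qed.

(** Multiplication by z mixes real and imaginary parts, hence the auxiliary real statement [K] on
    combinations of three triples. *)
Lemma crep_lin z u v w u' v' w' : crep u v w -> crep u' v' w' ->
  crep (fun x => z * u x + u' x) (fun x => z * v x + v' x) (fun x => z * w x + w' x).
Proof.
have K (c1 c2 : R) p q r p1 q1 r1 p2 q2 r2 : rep2 I a p q r -> rep2 I a p1 q1 r1 -> rep2 I a p2 q2 r2 ->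
    rep2 I a (fun x => (p2 x + c1 * p x) + c2 * p1 x) (fun x => (q2 x + c1 * q x) + c2 * q1 x)
      (fun x => (r2 x + c1 * r x) + c2 * r1 x).
  move=> [A B C D E] [A1 B1 C1 D1 E1] [A2 B2 C2 D2 E2].
  have P (f g h : R -> R) x : L2r I f -> L2r I g -> L2r I h ->
      prim ((fun x => (h x + c1 * f x) + c2 * g x) \_ I) x =
      prim (h \_ I) x + c1 * prim (f \_ I) x + c2 * prim (g \_ I) x.
    move=> ff gg hh.
    have lf := L2r_lint HI ff; have lg := L2r_lint HI gg; have lh := L2r_lint HI hh.
    have lf' := lintZ c1 lf; have lg' := lintZ c2 lg; have lhf := lintD lh lf'.
    rewrite -(primZ c1) // -(primZ c2) // -primD // -primD //.
    by congr prim; apply/funext => t; rewrite !restrict0E; case: ifP => _; rewrite ?mulr0 ?addr0.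
  split; try by apply: L2r_lin => //; exact: L2r_lin.
  - by move=> x; rewrite P // D D1 D2; ring.
  - by move=> x; rewrite P // E E1 E2; ring.
move=> [r i] [r' i']; split.
  have := K (Re z) (- Im z) _ _ _ _ _ _ _ _ _ r i r'.
  by congr (rep2 I a _ _ _); apply/funext => x; rewrite !ReImE; ring.
have := K (Im z) (Re z) _ _ _ _ _ _ _ _ _ r i i'.
by congr (rep2 I a _ _ _); apply/funext => x; rewrite !ReImE; ring.
Qed.

Definition Cintegrable f := mu.-integrable I (EFin \o (fun x => Re (f x))) /\
  mu.-integrable I (EFin \o (fun x => Im (f x))).

Lemma L2_Cintegrable u v : L2 I u -> L2 I v -> Cintegrable (fun x => u x * conjc (v x)).
Proof.
move=> /(L2P HI)[ur ui] /(L2P HI)[vr vi]; split.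
- have := integrableD mI (L2r_mul mI ur vr) (L2r_mul mI ui vi).
  by apply: eq_integrable => // x _ /=; congr EFin; rewrite !ReImE; ring.
- have := integrableB mI (L2r_mul mI ui vr) (L2r_mul mI ur vi).
  by apply: eq_integrable => // x _ /=; congr EFin; rewrite !ReImE; ring.
Qed.

Lemma CintB f g : Cintegrable f -> Cintegrable g ->
  Cint I (fun x => f x - g x) = Cint I f - Cint I g.
Proof.
move=> [fr fi] [gr gi]; apply: complex_ext; rewrite !ReImE /=.
- by under eq_Rintegral do rewrite !ReImE; rewrite RintegralB.
- by under eq_Rintegral do rewrite !ReImE; rewrite RintegralB.
Qed.

Lemma CintN f : Cintegrable f -> Cint I (fun x => - f x) = - Cint I f.
Proof.
move=> [fr fi]; apply: complex_ext; rewrite !ReImE /= -mulN1r -RintegralZl //;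
  by apply: eq_Rintegral => x _; rewrite ReImE mulN1r.
Qed.

Lemma Cint_ae f g : measurable_fun I (fun x => Re (f x)) -> measurable_fun I (fun x => Im (f x)) ->
  measurable_fun I (fun x => Re (g x)) -> measurable_fun I (fun x => Im (g x)) ->
  ae_eq mu I f g -> Cint I f = Cint I g.
Proof.
move=> fr fi gr gi /complex_ae_eqP[er ei].
by rewrite /Cint (Rintegral_ae mI fr gr er) (Rintegral_ae mI fi gi ei).
Qed.

Lemma Cint_ae_mul u u' v v' : L2 I u -> L2 I u' -> L2 I v -> L2 I v' ->
  ae_eq mu I u u' -> ae_eq mu I v v' ->
  Cint I (fun x => u x * conjc (v x)) = Cint I (fun x => u' x * conjc (v' x)).
Proof.
move=> Lu Lu' Lv Lv' uu' vv'.
have [r i] := L2_Cintegrable Lu Lv; have [r' i'] := L2_Cintegrable Lu' Lv'.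
apply: Cint_ae; try by apply/measurable_EFinP; exact: (measurable_int mu).
by apply: ae_imply2 uu' vv' => x e1 e2 Ix; rewrite e1 // e2.
Qed.

(** [B] stands for the boundary form of the real Green formula on [I]; the sesquilinear version is
    assembled from the four pairings of real and imaginary parts. *)
Lemma Cint_green u1 v1 w1 u2 v2 w2 (B : (R -> R) -> (R -> R) -> (R -> R) -> (R -> R) -> R) :
  (forall p1 q1 r1 p2 q2 r2, rep2 I a p1 q1 r1 -> rep2 I a p2 q2 r2 ->
    \int[mu]_(t in I) (p1 t * r2 t - r1 t * p2 t) = B p1 q1 p2 q2) ->
  crep u1 v1 w1 -> crep u2 v2 w2 ->
  Cint I (fun x => u1 x * conjc (w2 x)) - Cint I (fun x => w1 x * conjc (u2 x)) =
  (B (Re \o u1) (Re \o v1) (Re \o u2) (Re \o v2) + B (Im \o u1) (Im \o v1) (Im \o u2) (Im \o v2)) +i*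
  (B (Im \o u1) (Im \o v1) (Re \o u2) (Re \o v2) - B (Re \o u1) (Re \o v1) (Im \o u2) (Im \o v2)).
Proof.
move=> G c1 c2; have [Lu1 Lv1 Lw1] := crep_L2 c1; have [Lu2 Lv2 Lw2] := crep_L2 c2.
have [r1 i1] := c1; have [r2 i2] := c2.
rewrite -CintB; [|exact: L2_Cintegrable|exact: L2_Cintegrable].
have K p1 q1 s1 p2 q2 s2 : rep2 I a p1 q1 s1 -> rep2 I a p2 q2 s2 ->
   mu.-integrable I (EFin \o (fun t => p1 t * s2 t - s1 t * p2 t)).
  move=> [A _ C _ _] [A' _ C' _ _].
  exact: (integrableB mI (L2r_mul mI A C') (L2r_mul mI C A')).
apply: complex_ext => /=.
- rewrite -(G _ _ _ _ _ _ r1 r2) -(G _ _ _ _ _ _ i1 i2) -RintegralD //; [|exact: K r1 r2|exact: K i1 i2].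
  by apply: eq_Rintegral => x _; rewrite !ReImE; ring.
- rewrite -(G _ _ _ _ _ _ i1 r2) -(G _ _ _ _ _ _ r1 i2) -RintegralB //; [|exact: K i1 r2|exact: K r1 i2].
  by apply: eq_Rintegral => x _; rewrite !ReImE; ring.
Qed.

(* The first hypothesis holds on bounded intervals and on rays, for different
   reasons. *)
Lemma crep_of_weak2 u w :
  (forall (w p q : R -> R), (forall x, p x = p a + prim (q \_ I) x) ->
     (forall x, q x = q a + prim (w \_ I) x) -> L2r I p -> L2r I w -> L2r I q) ->
  L2 I u -> L2 I w ->
  (forall h, rtest I h -> Cint I (fun x => (derive1 (derive1 h) x)%:C * conjc (u x)) =
      Cint I (fun x => (h x)%:C * conjc (w x))) ->
  exists u' v', crep u' v' w /\ ae_eq mu I u u'.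
Proof.
move=> middle /(L2P HI)[ur ui] /(L2P HI)[wr wi] H.
have P p h : continuous h -> supported I h ->
   pair (p \_ I) h = \int[mu]_(x in I) (p x * h x) by move=> ch sh; rewrite (Rintegral_pair HI).
have [||p [q [rr er]]] := rep2_of_weak2 HI ur wr.
- by move=> p q pE qE pp; exact: (middle _ _ _ pE qE pp wr).
- move=> h rh; have [ch sh ch' sh'] := rtestP rh; have [_ _ ch2 sh2] := rtestP (rtest_derive1 rh).
  rewrite !P //; have /(congr1 Re) /= := H _ rh => E.
  transitivity (\int[mu]_(x in I) Re ((derive1 (derive1 h) x)%:C * conjc (u x))).
    by apply: eq_Rintegral => x _; rewrite !ReImE /=; ring.
  by rewrite E; apply: eq_Rintegral => x _; rewrite !ReImE /=; ring.
have [||p' [q' [ri ei]]] := rep2_of_weak2 HI ui wi.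
- by move=> p' q' pE qE pp; exact: (middle _ _ _ pE qE pp wi).
- move=> h rh; have [ch sh ch' sh'] := rtestP rh; have [_ _ ch2 sh2] := rtestP (rtest_derive1 rh).
  have NN (f g : R -> R) : continuous g -> supported I g -> L2r I f ->
      \int[mu]_(x in I) - (f x * g x) = - \int[mu]_(x in I) (f x * g x).
    move=> cg sg ff; rewrite -mulN1r -RintegralZl //.
      by apply: eq_Rintegral => x _; rewrite mulN1r.
    exact: (integrable_pair HI (L2r_lint HI ff) cg sg).
  rewrite !P //; have /(congr1 Im) /= := H _ rh => E.
  (* Conjugation reverses the sign of the imaginary parts on both sides. *)
  apply: oppr_inj; rewrite -!NN //.
  transitivity (\int[mu]_(x in I) Im ((derive1 (derive1 h) x)%:C * conjc (u x))).
    by apply: eq_Rintegral => x _; rewrite !ReImE /=; ring.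
  by rewrite E; apply: eq_Rintegral => x _; rewrite !ReImE /=; ring.
exists (fun x => p x +i* p' x), (fun x => q x +i* q' x).
by split => //; apply/complex_ae_eqP.
Qed.
End interval.
End ComplexRep.

(** * Prescribing boundary data *)

Section BoundaryData.
Context {R : realType}.
Notation mu := (@lebesgue_measure R).
Notation Re := (@complex.Re R).
Notation Im := (@complex.Im R).
Implicit Types (p q : R -> R).
Local Open Scope complex_scope.

Lemma smooth_left (a b al be : R) : a < b -> exists U : R -> R,
  [/\ smooth U, U a = al, derive1 U a = be & forall t, b <= t -> U t = 0 /\ derive1 U t = 0].
Proof.
move=> ab; pose c := flat 0 (b - a); pose d := flat 2 (b - a).
have c0 : c != 0 by rewrite /c /flat subr_gt0 ab expr0 mul1r gt_eqF // expR_gt0.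
(* [flat 2] is the derivative of [flat 0], so value and slope of [U] at [a] are A c and B c - A d;
   these equations determine A and B. *)
pose A := al / c; pose B := (be + A * d) / c.
pose U t := (A + B * (t - a)) * flat 0 (b - t).
have dU t : is_derive t (1:R) U (B * flat 0 (b - t) - (A + B * (t - a)) * flat 2 (b - t)).
  have d1 : is_derive t (1:R) (fun t => b - t) (-1).
    by apply: is_derive_eq (is_deriveB (is_derive_cst b t (1:R)) (is_derive_id t (1:R))) _; rewrite sub0r.
  have d2 := @is_derive1_comp _ (flat 0) (fun t => b - t) t _ _ (is_derive_flat 0 (b - t)) d1.
  have d3 : is_derive t (1:R) (fun t => A + B * (t - a)) B.
    have h := is_deriveD (is_derive_cst A t (1:R))
      (is_deriveZ B (is_deriveB (is_derive_id t (1:R)) (is_derive_cst a t (1:R)))).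
    by apply: is_derive_eq h _; rewrite /GRing.scale /= subr0 mulr1 add0r.
  apply: is_derive_eq (is_deriveM d3 d2) _; rewrite /GRing.scale /=; ring.
exists U; split.
- apply: elem_smooth_smooth.
  have := elem_mul (elem_aff B (A - B * a) elem_id) (elem_aff (-1) b (elem_flat 0)).
  by congr elem_smooth; apply/funext => t; rewrite /U; congr (_ * flat 0 _); ring.
- by rewrite /U subrr mulr0 addr0 /A -/c divfK.
- rewrite (is_derive1_val (dU a)) subrr mulr0 addr0 -/c -/d /B divfK //; ring.
- move=> t bt; have z n : flat n (b - t) = 0 by rewrite /flat subr_gt0 ltNge bt.
  by rewrite (is_derive1_val (dU t)) /U !z !mulr0 subrr.
Qed.

Lemma smooth_right (a b al be : R) : a < b -> exists U : R -> R,
  [/\ smooth U, U b = al, derive1 U b = be, U a = 0 & derive1 U a = 0].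
Proof.
move=> ab; have nab : - b < - a by rewrite ltrN2.
(* Reflection t -> - t, which changes the sign of the derivative. *)
have [V [sV Vb V'b V0]] := smooth_left al (- be) nab.
have [V0a V'0a] := V0 _ (lexx _).
have dV t : is_derive t (1:R) (fun t => V (- t)) (- derive1 V (- t)).
  have := @is_derive1_comp _ V (fun t => - t) t _ _ (smooth_is_derive sV (- t)) (is_deriveN (is_derive_id t (1:R))).
  by move=> h; apply: is_derive_eq h _; rewrite mulrN1.
exists (fun t => V (- t)); split; [|exact: Vb| |exact: V0a|].
- have sm n : forall W : R -> R, smooth W -> forall x, derivable (derive1n n (fun t => W (- t))) x 1.
    elim: n => [|n IH] W sW x.
      have := @is_derive1_comp _ W (fun t => - t) x _ _ (smooth_is_derive sW (- x)) (is_deriveN (is_derive_id x (1:R))).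
      by case.
    have -> : derive1n n.+1 (fun t => W (- t)) = derive1n n (fun t => (fun s => -1 * derive1 W s) (- t)).
      rewrite /derive1n iterSr; congr iter; apply/funext => t; apply: is_derive1_val.
      have := @is_derive1_comp _ W (fun t => - t) t _ _ (smooth_is_derive sW (- t)) (is_deriveN (is_derive_id t (1:R))).
      by move=> h; apply: is_derive_eq h _; rewrite mulrC.
    exact: (IH (fun s => -1 * derive1 W s) (@smoothZ R (-1) _ (smooth_derive1 sW)) x).
  by move=> n x; exact: sm.
- by rewrite (is_derive1_val (dV b)) V'b opprK.
- by rewrite (is_derive1_val (dV a)) V'0a oppr0.
Qed.

Section interval.
Variables (I : set R) (a : R).
Hypothesis HI : open_ray_part I a.
Let oI := orp_open HI.
Let aI := orp_lb HI.
Let mI : measurable (I : set (measurableTypeR R)). Proof. exact: open_measurable. Qed.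

(** The restricted integrand may jump at the ends of [I], so its primitive is differentiated only
    inside, and the mean value theorem with continuity reaches the ends. *)
Lemma prim_patch_FTC (V W : R -> R) x : continuous W -> (forall t, is_derive t (1:R) V (W t)) ->
  lint (W \_ I) -> a <= x -> (forall t, a < t < x -> I t) ->
  prim (W \_ I) x = V x - V a.
Proof.
move=> cW dV lW; rewrite le_eqVlt => /predU1P[<- _|ax axI].
  by rewrite subrr (prim_restrict_le HI).
have dP t : I t -> is_derive t (1:R) (prim (W \_ I)) (W t).
  move=> It; have t1 : t < t + 1 by rewrite ltrDl.
  have ct : {for t, continuous (W \_ I)}.
    have h : \forall s \near t, W s = (W \_ I) s.
      have : nbhs t I by exact: open_nbhs_nbhs.
      by apply: filterS => s Is; rewrite restrict0E mem_set.
    rewrite /prop_for /continuous_at restrict0E mem_set //.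
    exact: (cvg_trans (near_eq_cvg h) (cW t)).
  case: (@continuous_FTC1 R (W \_ I) -oo%O t (t + 1) t1 (lW _) _ ct) => [|h1 h2].
    by rewrite ltNyr.
  by apply: DeriveDef => //; rewrite -derive1E h2 restrict0E mem_set.
have [||c _] := @MVT R (prim (W \_ I) - V) (fun=> 0) a x ax.
- move=> t; rewrite in_itv /= => /axI It.
  by have := is_deriveB (dP t It) (dV t); rewrite subrr.
- apply: continuous_subspaceT => t; apply: cvgB; first exact: continuous_prim.
  exact: (is_derive_continuous dV).
have pa : prim (W \_ I) a = 0 by exact: (prim_restrict_le HI).
by rewrite mul0r !fctE pa sub0r opprK => h; lra.
Qed.

(** [U] itself need not satisfy the identities of [rep2], which hold on the whole line. Primitives
    of its restricted derivatives do, and they agree with [U] up to the ends of [I]. *)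
Lemma rep2_of_smooth (U : R -> R) : smooth U -> L2r I U -> L2r I (derive1 U) -> L2r I (derive1 (derive1 U)) ->
  (forall x y, I x -> a < y < x -> I y) ->
  exists u v w, rep2 I a u v w /\
   forall x, a <= x -> (forall t, a < t < x -> I t) -> u x = U x /\ v x = derive1 U x.
Proof.
move=> sU U0 U1 U2 axI; have sU1 := smooth_derive1 sU; have sU2 := smooth_derive1 sU1.
have l2 := L2r_lint HI U2; have l1 := L2r_lint HI U1.
pose v x := derive1 U a + prim (derive1 (derive1 U) \_ I) x.
have vE x : a <= x -> (forall t, a < t < x -> I t) -> v x = derive1 U x.
  move=> ax h; rewrite /v (_ : prim _ x = derive1 U x - derive1 U a); first by ring.
  exact: (prim_patch_FTC (smooth_continuous sU2) (smooth_is_derive sU1) l2 ax h).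
have vI x : I x -> v x = derive1 U x by move=> Ix; apply: vE => [|t]; [exact/ltW/aI|exact: axI].
have lvE : v \_ I = derive1 U \_ I.
  by apply/funext => x; rewrite !restrict0E; case: ifPn => //; rewrite inE; exact: vI.
pose u x := U a + prim (v \_ I) x.
have uE x : a <= x -> (forall t, a < t < x -> I t) -> u x = U x.
  move=> ax h; rewrite /u lvE (_ : prim _ x = U x - U a); first by ring.
  exact: (prim_patch_FTC (smooth_continuous sU1) (smooth_is_derive sU) l1 ax h).
exists u, v, (derive1 (derive1 U)); split; last by move=> x ax h; rewrite uE // vE.
split => //.
- apply: eq_L2r U0 => // x Ix; rewrite uE //; [exact/ltW/aI|by move=> t; exact: axI].
- by apply: eq_L2r U1 => // x Ix; rewrite vI.
- by move=> x; rewrite /u (prim_restrict_cst HI).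
- by move=> x; rewrite /v (prim_restrict_cst HI).
Qed.

Lemma L2r_vanish p b : continuous p -> (forall t, b <= t -> p t = 0) -> L2r I p.
Proof.
move=> cp p0; have mp := continuous_measurable_fun cp.
split; first exact: measurable_funTS.
have mD : measurable ((`]-oo, b]%classic : set (measurableTypeR R)) `&` I) by exact: measurableI.
have [M hM] : exists M, forall t, a <= t <= b -> `|p t| <= M.
  have : compact (p @` `[a, b]).
    by apply: continuous_compact; [exact: continuous_subspaceT|exact: segment_compact].
  move=> /compact_bounded [M [_ hM]]; exists (M + 1) => t h.
  by apply: (hM (M + 1)); [rewrite ltrDl|exists t => //=; rewrite in_itv].
have : mu.-integrable (`]-oo, b] `&` I) (EFin \o (fun t => p t ^+ 2)).
  apply: measurable_bounded_integrable => //.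
  - exact: (finite_ray_part HI).
  - by apply: measurable_funX; exact: measurable_funTS.
  - exists (M ^+ 2); split; first exact: num_real.
    move=> z Mz t [/=]; rewrite in_itv /= => tb /aI at_; rewrite normrX; apply: ltW; apply: le_lt_trans Mz.
    have tM : `|p t| <= M by apply: hM; rewrite tb ltW.
    by rewrite lerXn2r ?nnegrE // (le_trans _ tM).
move=> /integrable_mkcond - /(_ mD) h; apply/integrable_mkcond => //.
apply: eq_integrable h => // t _; rewrite !patchE in_setI.
case: (boolP (t \in I)) => It; rewrite ?andbT ?andbF //; case: ifPn => //.
rewrite notin_setE /= in_itv /= => /negP; rewrite -ltNge => yt.
by rewrite /= p0 ?expr0n // ltW.
Qed.
End interval.

Lemma rep2_ray_data (a al be : R) : exists u v w,
  [/\ rep2 `]a, +oo[%classic a u v w, u a = al & v a = be].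
Proof.
have HI := open_ray_part_ray a.
have aa : a < a + 1 by rewrite ltrDl.
have [U [sU Ua U'a U0]] := smooth_left al be aa.
have sU1 := smooth_derive1 sU; have sU2 := smooth_derive1 sU1.
(* [U] and its derivative vanish from a + 1 on; from a + 2 on a full neighbourhood lies in that
   range, so the second derivative vanishes as well. *)
have U2 t : a + 2 <= t -> derive1 (derive1 U) t = 0.
  move=> at_; rewrite derive1E (@near_eq_derive _ _ _ _ (cst 0)) ?derive_cst //.
  near=> s; have [] := U0 s; last by [].
  apply: ltW; near: s; apply: lt_nbhsr; lra.
have [||||u [v [w [r H]]]] := rep2_of_smooth HI sU.
- by apply: (L2r_vanish HI (smooth_continuous sU)) => t /U0[].
- by apply: (L2r_vanish HI (smooth_continuous sU1)) => t /U0[].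
- exact: (L2r_vanish HI (smooth_continuous sU2) U2).
- by move=> x y _ /andP[ay _] /=; rewrite in_itv /= andbT.
have [|e1 e2] := H a (lexx a); first by move=> t /andP[h1 h2]; have := lt_trans h1 h2; rewrite ltxx.
by exists u, v, w; split => //; rewrite ?e1 ?e2.
Unshelve. all: by end_near.
Qed.

Lemma rep2_itv_data (a b al be al' be' : R) : a < b -> exists u v w,
  [/\ rep2 `]a, b[%classic a u v w, u a = al, v a = be, u b = al' & v b = be'].
Proof.
move=> ab; have HI := open_ray_part_itv ab.
have [U [sU Ua U'a U0]] := smooth_left al be ab.
have [V [sV Vb V'b Va V'a]] := smooth_right al' be' ab.
have [Ub U'b] := U0 _ (lexx b).
(* Each summand vanishes with its derivative at the opposite end, so the data at the two ends do not
   interact. *)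
pose W t := U t + V t; have sW : smooth W by exact: smoothD.
have W' t : derive1 W t = derive1 U t + derive1 V t.
  by apply: is_derive1_val; apply: is_deriveD; exact: smooth_is_derive.
have B p : continuous p -> L2r `]a, b[%classic p.
  move=> cp; have [M hM] : exists M, forall t, a <= t <= b -> `|p t| <= M.
    have : compact (p @` `[a, b]).
      by apply: continuous_compact; [exact: continuous_subspaceT|exact: segment_compact].
    move=> /compact_bounded [M [_ hM]]; exists (M + 1) => t h.
    by apply: (hM (M + 1)); [rewrite ltrDl|exists t => //=; rewrite in_itv].
  apply: (L2r_bounded (M := M)); [exact: measurable_itv|exact: itv_finite_measure_oo| |].
    by apply: measurable_funTS; exact: continuous_measurable_fun.
  by move=> x /=; rewrite in_itv /= => /andP[h1 h2]; apply: hM; rewrite !ltW.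
have sW1 := smooth_derive1 sW; have sW2 := smooth_derive1 sW1.
have [||||u [v [w [r H]]]] := rep2_of_smooth HI sW.
- by apply: B; exact: smooth_continuous.
- by apply: B; exact: smooth_continuous.
- by apply: B; exact: smooth_continuous.
- by move=> x y /=; rewrite !in_itv /= => /andP[ax xb] /andP[-> yx]; exact: lt_trans yx xb.
have [|e1 e2] := H a (lexx a); first by move=> t /andP[h1 h2]; have := lt_trans h1 h2; rewrite ltxx.
have [|e3 e4] := H b (ltW ab); first by move=> t h; rewrite /= in_itv.
exists u, v, w; split => //; rewrite ?e1 ?e2 ?e3 ?e4 ?W' /W.
- by rewrite Ua Va addr0.
- by rewrite U'a V'a addr0.
- by rewrite Ub Vb add0r.
- by rewrite U'b V'b add0r.
Qed.

Lemma exhausted_ray (a : R) : exhausted `]a, +oo[%classic.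
Proof.
exists (fun n => a + n.+1%:R^-1), (fun n => a + n.+1%:R); split.
  by move=> n; rewrite /= !in_itv /= !andbT !ltrDl invr_gt0 ltr0n.
move=> t /=; rewrite in_itv /= andbT => at_.
have ta : 0 < t - a by rewrite subr_gt0.
near=> n; apply/andP; split.
  rewrite -lerBrDl; apply: ltW; near: n.
  have := @cvg_harmonic R; move/cvgrPdist_lt => /(_ _ ta); apply: filterS => n /=.
  by rewrite sub0r normrN gtr0_norm // invr_gt0.
rewrite -lerBlDl; apply: (@le_trans _ _ n%:R); last by rewrite ler_nat.
near: n; exact: nbhs_infty_ger.
Unshelve. all: by end_near.
Qed.

Lemma exhausted_itv (a b : R) : a < b -> exhausted `]a, b[%classic.
Proof.
(* Half the length keeps both sequences inside the interval; at n = 0 they meet at the midpoint. *)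
move=> ab; pose d := (b - a) / 2; have d0 : 0 < d by rewrite divr_gt0 // subr_gt0.
exists (fun n => a + d * n.+1%:R^-1), (fun n => b - d * n.+1%:R^-1).
have n1 (n : nat) : 0 < d * (n.+1%:R : R)^-1 <= d.
  apply/andP; split; first by rewrite mulr_gt0 // invr_gt0.
  by rewrite ler_pdivrMr // ler_peMr ?ler1n // ltW.
split.
  move=> n; have /andP[h1 h2] := n1 n; rewrite /= !in_itv /=; move: h1 h2; move: (d * _) => z.
  by rewrite /d => h1 h2; split; apply/andP; split; lra.
move=> t /=; rewrite in_itv /= => /andP[at_ tb].
have e0 : 0 < Num.min (t - a) (b - t) / d by rewrite divr_gt0 // lt_min !subr_gt0 at_.
near=> n.
have : (n.+1%:R : R)^-1 < Num.min (t - a) (b - t) / d.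
  near: n; have := @cvg_harmonic R; move/cvgrPdist_lt => /(_ _ e0); apply: filterS => n /=.
  by rewrite sub0r normrN gtr0_norm // invr_gt0.
move: (n.+1%:R^-1 : R) => z; rewrite ltr_pdivlMr // lt_min [z * d]mulrC => /andP[].
by move: (d * z) => y h1 h2; apply/andP; split; lra.
Unshelve. all: by end_near.
Qed.

Lemma closure_left (a : R) (I : set R) e : 0 < e -> (forall x, a < x < a + e -> I x) -> closure I a.
Proof.
move=> e0 h B /nbhs_ballP[d /= d0 hd].
have m0 : 0 < Num.min d e / 2 by rewrite divr_gt0 // lt_min d0.
have [m1 m2] : Num.min d e <= d /\ Num.min d e <= e by rewrite !ge_min !lexx orbT.
exists (a + Num.min d e / 2); split; first by apply: h; apply/andP; split; lra.
by apply: hd; rewrite /ball /= opprD addNKr normrN gtr0_norm //; lra.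
Qed.

Lemma closure_right (a : R) (I : set R) e : 0 < e -> (forall x, a - e < x < a -> I x) -> closure I a.
Proof.
move=> e0 h B /nbhs_ballP[d /= d0 hd].
have m0 : 0 < Num.min d e / 2 by rewrite divr_gt0 // lt_min d0.
have [m1 m2] : Num.min d e <= d /\ Num.min d e <= e by rewrite !ge_min !lexx orbT.
exists (a - Num.min d e / 2); split; first by apply: h; apply/andP; split; lra.
by apply: hd; rewrite /ball /= opprB addrC subrK gtr0_norm //; lra.
Qed.
End BoundaryData.

(** * The boundary form on the graph *)

Section Graph.
Context {R : realType}.
Variables (N : nat) (L : R).
Hypothesis L0 : 0 < L.
Notation mu := (@lebesgue_measure R).
Notation Re := (@complex.Re R).
Notation Im := (@complex.Im R).
Local Open Scope complex_scope.
Implicit Types (U V W F G : gfun R N) (e : edge N).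
Notation eI := (@edge_interior R N L).

Definition edge_left e : R := if e is Some _ then L else - L.

Lemma edge_orp e : open_ray_part (eI e) (edge_left e).
Proof.
case: e => [j|] /=; first exact: open_ray_part_ray.
by apply: open_ray_part_itv; have := L0; lra.
Qed.

Let mI e : measurable (eI e : set (measurableTypeR R)).
Proof. exact: open_measurable (orp_open (edge_orp e)). Qed.

Lemma edge_closure_L e : closure (eI e) L.
Proof.
case: e => [j|] /=.
  by apply: (@closure_left _ _ _ 1) => // x /andP[h _]; rewrite /= in_itv /= h.
apply: (@closure_right _ _ _ (2 * L)); first by rewrite mulr_gt0.
by move=> x /andP[h1 h2]; rewrite /= in_itv /=; apply/andP; split; lra.
Qed.

Lemma edge_closure_NL : closure (eI None) (- L).
Proof.
apply: (@closure_left _ _ _ (2 * L)); first by rewrite mulr_gt0.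
by move=> x /andP[h1 h2]; rewrite /= in_itv /=; apply/andP; split; lra.
Qed.

Lemma edge_not_L e : ~ eI e L.
Proof. by case: e => [j|] /=; rewrite in_itv /= ltxx ?andbF. Qed.

Lemma edge_not_NL : ~ eI None (- L).
Proof. by rewrite /= in_itv /= ltxx. Qed.

Lemma edge_middle e (w p q : R -> R) : (forall x, p x = p (edge_left e) + prim (q \_ (eI e)) x) ->
  (forall x, q x = q (edge_left e) + prim (w \_ (eI e)) x) -> L2r (eI e) p -> L2r (eI e) w -> L2r (eI e) q.
Proof.
case: e => [j|] /= pE qE pp ww; first exact: (L2r_middle_derivative pE qE).
rewrite (_ : q = (fun x => q (- L) + prim (w \_ `]- L, L[%classic) x)); last by apply/funext.
apply: L2r_prim_bounded.
by apply: (L2r_lint (a := - L)) => //; exact: (edge_orp None).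
Qed.

Lemma edge_exhausted e : exhausted (eI e).
Proof.
case: e => [j|] /=; first exact: exhausted_ray.
by apply: exhausted_itv; have := L0; lra.
Qed.

Definition bracket (u1 v1 u2 v2 : R -> R[i]) x := u1 x * conjc (v2 x) - v1 x * conjc (u2 x).

(** A ray contributes only through its lower end, hence the minus sign. *)
Definition edge_bracket e u1 v1 u2 v2 :=
  if e is Some _ then - bracket u1 v1 u2 v2 L
  else bracket u1 v1 u2 v2 L - bracket u1 v1 u2 v2 (- L).

Lemma edge_green e u1 v1 w1 u2 v2 w2 :
  crep (eI e) (edge_left e) u1 v1 w1 -> crep (eI e) (edge_left e) u2 v2 w2 ->
  Cint (eI e) (fun x => u1 x * conjc (w2 x)) - Cint (eI e) (fun x => w1 x * conjc (u2 x)) =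
  edge_bracket e u1 v1 u2 v2.
Proof.
move=> c1 c2; have HI := edge_orp e; case: e HI c1 c2 => [j|] HI c1 c2.
  rewrite (Cint_green HI (B := fun p1 q1 p2 q2 => - (p1 L * q2 L - q1 L * p2 L)) _ c1 c2); last first.
    by move=> p1 q1 r1 p2 q2 r2 H1 H2; exact: (green_ray H1 H2).
  by apply: complex_ext; rewrite /edge_bracket /bracket !ReImE /=; ring.
rewrite (Cint_green HI (B := fun p1 q1 p2 q2 => (p1 L * q2 L - q1 L * p2 L) -
  (p1 (- L) * q2 (- L) - q1 (- L) * p2 (- L))) _ c1 c2); last first.
  move=> p1 q1 r1 p2 q2 r2 H1 H2; apply: (green_bounded _ H1 H2); have := L0; lra.
by apply: complex_ext; rewrite /edge_bracket /bracket !ReImE /=; ring.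
Qed.

(* [U], [V], [W] are the continuous representative of [U0], that of its
   derivative, and its second derivative. *)
Record grep U0 U V W : Prop := GRep {
  grep_crep : forall e, crep (eI e) (edge_left e) (U e) (V e) (W e);
  grep_L2 : L2G L U0;
  grep_ae : ae_eqG L U0 U }.

Definition neg_second U : gfun R N := fun e x => - wderiv (eI e) (wderiv (eI e) (U e)) x.

Lemma H2G_grep U0 : H2G L U0 -> exists U V W, grep U0 U V W.
Proof.
move=> HU.
have H e : exists t : (R -> R[i]) * (R -> R[i]) * (R -> R[i]),
    crep (eI e) (edge_left e) t.1.1 t.1.2 t.2 /\ ae_eq mu (eI e) (U0 e) t.1.1.
  by have [u [v [w h]]] := H2_crep (edge_orp e) (HU e); exists (u, v, w).
have [f hf] := choice H.
exists (fun e => (f e).1.1), (fun e => (f e).1.2), (fun e => (f e).2); split.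
- by move=> e; have [] := hf e.
- by move=> e; have [] := HU e.
- by move=> e; have [] := hf e.
Qed.

Section values.
Variables (U0 U V W : gfun R N).
Hypothesis g : grep U0 U V W.

Lemma grep_H2G : H2G L U0.
Proof.
by move=> e; have [] := crep_H2 (edge_orp e) (grep_crep g e) (grep_L2 g e) (grep_ae g e).
Qed.

Lemma grep_bval e : bval L U0 e L = U e L.
Proof.
have [_ _ h _] := crep_H2 (edge_orp e) (grep_crep g e) (grep_L2 g e) (grep_ae g e).
exact: h (edge_closure_L e).
Qed.

Lemma grep_bder e : bder L U0 e L = V e L.
Proof.
have [_ _ _ h] := crep_H2 (edge_orp e) (grep_crep g e) (grep_L2 g e) (grep_ae g e).
exact: h (edge_closure_L e).
Qed.

Lemma grep_bvalN : bval L U0 None (- L) = U None (- L).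
Proof.
have [_ _ h _] := crep_H2 (edge_orp None) (grep_crep g None) (grep_L2 g None) (grep_ae g None).
exact: h edge_closure_NL.
Qed.

Lemma grep_bderN : bder L U0 None (- L) = V None (- L).
Proof.
have [_ _ _ h] := crep_H2 (edge_orp None) (grep_crep g None) (grep_L2 g None) (grep_ae g None).
exact: h edge_closure_NL.
Qed.

Lemma grep_sigma : sigma L U0 = U None L - \sum_(j < N) U (Some j) L.
Proof. by rewrite /sigma grep_bval; congr (_ - _); apply: eq_bigr => j _; rewrite grep_bval. Qed.

Lemma grep_neg_second : ae_eqG L (neg_second U0) (fun e x => - W e x).
Proof.
move=> e; have [_ h _ _] := crep_H2 (edge_orp e) (grep_crep g e) (grep_L2 g e) (grep_ae g e).
by apply: ae_imply h => x h Ix; rewrite /neg_second h.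
Qed.

Lemma grep_L2W : L2G L (fun e x => - W e x).
Proof.
move=> e; have [_ _ /(L2P (edge_orp e))[r i]] := crep_L2 (edge_orp e) (grep_crep g e).
have h p : L2r (eI e) p -> L2r (eI e) (fun x => - p x).
  move=> [mp ip]; split; first exact: measurableT_comp.
  by apply: eq_integrable ip => // x _ /=; rewrite sqrrN.
apply/(L2P (edge_orp e)); split.
  by apply: eq_L2r (h _ r) => // x _; rewrite ReN.
by apply: eq_L2r (h _ i) => // x _; rewrite ImN.
Qed.
End values.

Lemma sum_edge (T : nmodType) (f : edge N -> T) : \sum_e f e = f None + \sum_(j < N) f (Some j).
Proof.
rewrite (bigD1 None) //=; congr (_ + _).
rewrite (reindex_omap Some id) //=; last by case.
by apply: eq_bigl => j; rewrite eqxx.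
Qed.

(** As F = - W almost everywhere, the integrand on each edge becomes u1 w2^* - w1 u2^*, the
    derivative of the bracket. *)
Lemma innerG_green U1 V1 W1 U01 F1 U2 V2 W2 U02 F2 :
  grep U01 U1 V1 W1 -> grep U02 U2 V2 W2 -> L2G L F1 -> L2G L F2 ->
  ae_eqG L F1 (neg_second U01) -> ae_eqG L F2 (neg_second U02) ->
  innerG L F1 U02 - innerG L U01 F2 =
  \sum_e edge_bracket e (U1 e) (V1 e) (U2 e) (V2 e).
Proof.
move=> g1 g2 L1 L2' a1 a2; rewrite /innerG -sumrB; apply: eq_bigr => e _.
have HI := edge_orp e.
rewrite -(edge_green (grep_crep g1 e) (grep_crep g2 e)).
have [LU1 _ LW1] := crep_L2 HI (grep_crep g1 e).
have [LU2 _ LW2] := crep_L2 HI (grep_crep g2 e).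
have b1 : ae_eq mu (eI e) (F1 e) (fun x => - W1 e x).
  exact: ae_eq_trans (a1 e) (grep_neg_second g1 e).
have b2 : ae_eq mu (eI e) (F2 e) (fun x => - W2 e x).
  exact: ae_eq_trans (a2 e) (grep_neg_second g2 e).
rewrite (Cint_ae_mul HI (L1 e) (grep_L2W g1 e) (grep_L2 g2 e) LU2 b1 (grep_ae g2 e)).
rewrite (Cint_ae_mul HI (grep_L2 g1 e) LU1 (L2' e) (grep_L2W g2 e) (grep_ae g1 e) b2).
have i1 := L2_Cintegrable HI (grep_L2W g1 e) LU2.
have i2 := L2_Cintegrable HI LU1 (grep_L2W g2 e).
have j1 := L2_Cintegrable HI LW1 LU2.
have j2 := L2_Cintegrable HI LU1 LW2.
rewrite -(CintB HI i1 i2) -(CintB HI j2 j1); congr Cint; apply/funext => x.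
by rewrite rmorphN /=; ring.
Qed.

(** Coupling is assumed of [U1] only: for the adjoint, [U2] is the element whose coupling is still
    to be derived, so the values of [U1] at L cannot yet be gathered into [sigma]. *)
Lemma green_coupled U1 F1 U2 F2 : H2G L U1 -> H2G L U2 -> L2G L F1 -> L2G L F2 ->
  ae_eqG L F1 (neg_second U1) -> ae_eqG L F2 (neg_second U2) -> derivative_coupling L U1 ->
  innerG L F1 U2 - innerG L U1 F2 =
  bval L U1 None L * conjc (bder L U2 None L) - bder L U1 None L * conjc (sigma L U2)
  - bval L U1 None (- L) * conjc (bder L U2 None (- L)) + bder L U1 None (- L) * conjc (bval L U2 None (- L))
  - \sum_(j < N) bval L U1 (Some j) L * conjc (bder L U2 (Some j) L).
Proof.
move=> H1 H2 L1 L2' a1 a2 cp.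
have [u1 [v1 [w1 g1]]] := H2G_grep H1; have [u2 [v2 [w2 g2]]] := H2G_grep H2.
rewrite (innerG_green g1 g2 L1 L2' a1 a2) sum_edge /= /bracket sumrN sumrB.
rewrite (grep_bval g1) !(grep_bder g1) !(grep_bder g2) (grep_bvalN g1) (grep_bvalN g2)
  (grep_bderN g1) (grep_bderN g2) (grep_sigma g2).
have -> : \sum_(j < N) bval L U1 (Some j) L * conjc (bder L U2 (Some j) L) =
  \sum_(j < N) u1 (Some j) L * conjc (v2 (Some j) L).
  by apply: eq_bigr => j _; rewrite (grep_bval g1) (grep_bder g2).
have -> : \sum_(j < N) v1 (Some j) L * conjc (u2 (Some j) L) =
    v1 None L * conjc (\sum_(j < N) u2 (Some j) L).
  rewrite rmorph_sum mulr_sumr; apply: eq_bigr => j _.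
  by rewrite -(grep_bder g1 (Some j)) -(cp j) (grep_bder g1).
rewrite rmorphB /=; ring.
Qed.

Lemma green_coupled2 U1 F1 U2 F2 : H2G L U1 -> H2G L U2 -> L2G L F1 -> L2G L F2 ->
  ae_eqG L F1 (neg_second U1) -> ae_eqG L F2 (neg_second U2) ->
  derivative_coupling L U1 -> derivative_coupling L U2 ->
  innerG L F1 U2 - innerG L U1 F2 =
  sigma L U1 * conjc (bder L U2 None L) - bder L U1 None L * conjc (sigma L U2)
  - bval L U1 None (- L) * conjc (bder L U2 None (- L)) + bder L U1 None (- L) * conjc (bval L U2 None (- L)).
Proof.
move=> H1 H2 L1 L2' a1 a2 c1 c2; rewrite (green_coupled H1 H2 L1 L2' a1 a2 c1).
have -> : \sum_(j < N) bval L U1 (Some j) L * conjc (bder L U2 (Some j) L) =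
   (\sum_(j < N) bval L U1 (Some j) L) * conjc (bder L U2 None L).
  by rewrite mulr_suml; apply: eq_bigr => j _; rewrite (c2 j).
by rewrite [sigma L U1]/sigma; ring.
Qed.

Lemma test_function0 (I : set R) : test_function I (fun=> 0 : R[i]).
Proof.
have s0 : smooth (fun=> 0 : R) by apply: (@elem_smooth_smooth _ (fun=> 0)); exact: elem_cst.
split; [exact: s0|exact: s0|exists set0; split => //; exact: compact0].
Qed.

(** The vertices lie outside the open edges, so a test function, which is its own continuous
    representative, vanishes there with its derivative. *)
Lemma H0_test V : (forall e, test_function (eI e) (V e)) ->
  L2G L V /\ L2G L (fun e x => - Cderive (Cderive (V e)) x) /\
  exists V' W', [/\ grep V V V' W', forall e, V e L = 0 /\ V' e L = 0, V None (- L) = 0 /\ V' None (- L) = 0 &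
    (fun e x => - Cderive (Cderive (V e)) x) = (fun e x => - W' e x)].
Proof.
move=> tV.
have c e : crep (eI e) (edge_left e) (V e) (Cderive (V e)) (Cderive (Cderive (V e))).
  have HI := edge_orp e; have [rr ri] := test_rtest HI (tV e).
  have C p : rtest (eI e) p -> rep2 (eI e) (edge_left e) p (derive1 p) (derive1 (derive1 p)).
    move=> [sp up]; apply: (rep2_C2 HI up).
    - exact: smooth_is_derive.
    - by apply: smooth_is_derive; exact: smooth_derive1.
    - by apply: smooth_continuous; apply: smooth_derive1; exact: smooth_derive1.
  by split; exact: C.
have LV : L2G L V by move=> e; have [] := crep_L2 (edge_orp e) (c e).
have g : grep V V (fun e => Cderive (V e)) (fun e => Cderive (Cderive (V e))).
  by split => // e; exact: ae_eq_refl.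
have Z e x : ~ eI e x -> V e x = 0 /\ Cderive (V e) x = 0.
  move=> nI; have HI := edge_orp e; have [[_ sr] [_ si]] := test_rtest HI (tV e).
  have S p : supported (eI e) p -> p x = 0.
    by move=> sp; rewrite -(supported_patch HI sp) restrict0E memNset.
  split; apply: complex_ext; rewrite /= ?(S _ sr) ?(S _ si) //.
  - exact: S (supported_derive1 sr).
  - exact: S (supported_derive1 si).
split => //; split; first exact: (grep_L2W g).
exists (fun e => Cderive (V e)), (fun e => Cderive (Cderive (V e))); split => //.
- by move=> e; exact: Z (edge_not_L (e := e)).
- exact: Z edge_not_NL.
Qed.

Lemma adjoint_H0 V G : L2G L V -> L2G L G -> (forall U F, H0 L U F -> innerG L F V = innerG L U G) ->
  H2G L V /\ ae_eqG L G (neg_second V).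
Proof.
move=> LV LG H; suff K e : H2 (eI e) (V e) /\ ae_eq mu (eI e) (G e) (neg_second V e).
  by split=> e; have [] := K e.
have HI := edge_orp e.
have LNG : L2 (eI e) (fun x => - G e x).
  have /(L2P HI)[[mr ir] [mi ii]] := LG e; apply/(L2P HI); split; split.
  - by under eq_fun do rewrite ReN; exact: measurableT_comp.
  - by apply: eq_integrable ir => // x _ /=; rewrite ReN sqrrN.
  - by under eq_fun do rewrite ImN; exact: measurableT_comp.
  - by apply: eq_integrable ii => // x _ /=; rewrite ImN sqrrN.
have [|h rh|u [v [c uV]]] := crep_of_weak2 HI _ (LV e) LNG; first exact: edge_middle.
(* A test function carried by the single edge [e] isolates that edge in the inner products. *)
- pose U : gfun R N := fun e' x => if e' == e then (h x)%:C else 0.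
  have tU e' : test_function (eI e') (U e').
    rewrite /U; case: eqP => [->|_]; last exact: test_function0.
    exact: (rtest_test HI rh).
  have [LU [LF _]] := H0_test tU.
  have C0 : Cderive (fun=> 0 : R[i]) = fun=> 0.
    by apply/funext => x; rewrite /Cderive /= derive1_cst0.
  have hU : H0 L U (fun e x => - Cderive (Cderive (U e)) x).
    by split => //; exists U; split => // e'; exact: ae_eq_refl.
  have := H _ _ hU; rewrite /innerG (bigD1 e) //= [X in _ + X]big1 ?addr0; last first.
    move=> e' ne; rewrite /U (negbTE ne) !C0 /Cint /=.
    have z (y : R[i]) : - 0 * y = 0 by rewrite oppr0 mul0r.
    by apply: complex_ext => /=; under eq_Rintegral do rewrite z; rewrite Rintegral_cst ?mul0r.
  rewrite (bigD1 e) //= [X in _ + X]big1 ?addr0; last first.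
    move=> e' ne; rewrite /U (negbTE ne) /Cint /=.
    by apply: complex_ext => /=; under eq_Rintegral do rewrite mul0r; rewrite Rintegral_cst ?mul0r.
  have Uh : U e = fun x => (h x)%:C by apply/funext => x; rewrite /U eqxx.
  have CU : Cderive (Cderive (U e)) = fun x => (derive1 (derive1 h) x)%:C.
    rewrite Uh; apply/funext => x; rewrite /Cderive /=; congr (_ +i* _).
    by rewrite !derive1_cst0.
  have i1 := L2_Cintegrable HI (LF e) (LV e); have i2 := L2_Cintegrable HI (LU e) (LG e).
  move: i1 i2; rewrite CU Uh => i1 i2 E.
  transitivity (- Cint (eI e) (fun x => (h x)%:C * conjc (G e x))).
    rewrite -E -(CintN HI i1); congr Cint; apply/funext => x; by rewrite mulNr opprK.
  by rewrite -(CintN HI i2); congr Cint; apply/funext => x; rewrite rmorphN mulrN.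
have [H2V aW _ _] := crep_H2 HI c (LV e) uV.
split => //; apply: ae_imply aW => x aW Ix; by rewrite /neg_second aW // opprK.
Qed.
End Graph.

(** * The operators H_{a,c,beta} *)

Section Operators.
Context {R : realType}.
Variables (N : nat) (L : R).
Hypothesis L0 : 0 < L.
Notation mu := (@lebesgue_measure R).
Notation Re := (@complex.Re R).
Notation Im := (@complex.Im R).
Local Open Scope complex_scope.
Implicit Types (U V W F G : gfun R N) (e : edge N) (a c : R) (beta : R[i]).
Notation eI := (@edge_interior R N L).

Let mI e : measurable (eI e : set (measurableTypeR R)).
Proof. exact: open_measurable (orp_open (edge_orp L0 e)). Qed.

(** Boundary values and derivatives are independent of each other, which makes the domains large
    enough to determine their adjoints. *)
Lemma exists_boundary_data (z e phi d : R[i]) (p q : 'I_N -> R[i]) : exists U V W,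
  [/\ grep L U U V W, U None (- L) = z /\ V None (- L) = e, U None L = phi /\ V None L = d &
      forall j, U (Some j) L = p j /\ V (Some j) L = q j].
Proof.
have LL : - L < L by have := L0; lra.
have H (x : edge N) : exists t : (R -> R[i]) * (R -> R[i]) * (R -> R[i]),
    crep (eI x) (edge_left L x) t.1.1 t.1.2 t.2 /\
    if x is Some j then t.1.1 L = p j /\ t.1.2 L = q j
    else [/\ t.1.1 (- L) = z, t.1.2 (- L) = e, t.1.1 L = phi & t.1.2 L = d].
  case: x => [j|].
    have [u [v [w [r h1 h2]]]] := rep2_ray_data L (Re (p j)) (Re (q j)).
    have [u' [v' [w' [r' h1' h2']]]] := rep2_ray_data L (Im (p j)) (Im (q j)).
    exists (fun x => u x +i* u' x, fun x => v x +i* v' x, fun x => w x +i* w' x); split; first by split.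
    by rewrite /= h1 h2 h1' h2'; case: (p j) => ? ?; case: (q j).
  have [u [v [w [r h1 h2 h3 h4]]]] := rep2_itv_data (Re z) (Re e) (Re phi) (Re d) LL.
  have [u' [v' [w' [r' h1' h2' h3' h4']]]] := rep2_itv_data (Im z) (Im e) (Im phi) (Im d) LL.
  exists (fun x => u x +i* u' x, fun x => v x +i* v' x, fun x => w x +i* w' x); split; first by split.
  rewrite /= h1 h2 h3 h4 h1' h2' h3' h4'.
  by case: z {h1 h1' h3 h3' h2 h2' h4 h4'} => ? ?; case: e => ? ?; case: phi => ? ?; case: d.
have [f hf] := choice H.
exists (fun e => (f e).1.1), (fun e => (f e).1.2), (fun e => (f e).2); split.
- split=> x; [exact: (hf x).1| |exact: ae_eq_refl].
  by have [] := crep_L2 (edge_orp L0 x) (hf x).1.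
- by have [_ [-> ->]] := hf None.
- by have [_ [_ _ -> ->]] := hf None.
- by move=> j; have [_ [-> ->]] := hf (Some j).
Qed.

Lemma Habc_exists a c beta (z s : R[i]) (p : 'I_N -> R[i]) : exists U F,
  [/\ Habc L a c beta U F, bval L U None (- L) = z, sigma L U = s &
      forall j, bval L U (Some j) L = p j].
Proof.
(* Once z, sigma and the psi_j(L) are chosen, the conditions dictate the derivatives at both ends,
   and the definition of sigma dictates phi(L). *)
pose d := - (beta^* * z + c%:C * s).
have [U [V [W [g [z1 e1] [p1 d1] pj]]]] :=
  exists_boundary_data z (a%:C * z + beta * s) (s + \sum_(j < N) p j) d p (fun=> d).
have sE : sigma L U = s.
  rewrite (grep_sigma L0 g) p1 (_ : \sum_(j < N) U (Some j) L = \sum_(j < N) p j) ?addrK //.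
  by apply: eq_bigr => j _; have [-> _] := pj j.
exists U, (fun e x => - W e x); split => //.
- split.
  + split.
    * exact: (grep_H2G L0 g).
    * by move=> j; rewrite !(grep_bder L0 g) d1; have [_ ->] := pj j.
    * by rewrite (grep_bderN L0 g) (grep_bvalN L0 g) sE e1 z1.
    * by rewrite (grep_bder L0 g) (grep_bvalN L0 g) sE d1 z1 /d opprK.
  + exact: (grep_L2W L0 g).
  + by move=> e; apply: ae_eq_sym; exact: (grep_neg_second L0 g e).
- by rewrite (grep_bvalN L0 g).
- by move=> j; rewrite (grep_bval L0 g); have [] := pj j.
Qed.

(** Membership is tested on fixed representatives, whose boundary values are point evaluations and
    therefore linear. *)
Lemma Habc_grep a c beta U0 U V W F : grep L U0 U V W -> L2G L F -> ae_eqG L F (fun e x => - W e x) ->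
  (forall j, V None L = V (Some j) L) ->
  V None (- L) = a%:C * U None (- L) + beta * (U None L - \sum_(j < N) U (Some j) L) ->
  - V None L = beta^* * U None (- L) + c%:C * (U None L - \sum_(j < N) U (Some j) L) ->
  Habc L a c beta U0 F.
Proof.
move=> g LF FW cp E1 E2; split => //; first split.
- exact: (grep_H2G L0 g).
- by move=> j; rewrite !(grep_bder L0 g) (cp j).
- by rewrite (grep_bderN L0 g) (grep_bvalN L0 g) (grep_sigma L0 g).
- by rewrite (grep_bder L0 g) (grep_bvalN L0 g) (grep_sigma L0 g).
- move=> e; apply: ae_eq_trans (FW e) _; apply: ae_eq_sym; exact: (grep_neg_second L0 g e).
Qed.

Lemma Habc_grepP a c beta U0 U V W F : grep L U0 U V W -> Habc L a c beta U0 F ->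
  [/\ L2G L F, ae_eqG L F (fun e x => - W e x), forall j, V None L = V (Some j) L,
   V None (- L) = a%:C * U None (- L) + beta * (U None L - \sum_(j < N) U (Some j) L) &
   - V None L = beta^* * U None (- L) + c%:C * (U None L - \sum_(j < N) U (Some j) L)].
Proof.
move=> g [[_ cp E1 E2] LF FW]; split => //.
- by move=> e; apply: ae_eq_trans (FW e) _; exact: (grep_neg_second L0 g e).
- by move=> j; rewrite -!(grep_bder L0 g) (cp j).
- by move: E1; rewrite (grep_bderN L0 g) (grep_bvalN L0 g) (grep_sigma L0 g).
- by move: E2; rewrite (grep_bder L0 g) (grep_bvalN L0 g) (grep_sigma L0 g).
Qed.

Lemma H0_Habc a c beta U F : H0 L U F -> Habc L a c beta U F.
Proof.
move=> [LU LF [V [tV UV FV]]].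
have [LV [LVF [V' [W' [g Z [z1 z2] E]]]]] := H0_test L0 tV.
have gU : grep L U V V' W' by split => //; exact: grep_crep g.
apply: (Habc_grep gU LF).
- by rewrite -E.
- by move=> j; have [_ ->] := Z None; have [_ ->] := Z (Some j).
- by rewrite z1 z2; have [-> _] := Z None; rewrite big1 ?subr0 ?mulr0 ?addr0 // => j _; have [] := Z (Some j).
- by rewrite z1; have [-> ->] := Z None; rewrite big1 ?subr0 ?mulr0 ?addr0 ?oppr0 // => j _; have [] := Z (Some j).
Qed.

Lemma Habc_operator a c beta : is_operator L (Habc (N := N) L a c beta).
Proof.
split.
- by move=> U F [[HU _ _ _] LF _]; split => // e; have [] := HU e.
- move=> U F U' F' UF LU' LF' UU' FF'.
  have [[HU _ _ _] _ _] := UF; have [u [v [w g]]] := H2G_grep L0 HU.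
  have [LF Fw cp E1 E2] := Habc_grepP g UF.
  have g' : grep L U' u v w.
    split => //; first exact: grep_crep g.
    by move=> e; exact: ae_eq_trans (ae_eq_sym (UU' e)) (grep_ae g e).
  apply: (Habc_grep g') => //.
  by move=> e; exact: ae_eq_trans (ae_eq_sym (FF' e)) (Fw e).
- apply: H0_Habc; have t0 e : test_function (eI e) ((fun _ _ => 0) e : R -> R[i]) by exact: test_function0.
  have [L1 [L2' _]] := H0_test L0 t0.
  have C0 : Cderive (fun=> 0 : R[i]) = fun=> 0.
    by apply/funext => x; rewrite /Cderive /= derive1_cst0.
  split => //; exists (fun _ _ => 0); split => //; first by move=> e; exact: ae_eq_refl.
  by move=> e; rewrite !C0; apply: aeW => x _; rewrite oppr0.
- move=> z U F V G UF VG.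
  have [[HU _ _ _] _ _] := UF; have [[HV _ _ _] _ _] := VG.
  have [u [v [w g]]] := H2G_grep L0 HU; have [u' [v' [w' g']]] := H2G_grep L0 HV.
  have [LF Fw cp E1 E2] := Habc_grepP g UF; have [LG Gw cp' E1' E2'] := Habc_grepP g' VG.
  have L2lin (f h : gfun R N) : L2G L f -> L2G L h -> L2G L (fun e x => z * f e x + h e x).
    move=> Lf Lh e; have HI := edge_orp L0 e.
    have /(L2P HI)[fr fi] := Lf e; have /(L2P HI)[hr hi] := Lh e.
    apply/(L2P HI); split.
      have := L2r_lin (Re z) (mI e) (L2r_lin (- Im z) (mI e) hr fi) fr.
      by apply: eq_L2r => // x _; rewrite !ReImE; ring.
    have := L2r_lin (Re z) (mI e) (L2r_lin (Im z) (mI e) hi fr) fi.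
    by apply: eq_L2r => // x _; rewrite !ReImE; ring.
  have gl : grep L (fun e x => z * U e x + V e x) (fun e x => z * u e x + u' e x)
      (fun e x => z * v e x + v' e x) (fun e x => z * w e x + w' e x).
    split.
    + by move=> e; apply: (crep_lin (edge_orp L0 e)); [exact: grep_crep g e|exact: grep_crep g' e].
    + by apply: L2lin; [exact: grep_L2 g|exact: grep_L2 g'].
    + move=> e; apply: ae_imply2 (grep_ae g e) (grep_ae g' e) => x h1 h2 Ix.
      by rewrite h1 // h2.
  apply: (Habc_grep gl); first exact: L2lin.
  + move=> e; apply: ae_imply2 (Fw e) (Gw e) => x h1 h2 Ix.
    by rewrite h1 // h2 //; ring.
  + by move=> j; rewrite (cp j) (cp' j).
  + by rewrite E1 E1' big_split /= -mulr_sumr; ring.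
  + by rewrite opprD -mulrN E2 E2' big_split /= -mulr_sumr; ring.
- move=> U F F' [_ _ a1] [_ _ a2] e; exact: ae_eq_trans (a1 e) (ae_eq_sym (a2 e)).
Qed.

Lemma conjc_lin2 (x y z w : R[i]) : conjc (x * y + z * w) = conjc x * conjc y + conjc z * conjc w.
Proof. by rewrite rmorphD !rmorphM. Qed.

(** With x = (z, s) and M the Hermitian parameter matrix, the form is the difference of the inner
    products of M x with x' and of x with M x'. *)
Lemma boundary_form0 a c beta (z s e d z' s' e' d' : R[i]) :
  e = a%:C * z + beta * s -> - d = conjc beta * z + c%:C * s ->
  e' = a%:C * z' + beta * s' -> - d' = conjc beta * z' + c%:C * s' ->
  s * conjc d' - d * conjc s' - z * conjc e' + e * conjc z' = 0.
Proof.
move=> -> hd -> hd'; rewrite -[d]opprK -[d']opprK hd hd' [conjc (- _)]rmorphN /=.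
by rewrite !conjc_lin2 !conjc_real conjcK; ring.
Qed.

Lemma Habc_symmetric a c beta U F V G : Habc L a c beta U F -> Habc L a c beta V G ->
  innerG L F V = innerG L U G.
Proof.
move=> [[HU cU E1 E2] LF FU] [[HV cV E1' E2'] LG GV].
apply/eqP; rewrite -subr_eq0 (green_coupled2 L0 HU HV LF LG FU GV cU cV).
by apply/eqP; exact: (boundary_form0 E1 E2 E1' E2').
Qed.

Lemma adjoint_Habc a c beta V G : adjoint L (Habc L a c beta) V G -> Habc L a c beta V G.
Proof.
move=> [LV LG H].
have [HV GV] : H2G L V /\ ae_eqG L G (neg_second L V).
  by apply: (adjoint_H0 L0) => // U F UF; apply: H; exact: H0_Habc.
(* Green's formula against domain elements realizing arbitrary z, s and psi_j(L) = p j: an identity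
   in free variables, from which each condition is a coefficient. *)
have K (z s : R[i]) (p : 'I_N -> R[i]) :
    (s + \sum_(j < N) p j) * conjc (bder L V None L)
    + (conjc beta * z + c%:C * s) * conjc (sigma L V)
    - z * conjc (bder L V None (- L)) + (a%:C * z + beta * s) * conjc (bval L V None (- L))
    - \sum_(j < N) p j * conjc (bder L V (Some j) L) = 0.
  have [U [F [UF zE sE pE]]] := Habc_exists a c beta z s p.
  have [[HU cU E1 E2] LF FU] := UF.
  have := green_coupled L0 HU HV LF LG FU GV cU.
  rewrite (H _ _ UF) subrr zE E1 zE sE.
  have -> : bval L U None L = s + \sum_(j < N) p j.
    by rewrite -sE /sigma (eq_bigr p) ?subrK // => j _; exact: pE.
  have -> : bder L U None L = - (conjc beta * z + c%:C * s) by rewrite -zE -sE -E2 opprK.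
  have -> : \sum_(j < N) bval L U (Some j) L * conjc (bder L V (Some j) L) =
            \sum_(j < N) p j * conjc (bder L V (Some j) L) by apply: eq_bigr => j _; rewrite pE.
  by move=> h; rewrite [RHS]h; ring.
have K0 (z s : R[i]) : s * conjc (bder L V None L) + (conjc beta * z + c%:C * s) * conjc (sigma L V)
    - z * conjc (bder L V None (- L)) + (a%:C * z + beta * s) * conjc (bval L V None (- L)) = 0.
  have := K z s (fun=> 0); rewrite big1 // addr0 big1 ?subr0 // => j _; by rewrite mul0r.
split => //; split => //.
(* Taking z = s = 0 and the indicator of [j] isolates the derivatives of phi and psi_j at L. *)
- move=> j; have := K 0 0 (fun k => (k == j)%:R).
  rewrite (bigD1 j) //= eqxx big1 => [|k /negbTE ->//].
  rewrite [X in _ - X](bigD1 j) //= eqxx [X in _ - (_ + X)]big1 => [|k /negbTE ->]; last by rewrite mul0r.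
  rewrite !mulr0 !addr0 !mul0r !mul1r add0r subr0 addr0 => /eqP; rewrite subr_eq0 => /eqP h.
  by move: h; rewrite ?mul1r ?addr0 => h; rewrite -[LHS]conjcK h conjcK.
(* The choice (1, 0) gives the conjugate of the condition at - L, and (0, 1) below that of the
   condition at L. *)
- have := K0 1 0; rewrite !mulr0 !addr0 !mulr1 mul0r mul1r add0r => h.
  apply: (can_inj (@conjcK _)); rewrite conjc_lin2 conjc_real.
  have : conjc beta * conjc (sigma L V) + a%:C * conjc (bval L V None (- L)) - conjc (bder L V None (- L)) = 0.
    by rewrite -[RHS]h; ring.
  by move=> /eqP; rewrite subr_eq0 => /eqP <-; ring.
- have := K0 0 1; rewrite !mulr0 !add0r !mulr1 mul0r mul1r subr0 => h.
  apply: (can_inj (@conjcK _)); rewrite rmorphN /= conjc_lin2 conjc_real conjcK.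
  by apply/eqP; rewrite eq_sym -subr_eq0 opprK -[X in _ == X]h; apply/eqP; ring.
Qed.

(** Functions supported inside the edges have zero boundary data and lie in every one of these
    domains; they are dense edge by edge. *)
Lemma Habc_dense a c beta : densely_defined L (Habc (N := N) L a c beta).
Proof.
move=> U LU eps e0.
(* Real and imaginary parts cost at most 2 d per edge, hence eps / 2 in all. *)
pose d := eps / (4 * (#|edge N|)%:R).
have N0 : 0 < (#|edge N|)%:R :> R by rewrite ltr0n; apply/card_gt0P; exists None.
have d0 : 0 < d by rewrite divr_gt0 // mulr_gt0.
have H e : exists t : (R -> R[i]) * (R -> R[i]) * (R -> R[i]),
   [/\ crep (eI e) (edge_left L e) t.1.1 t.1.2 t.2,
     forall x, ~ eI e x -> t.1.1 x = 0 /\ t.1.2 x = 0 &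
     dist2 (eI e) (fun x => Re (U e x)) (fun x => Re (t.1.1 x)) +
     dist2 (eI e) (fun x => Im (U e x)) (fun x => Im (t.1.1 x)) <= 2 * d].
  have HI := edge_orp L0 e; have /(L2P HI)[ur ui] := LU e.
  have [f [v [w [r1 s1 t1 h1]]]] := L2r_dense HI (edge_exhausted L0 e) ur d0.
  have [f' [v' [w' [r2 s2 t2 h2]]]] := L2r_dense HI (edge_exhausted L0 e) ui d0.
  exists (fun x => f x +i* f' x, fun x => v x +i* v' x, fun x => w x +i* w' x).
  have S p x : supported (eI e) p -> ~ eI e x -> p x = 0.
    by move=> sp nI; rewrite -(supported_patch HI sp) restrict0E memNset.
  split => //=; last by lra.
  by move=> x nI; rewrite !(S _ _ _ nI).
have [f hf] := choice H.
have g : grep L (fun e => (f e).1.1) (fun e => (f e).1.1) (fun e => (f e).1.2) (fun e => (f e).2).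
  split=> e; [by have [] := hf e| |exact: ae_eq_refl].
  by have [h _ _] := hf e; have [] := crep_L2 (edge_orp L0 e) h.
exists (fun e => (f e).1.1); split.
  exists (fun e x => - (f e).2 x).
  have Z e : (f e).1.1 L = 0 /\ (f e).1.2 L = 0.
    by have [_ h _] := hf e; apply: h; exact: edge_not_L.
  have [ZN ZN'] : (f None).1.1 (- L) = 0 /\ (f None).1.2 (- L) = 0.
    by have [_ h _] := hf None; apply: h; exact: edge_not_NL.
  apply: (Habc_grep g); first exact: (grep_L2W L0 g).
  + by move=> e; exact: ae_eq_refl.
  + by move=> j; have [_ ->] := Z None; have [_ ->] := Z (Some j).
  + by rewrite ZN ZN'; have [-> _] := Z None; rewrite big1 ?subr0 ?mulr0 ?addr0 // => j _; have [] := Z (Some j).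
  + by rewrite ZN; have [-> ->] := Z None; rewrite big1 ?subr0 ?mulr0 ?addr0 ?oppr0 // => j _; have [] := Z (Some j).
have E e : (\int[mu]_(x in eI e) (sqnorm (U e x - (f e).1.1 x))%:E)%E =
    (dist2 (eI e) (fun x => Re (U e x)) (fun x => Re ((f e).1.1 x)) +
     dist2 (eI e) (fun x => Im (U e x)) (fun x => Im ((f e).1.1 x)))%:E.
  have HI := edge_orp L0 e; have /(L2P HI)[ur ui] := LU e.
  have /(L2P HI)[fr fi] := grep_L2 g e.
  have [_ i1] := L2rB HI ur fr; have [_ i2] := L2rB HI ui fi.
  rewrite /dist2 -RintegralD // /Rintegral fineK.
    by apply: eq_integral => x _; rewrite /sqnorm !ReImE.
  exact: (integrable_fin_num (mI e) (integrableD (mI e) i1 i2)).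
rewrite /sqnormG (eq_bigr _ (fun e _ => E e)) sumEFin lte_fin.
apply: (@le_lt_trans _ _ (2 * d *+ #|edge N|)).
  apply: (le_trans (y := \sum_(e : edge N) (2 * d))); last by rewrite sumr_const.
  by apply: ler_sum => e _; have [] := hf e.
rewrite -mulr_natr.
have -> : 2 * d * (#|edge N|)%:R = eps / 2 by rewrite /d; field; rewrite gt_eqF.
lra.
Qed.

Lemma Habc_self_adjoint a c beta : self_adjoint L (Habc (N := N) L a c beta).
Proof.
split; [exact: Habc_operator|exact: Habc_dense|move=> U F; split; last exact: adjoint_Habc].
move=> UF; have [[HU _ _ _] LF _] := UF; split => //; first by move=> e; have [] := HU e.
by move=> V G VG; exact: (Habc_symmetric VG UF).
Qed.

(** Domain elements with (z, sigma) = (1, 0) and (0, 1) read off the entries of the parameter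
    matrix. *)
Lemma Habc_inj a c beta a' c' beta' :
  (forall U F, Habc L a c beta U F <-> Habc L a' c' beta' U F) ->
  [/\ a = a', c = c' & beta = beta'].
Proof.
move=> E.
have [U [F [UF z1 s1 _]]] := Habc_exists a c beta 1 0 (fun=> 0).
have [V [G [VG z2 s2 _]]] := Habc_exists a c beta 0 1 (fun=> 0).
have [[_ _ h1 _] _ _] := UF; have [[_ _ h1' _] _ _] := (E _ _).1 UF.
have [[_ _ h2 h3] _ _] := VG; have [[_ _ h2' h3'] _ _] := (E _ _).1 VG.
move: h1 h1' h2 h2' h3 h3'; rewrite z1 s1 z2 s2 !mulr0 !mulr1 !addr0 !add0r.
by move=> -> [ea] -> eb -> [ec].
Qed.

(* The boundary form vanishes on [dom A]; testing it against the elements with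
   [(phi(-L), sigma) = (1, 0)] and [(0, 1)] yields the boundary conditions. *)
Lemma self_adjoint_Habc (A : oper R N) : self_adjoint L A -> extends A (H0 (N := N) L) ->
  (forall U, dom A U -> derivative_coupling L U) -> free_values L A ->
  exists (a c : R) (beta : R[i]), forall U F, A U F <-> Habc L a c beta U F.
Proof.
move=> [opA _ saA] ext cA fv.
have sym U F V G : A U F -> A V G -> innerG L F V = innerG L U G.
  by move=> AU /saA[_ _]; apply.
have LA U F : A U F -> L2G L U /\ L2G L F by have [h _ _ _ _] := opA; exact: h.
have HA U F : A U F -> H2G L U /\ ae_eqG L F (neg_second L U).
  move=> AU; have [LU LF] := LA _ _ AU.
  by apply: (adjoint_H0 L0) => // V G VG; apply: sym => //; exact: ext.
have form U F V G : A U F -> A V G ->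
    sigma L U * conjc (bder L V None L) - bder L U None L * conjc (sigma L V)
  - bval L U None (- L) * conjc (bder L V None (- L)) + bder L U None (- L) * conjc (bval L V None (- L)) = 0.
  move=> AU AV; have [HU FU] := HA _ _ AU; have [HV GV] := HA _ _ AV.
  rewrite -(green_coupled2 L0 HU HV (LA _ _ AU).2 (LA _ _ AV).2 FU GV).
  - by rewrite (sym _ _ _ _ AU AV) subrr.
  - by apply: cA; exists F.
  - by apply: cA; exists G.
have [U1 [[F1 A1] z1 s1]] := fv 1 0; have [U2 [[F2 A2] z2 s2]] := fv 0 1.
set e1 := bder L U1 None (- L); set d1 := bder L U1 None L.
set e2 := bder L U2 None (- L); set d2 := bder L U2 None L.
have f1 V G : A V G -> bder L V None (- L) = conjc e1 * bval L V None (- L) - conjc d1 * sigma L V.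
  move=> AV; have := form _ _ _ _ A1 AV; rewrite z1 s1 mul0r mul1r sub0r -/e1 -/d1 => h.
  apply: (can_inj (@conjcK _)); rewrite rmorphB !rmorphM /= !conjcK.
  by apply/eqP; rewrite eq_sym -subr_eq0 -[X in _ == X]h; apply/eqP; ring.
have f2 V G : A V G -> - bder L V None L = conjc e2 * bval L V None (- L) - conjc d2 * sigma L V.
  move=> AV; have := form _ _ _ _ A2 AV; rewrite z2 s2 mul0r mul1r subr0 -/e2 -/d2 => h.
  apply: (can_inj (@conjcK _)); rewrite rmorphB rmorphN !rmorphM /= !conjcK.
  by apply/eqP; rewrite eq_sym -subr_eq0 opprK -[X in _ == X]h; apply/eqP; ring.
(* Testing the two elements against themselves and each other shows that the matrix with columns
   (e1, - d1) and (e2, - d2) is Hermitian; its entries are the parameters. *)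
have e1r : e1 = conjc e1 by have := f1 _ _ A1; rewrite z1 s1 mulr1 mulr0 subr0.
have e2d : e2 = - conjc d1 by have := f1 _ _ A2; rewrite z2 s2 mulr1 mulr0 sub0r.
have d2r : d2 = conjc d2.
  by have := f2 _ _ A2; rewrite z2 s2 mulr1 mulr0 sub0r => /oppr_inj.
have real (x : R[i]) : x = conjc x -> x = (Re x)%:C.
  case: x => x y [/eqP]; rewrite -addr_eq0 -mulr2n mulrn_eq0 /= => /eqP -> //.
exists (Re e1), (- Re d2), e2.
have sub U F : A U F -> Habc L (Re e1) (- Re d2) e2 U F.
  move=> AU; have [HU FU] := HA _ _ AU; have [_ LF] := LA _ _ AU.
  split => //; split => //; first by apply: cA; exists F.
  - by rewrite (f1 _ _ AU) -e1r -(real _ e1r) e2d; ring.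
  - by rewrite (f2 _ _ AU) -d2r rmorphN /= -(real _ d2r); ring.
move=> U F; split; first exact: sub.
(* An element of the larger operator pairs symmetrically with all of [A], hence belongs to the
   adjoint of [A], which is [A]. *)
move=> UF; apply/saA; have [[HU _ _ _] LF _] := UF; split => //.
  by move=> e; have [] := HU e.
by move=> V G AV; exact: (Habc_symmetric (sub _ _ AV) UF).
Qed.

Lemma Habc_free_values a c beta : free_values L (Habc (N := N) L a c beta).
Proof.
move=> z s; have [U [F [UF zE sE _]]] := Habc_exists a c beta z s (fun=> 0).
by exists U; split => //; exists F.
Qed.
End Operators.

Theorem theorem5p6 (R : realType) (N : nat) (L : R) :
  0 < L -> (0 < N)%N ->
  (forall A : oper R N,
     [/\ self_adjoint L A,
         extends A (H0 (N := N) L),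
         (forall U, dom A U -> derivative_coupling L U)
       & free_values L A]
     <->
     exists (a c : R) (beta : R[i]),
       forall U F, A U F <-> Habc L a c beta U F)
  /\
  (forall (a c a' c' : R) (beta beta' : R[i]),
     (forall U F : gfun R N, Habc L a c beta U F <-> Habc L a' c' beta' U F) ->
     [/\ a = a', c = c' & beta = beta']).
Proof.
move=> L0 _; split=> [A|]; last by move=> a c a' c' beta beta'; exact: Habc_inj.
split=> [[sA eA cA fA]|[a [c [beta AE]]]]; first exact: self_adjoint_Habc.
have -> : A = Habc L a c beta.
  by apply/funext => U; apply/funext => F; exact/propext.
split.
- exact: Habc_self_adjoint.
- by move=> U F; exact: H0_Habc.
- by move=> U [F [[]]].
- exact: Habc_free_values.
Qed.
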